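(* Let $m\ge0$ be an integer. For every integer $N\ge0$, as $t\to0^+$, $$\mathrm{Tr}\,(e^{-tH_m})=\left(\frac1t-\sum_{k=0}^N\frac{(-t)^k}{(k+1)!}\,B_{2k+2}\Big(\frac{m+1}2\Big)+O(t^{N+1})\right)e^{t\frac{m^2+1}{4}} .$$ In particular, as $t\to0^+$, $$\mathrm{Tr}\,(e^{-tH_m})=\frac1t+\frac13+\Big(\frac1{15}-\frac{m^2}{24}\Big)t+\Big(\frac4{315}-\frac{m^2}{40}\Big)t^2+\frac{128-432m^2+49m^4}{40320}\,t^3+O(t^4).$$
   Context: $H_m$ is the magnetic Laplacian on the unit sphere $S^2\subset\mathbb R^3$ (round metric $dr^2+\sin^2r\,d\theta^2$, volume form $\Omega_0=\sin r\,dr\wedge d\theta$) with constant magnetic field $\frac m2\,\Omega_0$, i.e. the magnetic Laplacian acting on sections of the Hermitian line bundle with connection whose curvature is this magnetic field (the total flux being quantized, $m\in\mathbb Z$). For $m\ge0$ its spectrum consists of the eigenvalues $$\nu_{m,j}=j(j+1)+\frac m2(2j+1),\qquad j=0,1,2,\dots,$$ where $\nu_{m,j}$ has multiplicity $m+2j+1$. $B_n(x)=\sum_{p=0}^n\binom np B_p\,x^{n-p}$ is the $n$-th Bernoulli polynomial, where $B_p$ are the Bernoulli numbers (with $B_1=-\tfrac12$). *)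

(* Defs.v *)
From HB Require Import structures.
From mathcomp Require Import all_boot all_order all_algebra.
From mathcomp Require Import complex.
From mathcomp Require Import all_classical all_reals all_analysis.

Set Implicit Arguments.
Unset Strict Implicit.
Unset Printing Implicit Defensive.

Import Order.TTheory GRing.Theory Num.Theory.
Import numFieldNormedType.Exports.

Local Open Scope classical_set_scope.
Local Open Scope complex_scope.
Local Open Scope ring_scope.

Section MagneticLaplacian.
Variable R : realType.

(* The sphere is covered by the two stereographic charts z = tan(r/2) e^(i theta)
   (around r = 0) and w = 1/z (around r = pi), each with image the whole plane,
   identified with R * R.  In both charts the metric dr^2 + sin^2 r dtheta^2 is
     conf(x, y) (dx^2 + dy^2),  conf(x, y) = 4 / (1 + x^2 + y^2)^2,
   and the volume form Omega_0 is conf dx /\ dy: w = 1/z is an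
   orientation-preserving isometry of the sphere. *)
Definition conf (p : R * R) : R := 4 / (1 + p.1 ^+ 2 + p.2 ^+ 2) ^+ 2.

(* Connection 1-form A = m (x dy - y dx) / (1 + x^2 + y^2), in both charts.
   It satisfies dA = (m/2) conf dx /\ dy = (m/2) Omega_0. *)
Definition potx (m : int) (p : R * R) : R :=
  - m%:~R * p.2 / (1 + p.1 ^+ 2 + p.2 ^+ 2).

Definition poty (m : int) (p : R * R) : R :=
  m%:~R * p.1 / (1 + p.1 ^+ 2 + p.2 ^+ 2).

Definition cderive (v : R * R) (f : R * R -> R[i]) (p : R * R) : R[i] :=
  'D_v (fun q => complex.Re (f q)) p +i* 'D_v (fun q => complex.Im (f q)) p.

(* Covariant derivatives nabla = d - i A. *)
Definition nablax (m : int) (f : R * R -> R[i]) (p : R * R) : R[i] :=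
  cderive (1, 0) f p - 'i%C * (potx m p)%:C * f p.

Definition nablay (m : int) (f : R * R -> R[i]) (p : R * R) : R[i] :=
  cderive (0, 1) f p - 'i%C * (poty m p)%:C * f p.

(* - |g|^(-1/2) nabla_j (|g|^(1/2) g^(jk) nabla_k f) for g = conf (dx^2 + dy^2),
   where |g|^(1/2) g^(jk) is the identity matrix. *)
Definition maglap_chart (m : int) (f : R * R -> R[i]) (p : R * R) : R[i] :=
  - ((conf p)^-1)%:C * (nablax m (nablax m f) p + nablay m (nablay m f) p).

(* C^oo: every iterated directional derivative is everywhere differentiable. *)
Definition smooth (f : R * R -> R) : Prop :=
  forall (vs : seq (R * R)) (p : R * R),
    differentiable (foldr (fun v g => 'D_v g) f vs) p.

Definition csmooth (f : R * R -> R[i]) : Prop :=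
  smooth (fun p => complex.Re (f p)) /\ smooth (fun p => complex.Im (f p)).

Definition cplx (p : R * R) : R[i] := p.1 +i* p.2.

(* u.1 (in the z chart) and u.2 (in the w chart) are the local expressions of a
   smooth section of the line bundle.  Where both charts are defined, the two
   potentials differ by m dtheta, whence the transition function e^(-i m theta);
   cplx p * cplx q = 1 says that p and q are the two coordinates of one point. *)
Definition smooth_section (m : int)
    (u : (R * R -> R[i]) * (R * R -> R[i])) : Prop :=
  [/\ csmooth u.1, csmooth u.2 &
      forall p q : R * R, cplx p * cplx q = 1 ->
        u.2 q = (cplx p / `|cplx p|) ^ (- m) * u.1 p].

Definition maglap (m : int) (u : (R * R -> R[i]) * (R * R -> R[i])) :
    (R * R -> R[i]) * (R * R -> R[i]) :=
  (maglap_chart m u.1, maglap_chart m u.2).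

Definition eigensection (m : int) (l : R)
    (u : (R * R -> R[i]) * (R * R -> R[i])) : Prop :=
  smooth_section m u /\
  (forall p, (maglap m u).1 p = l%:C * u.1 p /\
             (maglap m u).2 p = l%:C * u.2 p).

Definition lin_indep (n : nat)
    (u : 'I_n -> (R * R -> R[i]) * (R * R -> R[i])) : Prop :=
  forall c : 'I_n -> R[i],
    (forall p, \sum_(k < n) c k * (u k).1 p = 0 /\
               \sum_(k < n) c k * (u k).2 p = 0) ->
    forall k, c k = 0.

(* The complex dimension, possibly +oo, of the l-eigenspace of the operator
   (so 0 when l is not an eigenvalue). *)
Definition multiplicity (m : int) (l : R) : \bar R :=
  ereal_sup [set (n%:R)%:E | n in [set n : nat |
    exists u : 'I_n -> (R * R -> R[i]) * (R * R -> R[i]),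
      (forall k, eigensection m l (u k)) /\ lin_indep u]].

(* Tr e^(-tH) for H = maglap m: the sum of e^(-tl) over the eigenvalues l of H,
   with multiplicity, as an extended real.  H is an elliptic symmetric operator
   on a compact manifold, so its spectrum consists of real eigenvalues with
   smooth eigensections. *)
Definition heat_trace (m : int) (t : R) : \bar R :=
  \esum_(l in [set: R]) ((expR (- t * l))%:E * multiplicity m l)%E.

End MagneticLaplacian.

Section Bernoulli.
Variable R : numFieldType.

(* [:: B_0; ...; B_n], from B_0 = 1 and
   \sum_(k < n.+2) 'C(n.+2, k) * B_k = 0, solved for B_(n.+1). *)
Fixpoint bernoulli_seq (n : nat) : seq R :=
  if n is n'.+1 then
    let s := bernoulli_seq n' in
    rcons s (- (\sum_(k < n'.+1) 'C(n'.+2, k)%:R * s`_k) / n'.+2%:R)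
  else [:: 1].

Definition bernoulli (n : nat) : R := (bernoulli_seq n)`_n.

Definition bernoulli_poly (n : nat) : {poly R} :=
  \sum_(p < n.+1) ('C(n, p)%:R * bernoulli p) *: 'X^(n - p).

End Bernoulli.

(* Main.v *)
(** Put s = 1 + |z|^2.  A section of the bundle with flux m is u = s^(-m/2) f in
    both charts, where f1(z) = z^m f2(1/z); in this holomorphic frame H_m - m/2
    becomes P_m = D_m^* D_m, with D_m f = s^2 dbar f mapping sections of flux m
    to sections of flux m + 2 and D_m D_m^* = P_(m+2) + m + 2.  Hence D_m is an
    isomorphism from the mu-eigenspace of P_m to the (mu - m - 2)-eigenspace of
    P_(m+2) whenever mu <> 0.  Since the Laplacian of |u|^2 is
    2 |nabla u|^2 - 2 l |u|^2 up to the conformal factor, the maximum principle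
    on the sphere excludes eigenvalues l < 0; so iterating D_m reaches the
    kernel of some D_(m+2j), i.e. the eigenvalues are nu_(m,j), and the
    multiplicity of nu_(m,j) is the dimension of the space of holomorphic
    sections of flux n = m + 2j.  This is n + 1: by Bol's lemma the (n+1)-st
    derivative maps holomorphic sections of flux n to holomorphic sections of
    flux - n - 2, which vanish by the maximum principle again, so a holomorphic
    section is determined by its Taylor polynomial of degree n at a point.

    With a = (m + 1) / 2 the trace is e^(t (m^2 + 1) / 4) times
    sum_j 2 (j + a) e^(-t (j + a)^2), which the Euler-Maclaurin formula for
    g(x) = e^(-t x^2) compares with t^-1 sum_i B_i / i! g^(i)(a). *)

Require Import Defs.
From HB Require Import structures.
From mathcomp Require Import all_boot all_order all_algebra.
From mathcomp Require Import complex ring lra zify.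
From mathcomp Require Import all_classical all_reals all_analysis.

Set Implicit Arguments.
Unset Strict Implicit.
Unset Printing Implicit Defensive.

Import Order.TTheory GRing.Theory Num.Theory.
Import numFieldNormedType.Exports.
Local Open Scope classical_set_scope.
Local Open Scope ring_scope.

(** * Directional derivatives in the plane *)

Section PlaneCalculus.
Variable R : realType.
Implicit Types (f g : R * R -> R) (p v : R * R).

(** There is no integration over the sphere and no spectral theory here. Where one would integrate
    by parts, as in (P_m F, F) = |D_m F|^2, the maximum principle is used instead, in a bundle of
    larger or of negative flux; all it needs of the sphere is compactness, that is, two closed
    squares in the charts. Multiplicities are compared by moving independent families along the
    ladder, so that finite dimension is a conclusion. As [heat_trace] sums over all real numbers,
    the values that are not levels have to be excluded as well.

    The error must be a power of t, while the number of terms that matter grows as t tends to 0.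
    Hence Euler-Maclaurin is run with derivatives of order 2 L, which are O(t^L); one power of t is
    traded for a decay 1 / x^2 that makes the errors of the steps j -> j + 1 summable. A single step
    uses no periodic Bernoulli functions: with B(z) = z / (e^z - 1) and D the derivation, it is the
    identity e^D B(D) = B(D) + D, where e^D is expanded by Taylor's formula. The boundary terms at a
    become Bernoulli polynomials because B(D) x^n = B_n(x). *)

Lemma differentiable_fst p : differentiable (fst : R * R -> R) p.
Proof.
pose f := (fst : {linear (R^o * R^o)%type -> R^o}).
by apply: (@linear_differentiable R (R * R)%type R f) => x; exact: cvg_fst.
Qed.

Lemma differentiable_snd p : differentiable (snd : R * R -> R) p.
Proof.
pose f := (snd : {linear (R^o * R^o)%type -> R^o}).
by apply: (@linear_differentiable R (R * R)%type R f) => x; exact: cvg_snd.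
Qed.

Lemma derive_fst p v : 'D_v (fst : R * R -> R) p = v.1.
Proof.
pose f := (fst : {linear (R^o * R^o)%type -> R^o}).
rewrite deriveE; last exact: differentiable_fst.
by rewrite (@diff_lin R (R * R)%type R f) // => x; exact: cvg_fst.
Qed.

Lemma derive_snd p v : 'D_v (snd : R * R -> R) p = v.2.
Proof.
pose f := (snd : {linear (R^o * R^o)%type -> R^o}).
rewrite deriveE; last exact: differentiable_snd.
by rewrite (@diff_lin R (R * R)%type R f) // => x; exact: cvg_snd.
Qed.

Lemma derive_pairE f p v : differentiable f p ->
  'D_v f p = v.1 * 'D_(1, 0) f p + v.2 * 'D_(0, 1) f p.
Proof.
move=> df; rewrite !deriveE //.
have -> : v = v.1 *: ((1 : R^o), (0 : R^o)) + v.2 *: ((0 : R^o), (1 : R^o)).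
  case: v => a b; congr pair; rewrite /= /GRing.scale /=; ring.
by rewrite linearD !linearZ /= /GRing.scale /=; congr (_ * _ + _ * _); ring.
Qed.

Lemma derive_prod f g p v : differentiable f p -> differentiable g p ->
  'D_v (fun q => f q * g q) p = f p * 'D_v g p + g p * 'D_v f p.
Proof.
by move=> df dg; rewrite (@deriveM R _ f g p v) //; exact: diff_derivable.
Qed.

Lemma derive_plus f g p v : differentiable f p -> differentiable g p ->
  'D_v (fun q => f q + g q) p = 'D_v f p + 'D_v g p.
Proof.
by move=> df dg; rewrite (@deriveD R _ _ f g p v) //; exact: diff_derivable.
Qed.

Lemma derive_opp f p v : differentiable f p ->
  'D_v (fun q => - f q) p = - 'D_v f p.
Proof.
by move=> df; rewrite (@deriveN R _ _ f p v) //; exact: diff_derivable.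
Qed.

Lemma derive_comp1 (phi : R -> R) g p v : differentiable g p ->
  derivable phi (g p) 1 ->
  'D_v (fun q => phi (g q)) p = 'D_1 phi (g p) * 'D_v g p.
Proof.
move=> dg dphi; have dphi' : differentiable phi (g p) by apply/derivable1_diffP.
rewrite deriveE; last exact: differentiable_comp.
rewrite (@diff_comp _ _ _ _ g phi) //= (deriveE _ dg).
by rewrite deriv1E // /GRing.scale /= mulrC derive1E.
Qed.

Lemma derive_comp2 f (phi1 phi2 : R * R -> R) p v :
  differentiable phi1 p -> differentiable phi2 p ->
  differentiable f (phi1 p, phi2 p) ->
  'D_v (fun q => f (phi1 q, phi2 q)) p =
  'D_('D_v phi1 p, 'D_v phi2 p) f (phi1 p, phi2 p).
Proof.
move=> d1 d2 df; have dp := differentiable_pair d1 d2.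
rewrite deriveE; last exact: (differentiable_comp dp df).
rewrite (@diff_comp _ _ _ _ (fun q => (phi1 q, phi2 q)) f) //=.
by rewrite diff_pair // !deriveE.
Qed.

Lemma is_derive_line f p v (t : R) :
  differentiable f (p.1 + t * v.1, p.2 + t * v.2) ->
  is_derive t 1 (fun s : R => f (p.1 + s * v.1, p.2 + s * v.2))
    ('D_v f (p.1 + t * v.1, p.2 + t * v.2)).
Proof.
move=> df; set a := (p.1 + t * v.1, p.2 + t * v.2) in df *.
have E : (fun h : R => h^-1 *: (((fun s : R => f (p.1 + s * v.1, p.2 + s * v.2))
    (h *: (1 : R) + t)) - f a)) = (fun h : R => h^-1 *: (f (h *: v + a) - f a)).
  apply/funext => h; congr (_ *: (f _ - _)).
  by rewrite /a /GRing.scale /=; congr pair; rewrite /= /GRing.scale /=; ring.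
have dv : derivable f a v by exact: diff_derivable.
apply: DeriveDef.
  by rewrite /derivable; under eq_fun do rewrite -/a; rewrite -/a E.
by rewrite /derive -/a E.
Qed.

Lemma MVT_line f p v (h : R) : (forall q, differentiable f q) -> 0 < h ->
  exists2 c : R, 0 < c < h &
    f (p.1 + h * v.1, p.2 + h * v.2) - f p =
    'D_v f (p.1 + c * v.1, p.2 + c * v.2) * h.
Proof.
move=> df h0.
have dl x := @is_derive_line f p v x (df _).
have cl : {within `[0, h], continuous (fun s : R => f (p.1 + s * v.1,
  p.2 + s * v.2))}.
  by apply: derivable_within_continuous => x _; case: (dl x).
have [c] := MVT h0 (fun x _ => dl x) cl.
rewrite in_itv /= => ch E; exists c => //.
by rewrite subr0 !mul0r !addr0 -surjective_pairing in E.
Qed.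

(** The mean value theorem twice: along [u] for the increment of [f] in direction [v], then along
    [v] for ['D_u f]. *)
Lemma second_difference f p (u v : R * R) (h : R) :
  (forall q, differentiable f q) -> (forall q, differentiable ('D_u f) q) ->
  0 < h ->
  exists c d, [/\ 0 < c < h, 0 < d < h &
   f (p.1 + h * u.1 + h * v.1, p.2 + h * u.2 + h * v.2)
   - f (p.1 + h * u.1, p.2 + h * u.2) - f (p.1 + h * v.1, p.2 + h * v.2) + f p
   = 'D_v ('D_u f) (p.1 + c * u.1 + d * v.1, p.2 + c * u.2 +
     d * v.2) * (h * h)].
Proof.
move=> df du h0.
pose shift := fun q : R * R => (q.1 + h * v.1, q.2 + h * v.2).
have d1 q : differentiable (fun q : R * R => q.1 + h * v.1) q.
  by apply: differentiableD => //; exact: differentiable_fst.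
have d2 q : differentiable (fun q : R * R => q.2 + h * v.2) q.
  by apply: differentiableD => //; exact: differentiable_snd.
have dshift q : differentiable shift q by exact: differentiable_pair.
have dfs q : differentiable (fun q => f (shift q)) q.
  exact: (differentiable_comp (dshift q) (df _)).
pose g := fun q : R * R => f (shift q) - f q.
have dg q : differentiable g q by apply: differentiableB.
have [c ch Ec] := MVT_line p u dg h0.
have Dg q : 'D_u g q = 'D_u f (shift q) - 'D_u f q.
  rewrite (@deriveB R _ _ (fun q => f (shift q)) f q u);
    try exact: diff_derivable.
  have E1 : 'D_u (fun q : R * R => q.1 + h * v.1) q = u.1.
    have df1 := differentiable_fst q.
    by rewrite (derive_plus _ df1) ?derive_fst ?derive_cst ?addr0.
  have E2 : 'D_u (fun q : R * R => q.2 + h * v.2) q = u.2.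
    have df2 := differentiable_snd q.
    by rewrite (derive_plus _ df2) ?derive_snd ?derive_cst ?addr0.
  congr (_ - _); apply: etrans (derive_comp2 u (d1 q) (d2 q) (df _)) _.
  by rewrite E1 E2 -surjective_pairing.
pose q := (p.1 + c * u.1, p.2 + c * u.2).
have [d dh Ed] := MVT_line q v du h0.
exists c, d; split => //; rewrite Dg -/q in Ec.
have Ed' : 'D_u f (shift q) - 'D_u f q = _ := Ed.
rewrite Ed' /g in Ec; rewrite mulrA; apply: etrans Ec.
by rewrite /shift /=; ring.
Qed.

Lemma ball_quadrant p (r x y : R) : 0 < x < r / 2 -> 0 < y < r / 2 ->
  ball p r (p.1 + x, p.2 + y).
Proof.
have E (a b : R) : 0 < b < r / 2 -> ball a r (a + b).
  move=> /andP[b0 br]; rewrite /ball /= opprD addNKr normrN gtr0_norm //; lra.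
by move=> xr yr; split; exact: E.
Qed.

(** Schwarz's theorem. The second difference is symmetric in the two directions, so by
    [second_difference] the two mixed derivatives agree at a pair of points arbitrarily close to
    [p]; both are continuous, being differentiable. *)
Lemma derive_swap f p :
  (forall q, differentiable f q) -> (forall v q, differentiable ('D_v f) q) ->
  (forall u v q, differentiable ('D_u ('D_v f)) q) ->
  'D_(1, 0) ('D_(0, 1) f) p = 'D_(0, 1) ('D_(1, 0) f) p.
Proof.
move=> df d1 d2; apply/eqP; rewrite -subr_eq0 -normr_le0.
apply/ler_addgt0Pl => e e0; rewrite addr0.
have key (X Y Z : R) : `|Z - X| < e / 2 -> `|Y - X| < e / 2 -> `|Y - Z| <= e.
  move=> ZX YX; apply: le_trans (ler_distD X Y Z) _.
  by rewrite (splitr e) lerD // ltW // distrC.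
have cA := differentiable_continuous (d2 (0, 1) (1, 0) p).
have cB := differentiable_continuous (d2 (1, 0) (0, 1) p).
move/cvgrPdist_lt : cA => /(_ (e / 2)); rewrite divr_gt0 // => /(_ isT) cA.
move/cvgrPdist_lt : cB => /(_ (e / 2)); rewrite divr_gt0 // => /(_ isT) cB.
have [r r0 Br] := (nbhs_ballP _ _).1 (filterI cA cB).
have rh : 0 < r / 2 by rewrite divr_gt0.
have [c [d [ch dh E]]] := second_difference p (0, 1) df (d1 (1, 0)) rh.
have [c' [d' [ch' dh' E']]] := second_difference p (1, 0) df (d1 (0, 1)) rh.
have rr : 0 < r / 2 * (r / 2) by rewrite mulr_gt0.
have EE : 'D_(0, 1) ('D_(1, 0) f) (p.1 + c, p.2 + d) =
          'D_(1, 0) ('D_(0, 1) f) (p.1 + d', p.2 + c').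
  move: E E'; rewrite /= !(mulr1, mulr0, addr0).
  set A := (X in _ = X * _ -> _); set B := (X in _ -> _ = X * _ -> _) => E E'.
  apply: (mulIf (lt0r_neq0 rr)); apply: etrans (esym E) _; apply: etrans E'.
  by congr (_ + _); rewrite addrAC.
have [/= A1 _] := Br _ (ball_quadrant p ch dh).
have [/= _ B1] := Br _ (ball_quadrant p dh' ch').
rewrite EE in A1; exact: key A1 B1.
Qed.

Lemma gt0_right_of_derive_gt0 (phi : R -> R) (d : R) :
  is_derive (0 : R) 1 phi d -> phi 0 = 0 -> 0 < d ->
  exists2 c : R, 0 < c & forall s, 0 < s -> s < c -> 0 < phi s.
Proof.
move=> [dphi vphi] phi0 d0.
have cv : (fun h : R => h^-1 *: (phi (h *: (1 : R) + 0) - phi 0)) @ 0^' --> d.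
  by rewrite -vphi; exact: dphi.
have := (cvgr_gt _ cv) _ d0; rewrite /nbhs /= => -[c c0 H].
exists c; first exact: c0.
move=> s s0 sc; have Hs : 0 < s^-1 * (phi (s * 1 + 0) - phi 0).
  apply: (H s); last by rewrite gt_eqF.
  by rewrite /= sub0r normrN gtr0_norm.
by move: Hs; rewrite phi0 subr0 addr0 mulr1 pmulr_rgt0 // invr_gt0.
Qed.

(** At the maximum the first derivative vanishes. If the second were positive, the first would be
    positive just after [p] on the line, and [f] would exceed its maximum there. *)
Lemma second_derive_max f p v :
  (forall q, differentiable f q) -> (forall q, differentiable ('D_v f) q) ->
  (forall q, f q <= f p) -> 'D_v ('D_v f) p <= 0.
Proof.
move=> df dv fmax; rewrite leNgt; apply/negP => D2.
pose l := fun s : R => (p.1 + s * v.1, p.2 + s * v.2).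
have l0 : l 0 = p by rewrite /l !mul0r !addr0 -surjective_pairing.
have D1 : 'D_v f p = 0.
  have I : is_derive (0 : R) 1 (fun s => f (l s)) 0.
    apply: (@derive1_at_max R (fun s => f (l s)) (-1) 1 0); rewrite ?ler01 //.
    - by move=> t _; have := @is_derive_line f p v t (df _); case.
    - by rewrite in_itv /= ltr01 ltrN10.
    - by move=> t _; rewrite l0.
  have := @is_derive_line f p v 0 (df _); rewrite -/(l 0) l0 => J.
  by rewrite -(@derive_val _ _ _ _ _ _ _ J) (@derive_val _ _ _ _ _ _ _ I).
have J : is_derive (0 : R) 1 (fun s => 'D_v f (l s)) ('D_v ('D_v f) p).
  by have := @is_derive_line ('D_v f) p v 0 (dv _); rewrite -/(l 0) l0.
have Z : 'D_v f (l 0) = 0 by rewrite l0.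
have [c c0 cP] := gt0_right_of_derive_gt0 J Z D2.
have c2 : 0 < c / 2 by rewrite divr_gt0.
have [s /andP[s0 sc] E] := MVT_line p v df c2.
have sc' : s < c.
  by apply: lt_le_trans sc _; rewrite ler_pdivrMr // ler_peMr ?ler1n // ltW.
have := mulr_gt0 (cP s s0 sc') c2; rewrite -E subr_gt0 ltNge => /negP; apply.
exact: fmax.
Qed.

End PlaneCalculus.

(** * Smooth functions *)

Section Smoothness.
Variable R : realType.
Implicit Types (f g : R * R -> R) (p v : R * R).

(** Grading [smooth] by the order allows induction: a derivative of a product, or of [hrho], is an
    expression in functions already controlled to the lower order. *)
Fixpoint Ck (n : nat) (f : R * R -> R) : Prop :=
  (forall p, differentiable f p) /\
  (if n is n'.+1 then forall v, Ck n' ('D_v f) else True).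

Lemma CkW n f : Ck n.+1 f -> Ck n f.
Proof.
elim: n f => [|n IH] f [df] D; split => // v.
by apply: IH; exact: D.
Qed.

Lemma smoothP f : smooth f <-> forall n, Ck n f.
Proof.
have key n g : Ck n g <-> forall vs, (size vs <= n)%N ->
    forall p, differentiable (foldr (fun v g => 'D_v g) g vs) p.
  elim: n g => [|n IH] g; split.
  - by case=> dg _ [].
  - by move=> H; split=> //; exact: (H [::]).
  - move=> [dg Dg]; elim/last_ind => // vs v _; rewrite size_rcons ltnS => sv p.
    by rewrite foldr_rcons; exact: ((IH ('D_v g)).1 (Dg v) vs sv p).
  - move=> H; split; first exact: (H [::]).
    move=> v; apply/IH => vs sv p.
    by have := H (rcons vs v); rewrite size_rcons ltnS foldr_rcons; exact.
split => [sf n|H vs p].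
  by apply/key => vs _ p; exact: sf.
exact: ((key (size vs) f).1 (H _) vs (leqnn _) p).
Qed.

Lemma smooth_differentiable f p : smooth f -> differentiable f p.
Proof. by move/(_ [::] p). Qed.

Lemma smooth_derive f v : smooth f -> smooth ('D_v f).
Proof. by move=> /smoothP H; apply/smoothP => n; have [_] := H n.+1; exact. Qed.

Lemma smooth_cst (a : R) : smooth (fun=> a).
Proof.
apply/smoothP => n; elim: n a => [|n IH] a; split=> // v.
have -> : 'D_v (fun _ : R * R => a) = fun=> 0; last exact: IH.
by apply/funext => p; rewrite derive_cst.
Qed.

Lemma CkD n f g : Ck n f -> Ck n g -> Ck n (fun p => f p + g p).
Proof.
elim: n f g => [|n IH] f g [df Df] [dg Dg].
  by split=> // p; exact: differentiableD.
split=> [p|v]; first exact: differentiableD.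
have -> : 'D_v (fun p => f p + g p) = fun p => 'D_v f p + 'D_v g p.
  by apply/funext => p; exact: derive_plus.
exact: IH (Df v) (Dg v).
Qed.

Lemma CkM n f g : Ck n f -> Ck n g -> Ck n (fun p => f p * g p).
Proof.
elim: n f g => [|n IH] f g Cf Cg.
  by split=> // p; apply: differentiableM; [case: Cf | case: Cg].
have [df Df] := Cf; have [dg Dg] := Cg.
split=> [p|v]; first exact: differentiableM.
have -> : 'D_v (fun p => f p * g p) =
    fun p => f p * 'D_v g p + g p * 'D_v f p.
  by apply/funext => p; exact: derive_prod.
by apply: CkD; [exact: IH (CkW Cf) (Dg v) | exact: IH (CkW Cg) (Df v)].
Qed.

Lemma smoothD f g : smooth f -> smooth g -> smooth (fun p => f p + g p).
Proof. by move=> /smoothP sf /smoothP sg; apply/smoothP => n; exact: CkD. Qed.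

Lemma smoothM f g : smooth f -> smooth g -> smooth (fun p => f p * g p).
Proof. by move=> /smoothP sf /smoothP sg; apply/smoothP => n; exact: CkM. Qed.

Lemma smoothN f : smooth f -> smooth (fun p => - f p).
Proof.
move=> sf; rewrite (_ : (fun p => - f p) = fun p => (-1) * f p).
  by apply: smoothM => //; exact: smooth_cst.
by apply/funext => p; rewrite mulN1r.
Qed.

Lemma smoothB f g : smooth f -> smooth g -> smooth (fun p => f p - g p).
Proof. by move=> sf sg; apply: smoothD => //; exact: smoothN. Qed.

Lemma smooth_fst : smooth (fst : R * R -> R).
Proof.
apply/smoothP => n; have df p : differentiable (fst : R * R -> R) p.
  exact: differentiable_fst.
case: n => [|n]; split=> // v.
rewrite (_ : 'D_v _ = fun=> v.1); first exact: (smoothP _).1 (smooth_cst _) n.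
by apply/funext => p; rewrite derive_fst.
Qed.

Lemma smooth_snd : smooth (snd : R * R -> R).
Proof.
apply/smoothP => n; have df p : differentiable (snd : R * R -> R) p.
  exact: differentiable_snd.
case: n => [|n]; split=> // v.
rewrite (_ : 'D_v _ = fun=> v.2); first exact: (smoothP _).1 (smooth_cst _) n.
by apply/funext => p; rewrite derive_snd.
Qed.

Lemma smooth_derive_swap f p : smooth f ->
  'D_(1, 0) ('D_(0, 1) f) p = 'D_(0, 1) ('D_(1, 0) f) p.
Proof.
move=> sf; apply: derive_swap => [q|v q|u v q];
  apply: smooth_differentiable => //.
  exact: smooth_derive.
by do 2!apply: smooth_derive.
Qed.

Definition rho p : R := 1 + p.1 ^+ 2 + p.2 ^+ 2.

Lemma rho_gt0 p : 0 < rho p.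
Proof. by rewrite /rho -addrA ltr_pwDl // addr_ge0 // sqr_ge0. Qed.

Lemma smooth_rho : smooth rho.
Proof.
apply: smoothD; first apply: smoothD; first exact: smooth_cst.
  by apply: smoothM; exact: smooth_fst.
by apply: smoothM; exact: smooth_snd.
Qed.

Lemma derive_rho p v : 'D_v rho p = 2 * (p.1 * v.1 + p.2 * v.2).
Proof.
have d1 := differentiable_fst p; have d2 := differentiable_snd p.
have d11 : differentiable (fun q : R * R => q.1 * q.1) p by exact:
  differentiableM.
have d22 : differentiable (fun q : R * R => q.2 * q.2) p by exact:
  differentiableM.
have dc : differentiable (fun _ : R * R => 1 : R) p by [].
have dc1 : differentiable (fun q : R * R => 1 +
  q.1 * q.1 : R) p by exact: differentiableD.
have -> : rho = fun q => (1 + q.1 * q.1) + q.2 * q.2 by apply/funext => q;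
  rewrite /rho !expr2.
rewrite (derive_plus v dc1 d22) (derive_plus v dc d11) derive_cst.
by rewrite (derive_prod v d1 d1) (derive_prod v d2 d2) !derive_fst !derive_snd;
  ring.
Qed.

(** Its powers [rho ^ (- m / 2)] relate the holomorphic and the unitary frame; odd flux requires the
    square root. *)
Definition hrho p : R := (Num.sqrt (rho p))^-1.

Lemma hrho_gt0 p : 0 < hrho p.
Proof. by rewrite invr_gt0 sqrtr_gt0 rho_gt0. Qed.

Lemma sqr_hrho p : hrho p ^+ 2 = (rho p)^-1.
Proof. by rewrite exprVn sqr_sqrtr // ltW // rho_gt0. Qed.

Lemma differentiable_hrho p : differentiable hrho p.
Proof.
have s0 := rho_gt0 p.
apply: (@differentiableV R _ (fun p => Num.sqrt (rho p))).
  apply: (@differentiable_comp _ _ _ _ rho Num.sqrt).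
    exact: smooth_differentiable smooth_rho.
  by apply/derivable1_diffP; case: (is_derive1_sqrt s0).
by rewrite gt_eqF // sqrtr_gt0.
Qed.

Lemma derive_hrho p v : 'D_v hrho p = - (p.1 * v.1 + p.2 * v.2) * hrho p ^+ 3.
Proof.
have s0 := rho_gt0 p.
have sq0 : Num.sqrt (rho p) != 0 by rewrite gt_eqF // sqrtr_gt0.
have drho := smooth_differentiable p smooth_rho.
have [dsq vsq] := is_derive1_sqrt s0.
have dc : differentiable (fun p => Num.sqrt (rho p)) p.
  apply: (@differentiable_comp _ _ _ _ rho Num.sqrt) => //.
  by apply/derivable1_diffP.
have E := @deriveV R _ (fun p => Num.sqrt (rho p)) p v sq0 (diff_derivable dc).
apply: etrans E _.
rewrite (derive_comp1 v drho dsq) vsq derive_rho /hrho /GRing.scale /=.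
by field.
Qed.

(** The derivative of [hrho] is a linear function times [hrho ^ 3], so the induction on the order
    closes on itself. *)
Lemma smooth_hrho : smooth hrho.
Proof.
apply/smoothP; elim=> [|n IH]; first by split=> // p;
  exact: differentiable_hrho.
split=> [p|v]; first exact: differentiable_hrho.
rewrite (_ : 'D_v hrho = fun p => - (p.1 * v.1 + p.2 * v.2) *
   (hrho p * (hrho p * hrho p))).
  apply: CkM; last exact: CkM IH (CkM IH IH).
  exact: ((smoothP _).1 (smoothN (smoothD (smoothM smooth_fst (smooth_cst v.1))
    (smoothM smooth_snd (smooth_cst v.2)))) n).
by apply/funext => p; rewrite derive_hrho.
Qed.

End Smoothness.

(** * Wirtinger calculus *)

Section ComplexCalculus.
Variable R : realType.
Local Notation C := R[i].
Local Notation Re := complex.Re.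
Local Notation Im := complex.Im.
Implicit Types (f g : R * R -> C) (p v : R * R).

Lemma cReM (a b : C) : Re (a * b) = Re a * Re b - Im a * Im b.
Proof. by case: a b => [a1 a2] [b1 b2]. Qed.

Lemma cImM (a b : C) : Im (a * b) = Re a * Im b + Im a * Re b.
Proof. by case: a b => [a1 a2] [b1 b2]. Qed.

Lemma cReD (a b : C) : Re (a + b) = Re a + Re b.
Proof. by case: a b => [a1 a2] [b1 b2]. Qed.

Lemma cImD (a b : C) : Im (a + b) = Im a + Im b.
Proof. by case: a b => [a1 a2] [b1 b2]. Qed.

Lemma eq_C (a b : C) : Re a = Re b -> Im a = Im b -> a = b.
Proof. by case: a b => [a1 a2] [b1 b2] /= -> ->. Qed.

Lemma conjCM (a b : C) : (a * b)^*%C = a^*%C * b^*%C.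
Proof. exact: rmorphM. Qed.

Lemma conjCD (a b : C) : (a + b)^*%C = a^*%C + b^*%C.
Proof. exact: rmorphD. Qed.

Definition cdiff f p :=
  differentiable (fun q => Re (f q)) p /\ differentiable (fun q => Im (f q)) p.

Lemma cderiveM f g p v : cdiff f p -> cdiff g p ->
  cderive v (fun q => f q * g q) p = cderive v f p * g p + f p * cderive v g p.
Proof.
move=> [df1 df2] [dg1 dg2].
have E1 : (fun q => Re (f q * g q)) =
    fun q => Re (f q) * Re (g q) + - (Im (f q) * Im (g q)).
  by apply/funext => q; rewrite cReM.
have E2 : (fun q => Im (f q * g q)) =
    fun q => Re (f q) * Im (g q) + Im (f q) * Re (g q).
  by apply/funext => q; rewrite cImM.
rewrite /cderive E1 E2.
have d11 := differentiableM df1 dg1; have d22 := differentiableM df2 dg2.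
have d12 := differentiableM df1 dg2; have d21 := differentiableM df2 dg1.
have dN := differentiableN d22.
rewrite (derive_plus v d11 dN) (derive_plus v d12 d21) (derive_opp v d22).
rewrite (derive_prod v df1 dg1) (derive_prod v df2 dg2).
rewrite (derive_prod v df1 dg2) (derive_prod v df2 dg1).
have key (a1 a2 b1 b2 x1 x2 y1 y2 : R) :
    Complex (a1 * y1 + b1 * x1 + - (a2 * y2 + b2 * x2))
      (a1 * y2 + b2 * x1 + (a2 * y1 + b1 * x2)) =
    (x1 +i* x2)%C * (b1 +i* b2)%C + (a1 +i* a2)%C * (y1 +i* y2)%C.
  by apply: eq_C; rewrite !(cReD, cImD, cReM, cImM) /=; ring.
by rewrite key; congr (_ * _ + _ * _); apply: eq_C.
Qed.

Lemma cderiveD f g p v : cdiff f p -> cdiff g p ->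
  cderive v (fun q => f q + g q) p = cderive v f p + cderive v g p.
Proof.
move=> [df1 df2] [dg1 dg2].
have E1 : (fun q => Re (f q + g q)) = fun q => Re (f q) + Re (g q).
  by apply/funext => q; rewrite cReD.
have E2 : (fun q => Im (f q + g q)) = fun q => Im (f q) + Im (g q).
  by apply/funext => q; rewrite cImD.
by rewrite /cderive E1 E2 (derive_plus v df1 dg1) (derive_plus v df2 dg2).
Qed.

Lemma cdiffM f g p : cdiff f p -> cdiff g p -> cdiff (fun q => f q * g q) p.
Proof.
move=> [df1 df2] [dg1 dg2]; split.
- under eq_fun do rewrite cReM.
  by apply: differentiableB; exact: differentiableM.
- under eq_fun do rewrite cImM.
  by apply: differentiableD; exact: differentiableM.
Qed.

Lemma cdiffD f g p : cdiff f p -> cdiff g p -> cdiff (fun q => f q + g q) p.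
Proof.
move=> [df1 df2] [dg1 dg2]; split.
- by under eq_fun do rewrite cReD; exact: differentiableD.
- by under eq_fun do rewrite cImD; exact: differentiableD.
Qed.

Lemma csmoothM f g : csmooth f -> csmooth g -> csmooth (fun q => f q * g q).
Proof.
move=> [df1 df2] [dg1 dg2]; split.
- under eq_fun do rewrite cReM.
  by apply: smoothB; exact: smoothM.
- under eq_fun do rewrite cImM.
  by apply: smoothD; exact: smoothM.
Qed.

Lemma csmoothD f g : csmooth f -> csmooth g -> csmooth (fun q => f q + g q).
Proof.
move=> [df1 df2] [dg1 dg2]; split.
- by under eq_fun do rewrite cReD; exact: smoothD.
- by under eq_fun do rewrite cImD; exact: smoothD.
Qed.

Lemma csmooth_cst (a : C) : csmooth (fun=> a).
Proof. by split; exact: smooth_cst. Qed.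

Lemma csmoothZ a f : csmooth f -> csmooth (fun q => a * f q).
Proof. exact/csmoothM/csmooth_cst. Qed.

Lemma csmoothN f : csmooth f -> csmooth (fun q => - f q).
Proof. by move=> /(csmoothZ (-1)); under eq_fun do rewrite mulN1r. Qed.

Lemma csmoothX f n : csmooth f -> csmooth (fun q => f q ^+ n).
Proof.
move=> sf; elim: n => [|n IH]; first exact: csmooth_cst.
by under eq_fun do rewrite exprS; exact: csmoothM.
Qed.

Lemma csmooth_sum n (F : 'I_n -> R * R -> C) :
  (forall k, csmooth (F k)) -> csmooth (fun q => \sum_(k < n) F k q).
Proof.
elim: n F => [|n IH] F sF.
  by under eq_fun do rewrite big_ord0; exact: csmooth_cst.
under eq_fun do rewrite big_ord_recl.
by apply: csmoothD => //; exact: IH.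
Qed.

Lemma csmooth_real (f : R * R -> R) : smooth f -> csmooth (fun q => (f q)%:C%C).
Proof. by move=> sf; split => //; exact: smooth_cst. Qed.

Lemma csmooth_cplx : csmooth (@cplx R).
Proof. by split; [exact: smooth_fst | exact: smooth_snd]. Qed.

Definition zbar p : C := (cplx p)^*%C.

Lemma csmooth_conj f : csmooth f -> csmooth (fun q => (f q)^*%C).
Proof.
move=> [sf1 sf2]; split; [move: sf1 | move: (smoothN sf2)];
  by congr (smooth _); apply/funext => q; case: (f q).
Qed.

Lemma csmooth_zbar : csmooth zbar.
Proof. exact: csmooth_conj csmooth_cplx. Qed.

Lemma csmooth_cderive f v : csmooth f -> csmooth (cderive v f).
Proof. by move=> [sf1 sf2]; split; exact: smooth_derive. Qed.

Lemma csmooth_cdiff f p : csmooth f -> cdiff f p.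
Proof. by move=> [sf1 sf2]; split; exact: smooth_differentiable. Qed.

(* [a] and [b] are the Wirtinger derivatives (d/dz) f and (d/dzbar) f at [p]. *)
Definition wder f p (a b : C) :=
  cdiff f p /\ forall v, cderive v f p = cplx v * a + zbar v * b.

Definition dz f p : C := (cderive (1, 0) f p - 'i%C * cderive (0, 1) f p) / 2.
Definition dzb f p : C := (cderive (1, 0) f p + 'i%C * cderive (0, 1) f p) / 2.

Lemma mul_ii : 'i%C * 'i%C = -1 :> C.
Proof. by apply: eq_C; rewrite /= ; ring. Qed.

Lemma cplx10 : cplx (1, 0) = 1 :> C. Proof. by []. Qed.
Lemma cplx01 : cplx (0, 1) = 'i%C :> C. Proof. by []. Qed.
Lemma zbar10 : zbar (1, 0) = 1.
Proof. by apply: eq_C; rewrite /= ?oppr0. Qed.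
Lemma zbar01 : zbar (0, 1) = - 'i%C.
Proof. by apply: eq_C; rewrite /= ?oppr0. Qed.

Lemma wder_dz f p a b : wder f p a b -> dz f p = a.
Proof.
move=> [_ W]; rewrite /dz !W cplx10 cplx01 zbar10 zbar01.
transitivity ((a * (1 - 'i%C * 'i%C) + b * (1 + 'i%C * 'i%C)) / 2);
  first by field.
by rewrite mul_ii; field.
Qed.

Lemma wder_dzb f p a b : wder f p a b -> dzb f p = b.
Proof.
move=> [_ W]; rewrite /dzb !W cplx10 cplx01 zbar10 zbar01.
transitivity ((a * (1 + 'i%C * 'i%C) + b * (1 - 'i%C * 'i%C)) / 2);
  first by field.
by rewrite mul_ii; field.
Qed.

Lemma wderP f p : cdiff f p -> wder f p (dz f p) (dzb f p).
Proof.
move=> df; split=> // v; have [df1 df2] := df.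
have E : cderive v f p = (v.1)%:C%C * cderive (1,
  0) f p + (v.2)%:C%C * cderive (0, 1) f p.
  rewrite /cderive (derive_pairE v df1) (derive_pairE v df2).
  have key (x y a b c d : R) : Complex (x * a + y * b) (x * c + y * d) =
      x%:C%C * (a +i* c)%C + y%:C%C * (b +i* d)%C.
    by apply: eq_C; rewrite !(cReD, cImD, cReM, cImM) /=; ring.
  exact: key.
rewrite E /dz /dzb.
have -> : cplx v = (v.1)%:C%C + 'i%C * (v.2)%:C%C.
  by apply: eq_C; rewrite !(cReD, cImD, cReM, cImM) /=; ring.
have -> : zbar v = (v.1)%:C%C - 'i%C * (v.2)%:C%C.
  by rewrite -mulrN; apply: eq_C; rewrite !(cReD, cImD, cReM, cImM) /=; ring.
set a := cderive _ _ _; set b := cderive _ _ _; set x := _%:C%C;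
  set y := _%:C%C.
have i2 := mul_ii; transitivity (x * a - ('i%C * 'i%C) * y * b);
  first by rewrite i2; ring.
by field.
Qed.

Lemma wder_csmooth f p : csmooth f -> wder f p (dz f p) (dzb f p).
Proof. by move=> sf; apply: wderP; exact: csmooth_cdiff. Qed.

Lemma wder_eq f p a b a' b' : wder f p a b -> a = a' -> b = b' ->
  wder f p a' b'.
Proof. by move=> ? <- <-. Qed.

Lemma wder_cst (c : C) p : wder (fun=> c) p 0 0.
Proof.
split; first exact: csmooth_cdiff (csmooth_cst c).
by move=> v; rewrite /cderive !derive_cst !mulr0 addr0.
Qed.

Lemma wderM f g p a b c d : wder f p a b -> wder g p c d ->
  wder (fun q => f q * g q) p (a * g p + f p * c) (b * g p + f p * d).
Proof.
move=> [df Wf] [dg Wg]; split; first exact: cdiffM.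
by move=> v; rewrite cderiveM // Wf Wg; ring.
Qed.

Lemma wderD f g p a b c d : wder f p a b -> wder g p c d ->
  wder (fun q => f q + g q) p (a + c) (b + d).
Proof.
move=> [df Wf] [dg Wg]; split; first exact: cdiffD.
by move=> v; rewrite cderiveD // Wf Wg; ring.
Qed.

Lemma wderZ k f p a b : wder f p a b -> wder (fun q =>
  k * f q) p (k * a) (k * b).
Proof.
by move=> W; apply: wder_eq (wderM (wder_cst k p) W) _ _; rewrite mul0r add0r.
Qed.

Lemma wderN f p a b : wder f p a b -> wder (fun q => - f q) p (- a) (- b).
Proof.
move=> /(wderZ (-1)); rewrite !mulN1r.
by under eq_fun do rewrite mulN1r.
Qed.

Lemma wderX f p a b n : wder f p a b ->
  wder (fun q => f q ^+ n) p (n%:R * f p ^+ n.-1 * a) (n%:R * f p ^+ n.-1 * b).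
Proof.
move=> W; elim: n => [|n IH].
  by rewrite !mul0r; exact: wder_cst.
under eq_fun do rewrite exprS.
apply: wder_eq (wderM W IH) _ _; case: n {IH} => [|n] /=;
  rewrite -?[n.+2%:R]natr1 -?natr1 ?exprS; ring.
Qed.

Lemma wder_cplx p : wder (@cplx R) p 1 0.
Proof.
split; first exact: csmooth_cdiff csmooth_cplx.
move=> v; rewrite mulr1 mulr0 addr0 /cderive.
by apply: eq_C => /=; [exact: derive_fst | exact: derive_snd].
Qed.

Lemma wder_conj f p a b : wder f p a b -> wder (fun q =>
  (f q)^*%C) p b^*%C a^*%C.
Proof.
move=> [[d1 d2] W].
have E1 : (fun q => Re (f q)^*%C) = fun q => Re (f q) by apply/funext => q;
  case: (f q).
have E2 : (fun q => Im (f q)^*%C) = fun q => - Im (f q) by apply/funext => q;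
  case: (f q).
split; first by split; rewrite ?E1 ?E2 //; exact: differentiableN.
move=> v; have := congr1 conjc (W v); rewrite /zbar conjCD !conjCM conjcK addrC
  => <-.
rewrite /cderive E1 E2 derive_opp //.
Qed.

Lemma wder_zbar p : wder zbar p 0 1.
Proof.
have := wder_conj (wder_cplx p).
by rewrite conjc0 conjc1.
Qed.

Lemma wder_comp f (phi : R * R -> R * R) p a b c d :
  wder (fun q => cplx (phi q)) p a b -> wder f (phi p) c d ->
  wder (fun q => f (phi q)) p (c * a + d * b^*%C) (c * b + d * a^*%C).
Proof.
move=> [[dp1 dp2] Wp] [[df1 df2] Wf].
have dphi : differentiable phi p.
  have := differentiable_pair dp1 dp2.
  by congr (differentiable _ p); apply/funext => q;
    rewrite /= -surjective_pairing.
split.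
  by split; [exact: differentiable_comp dphi df1 | exact: differentiable_comp
    dphi df2].
move=> v.
have E : cderive v (fun q => f (phi q)) p =
    cderive ('D_v (fun q => (phi q).1) p, 'D_v (fun q =>
      (phi q).2) p) f (phi p).
  rewrite /cderive.
  have H (F : R * R -> R) : differentiable F (phi p) ->
     'D_v (fun q => F (phi q)) p =
     'D_('D_v (fun q => (phi q).1) p, 'D_v (fun q => (phi q).2) p) F (phi p).
    move=> dF; rewrite (surjective_pairing (phi p)) in dF *.
    rewrite -(derive_comp2 v dp1 dp2 dF).
    by congr ('D_v _ p); apply/funext => q; rewrite -surjective_pairing.
  by rewrite (H (fun q => Re (f q)) df1) (H (fun q => Im (f q)) df2).
rewrite E Wf /zbar -[cplx (_, _)]/(cderive v (fun q => cplx (phi q)) p) Wp.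
by rewrite conjCD !conjCM /zbar conjcK; ring.
Qed.

Lemma near_cderive f g p v : (\forall q \near p, f q = g q) ->
  cderive v f p = cderive v g p.
Proof.
move=> fg; rewrite /cderive; congr Complex; apply: near_eq_derive;
  by apply: filterS fg => q ->.
Qed.

(** The relations between the charts hold off the origin only, hence near a point and not as
    equalities of functions. *)
Lemma near_wderE f g p a b : (\forall q \near p, f q = g q) -> wder g p a b ->
  dz f p = a /\ dzb f p = b.
Proof.
move=> fg W; rewrite -(wder_dz W) -(wder_dzb W) /dz /dzb.
by rewrite !(near_cderive _ fg).
Qed.

Lemma csmooth_dz f : csmooth f -> csmooth (dz f).
Proof.
move=> sf; have := csmoothZ 2^-1 (csmoothD (csmooth_cderive (1, 0) sf)
  (csmoothN (csmoothZ 'i%C (csmooth_cderive (0, 1) sf)))).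
by congr csmooth; apply/funext => q; rewrite mulrC.
Qed.

Lemma csmooth_dzb f : csmooth f -> csmooth (dzb f).
Proof.
move=> sf; have := csmoothZ 2^-1 (csmoothD (csmooth_cderive (1, 0) sf)
  (csmoothZ 'i%C (csmooth_cderive (0, 1) sf))).
by congr csmooth; apply/funext => q; rewrite mulrC.
Qed.

Lemma cderive_swap f p : csmooth f ->
  cderive (1, 0) (cderive (0, 1) f) p = cderive (0, 1) (cderive (1, 0) f) p.
Proof.
move=> [s1 s2].
transitivity (Complex ('D_(1, 0) ('D_(0, 1) (fun q => Re (f q))) p)
  ('D_(1, 0) ('D_(0, 1) (fun q => Im (f q))) p)); first by [].
by rewrite (smooth_derive_swap p s1) (smooth_derive_swap p s2).
Qed.

Lemma cderive1E f p : csmooth f -> cderive (1, 0) f p = dz f p + dzb f p.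
Proof.
move=> sf; have [_ ->] := wder_csmooth p sf.
by rewrite cplx10 zbar10 !mul1r.
Qed.

Lemma cderive2E f p : csmooth f -> cderive (0,
  1) f p = 'i%C * (dz f p - dzb f p).
Proof.
move=> sf; have [_ ->] := wder_csmooth p sf.
by rewrite cplx01 zbar01; ring.
Qed.

Lemma dzD f g p : csmooth f -> csmooth g ->
  dz (fun q => f q + g q) p = dz f p + dz g p.
Proof. by move=> sf sg; exact: wder_dz (wderD (wder_csmooth p sf) (wder_csmooth
  p sg)). Qed.

Lemma dzbD f g p : csmooth f -> csmooth g ->
  dzb (fun q => f q + g q) p = dzb f p + dzb g p.
Proof. by move=> sf sg; exact: wder_dzb (wderD (wder_csmooth p sf)
  (wder_csmooth p sg)). Qed.

Lemma dzM f g p : csmooth f -> csmooth g ->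
  dz (fun q => f q * g q) p = dz f p * g p + f p * dz g p.
Proof. by move=> sf sg; exact: wder_dz (wderM (wder_csmooth p sf) (wder_csmooth
  p sg)). Qed.

Lemma dzbM f g p : csmooth f -> csmooth g ->
  dzb (fun q => f q * g q) p = dzb f p * g p + f p * dzb g p.
Proof. by move=> sf sg; exact: wder_dzb (wderM (wder_csmooth p sf)
  (wder_csmooth p sg)). Qed.

Lemma dzZ k f p : csmooth f -> dz (fun q => k * f q) p = k * dz f p.
Proof. by move=> sf; exact: wder_dz (wderZ k (wder_csmooth p sf)). Qed.

Lemma dzbZ k f p : csmooth f -> dzb (fun q => k * f q) p = k * dzb f p.
Proof. by move=> sf; exact: wder_dzb (wderZ k (wder_csmooth p sf)). Qed.

Lemma dz_dzb f p : csmooth f -> dz (dzb f) p = dzb (dz f) p.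
Proof.
move=> sf; have s1 := csmooth_cderive (1, 0) sf.
have s2 := csmooth_cderive (0, 1) sf.
have E1 : dzb f = fun q => 2^-1 * (cderive (1, 0) f q + 'i%C * cderive (0,
  1) f q).
  by apply/funext => q; rewrite mulrC.
have E2 : dz f = fun q => 2^-1 * (cderive (1, 0) f q + (- 'i%C) * cderive (0,
  1) f q).
  by apply/funext => q; rewrite mulrC mulNr.
rewrite E1 E2 dzZ ?dzbZ; try by apply: csmoothD => //; exact: csmoothZ.
rewrite dzD ?dzbD //; try exact: csmoothZ.
rewrite (dzZ 'i%C p s2) (dzbZ (- 'i%C) p s2) /dz /dzb (cderive_swap p sf).
have key (a b c : C) : 2^-1 * ((a - 'i%C * b) / 2 +
  'i%C * ((b - 'i%C * c) / 2)) =
    2^-1 * ((a + 'i%C * b) / 2 + - 'i%C * ((b + 'i%C * c) / 2)) by ring.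
exact: key.
Qed.

(* [z |-> 1 / z], the change of charts (0 at 0). *)
Definition inversion p : R * R :=
  (p.1 / (p.1 ^+ 2 + p.2 ^+ 2), - p.2 / (p.1 ^+ 2 + p.2 ^+ 2)).

Lemma sqr_norm_gt0 p : cplx p != 0 -> 0 < p.1 ^+ 2 + p.2 ^+ 2.
Proof.
case: p => x y p0; rewrite lt0r addr_ge0 ?sqr_ge0 // andbT /=.
apply: contra p0; rewrite paddr_eq0 ?sqr_ge0 // !sqrf_eq0 => /andP[/eqP->
  /eqP->].
by [].
Qed.

Lemma inversionK p : cplx p != 0 -> cplx p * cplx (inversion p) = 1.
Proof.
move=> /sqr_norm_gt0/lt0r_neq0 n0.
by apply: eq_C; rewrite !(cReM, cImM) /=; field.
Qed.

Lemma near_neq0 p : cplx p != 0 -> \forall q \near p, cplx q != 0.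
Proof.
move=> /sqr_norm_gt0 n0.
have sm : smooth (fun q : R * R => q.1 * q.1 + q.2 * q.2).
  by apply: smoothD; apply: smoothM; [exact: smooth_fst|exact:
    smooth_fst|exact: smooth_snd|exact: smooth_snd].
have cn := differentiable_continuous (smooth_differentiable p sm).
have npos : \forall q \near p, 0 < q.1 * q.1 + q.2 * q.2.
  exact: (cvgr_gt _ cn _ n0).
apply: filterS npos => q nq; apply: contraTneq nq => q0.
have [-> ->] : q.1 = 0 /\ q.2 = 0 by case: q q0 => x y [-> ->].
by rewrite mulr0 addr0 ltxx.
Qed.

(** Both derivatives are read off by differentiating [cplx q * cplx (inversion q) = 1], valid near
    [p]. *)
Lemma wder_inversion p : cplx p != 0 ->
  wder (fun q => cplx (inversion q)) p (- cplx (inversion p) ^+ 2) 0.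
Proof.
move=> p0; have n0 := lt0r_neq0 (sqr_norm_gt0 p0).
have d1 := differentiable_fst p; have d2 := differentiable_snd p.
have dn : differentiable (fun q : R * R => q.1 * q.1 + q.2 * q.2) p.
  exact: differentiableD (differentiableM d1 d1) (differentiableM d2 d2).
have dV : differentiable (fun q : R * R => (q.1 * q.1 + q.2 * q.2)^-1) p.
  exact: differentiableV.
have cd : cdiff (fun q => cplx (inversion q)) p.
  by split; [exact: differentiableM d1 dV | exact: differentiableM
    (differentiableN d2) dV].
have W := wderP cd; have WM := wderM (wder_cplx p) W.
have nE : \forall q \near p, (fun=> 1 : C) q = cplx q * cplx (inversion q).
  by apply: filterS (near_neq0 p0) => q q0; rewrite inversionK.
have [] := near_wderE nE WM; rewrite (wder_dz (wder_cst 1 p)) (wder_dzb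
  (wder_cst 1 p)).
have K := inversionK p0; rewrite mul0r add0r mul1r => Ea Eb.
apply: wder_eq W _ _.
  have : cplx (inversion p) * 0 = 0 by rewrite mulr0.
  rewrite [X in _ * X]Ea mulrDr mulrA (mulrC _ (cplx p)) K mul1r -expr2.
  by move/eqP; rewrite addrC addr_eq0 => /eqP.
have : cplx (inversion p) * 0 = 0 by rewrite mulr0.
by rewrite [X in _ * X]Eb mulrA (mulrC _ (cplx p)) K mul1r.
Qed.

End ComplexCalculus.

(** * The holomorphic frame *)

Section Gauge.
Variable R : realType.
Local Notation C := R[i].
Local Notation Re := complex.Re.
Local Notation Im := complex.Im.
Implicit Types (f g : R * R -> C) (p v : R * R).

Definition rhoC p : C := 1 + cplx p * zbar p.
Definition hC p : C := (hrho p)%:C%C.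
(** The square root of [rhoC] and inverse of [hC], written as a product of functions whose
    derivatives are known. *)
Definition kC p : C := hC p * rhoC p.

Lemma rhoCE p : rhoC p = (rho p)%:C%C.
Proof. by apply: eq_C; rewrite /rhoC /rho ?(cReD, cImD, cReM, cImM) /=; ring.
  Qed.

Lemma rhoC_neq0 p : rhoC p != 0.
Proof. by rewrite rhoCE; apply/eqP => -[]; apply/eqP;
  rewrite gt_eqF // rho_gt0. Qed.

Lemma hC_neq0 p : hC p != 0.
Proof. by apply/eqP => -[]; apply/eqP; rewrite gt_eqF // hrho_gt0. Qed.

Lemma sqr_hC p : hC p ^+ 2 = (rhoC p)^-1.
Proof. by rewrite rhoCE /hC -rmorphXn /= sqr_hrho fmorphV. Qed.

Lemma csmooth_rhoC : csmooth rhoC.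
Proof.
by apply: csmoothD; [exact: csmooth_cst | exact: csmoothM (csmooth_cplx R)
  (csmooth_zbar R)].
Qed.

Lemma csmooth_hC : csmooth hC.
Proof. exact: csmooth_real (@smooth_hrho R). Qed.

Lemma wder_rhoC p : wder rhoC p (zbar p) (cplx p).
Proof.
apply: wder_eq (wderD (wder_cst 1 p) (wderM (wder_cplx p) (wder_zbar p))) _ _;
  by ring.
Qed.

Lemma wder_hC p : wder hC p (- (zbar p / rhoC p / 2) * hC p) (- (cplx p / rhoC
  p / 2) * hC p).
Proof.
split; first exact: csmooth_cdiff csmooth_hC.
move=> v; rewrite -sqr_hC.
have -> : cderive v hC p = - ((p.1 * v.1 + p.2 * v.2)%:C%C) * hC p ^+ 3.
  rewrite /hC -rmorphXn -rmorphN -rmorphM; apply: eq_C;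
    first exact: derive_hrho.
  exact: derive_cst.
have -> : (p.1 * v.1 + p.2 * v.2)%:C%C = (cplx v * zbar p +
  zbar v * cplx p) / 2 :> C.
  have -> : cplx v * zbar p + zbar v * cplx p = 2 * (p.1 * v.1 +
    p.2 * v.2)%:C%C.
    by apply: eq_C; rewrite !(cReD, cImD, cReM, cImM) /=; ring.
  by field.
by field.
Qed.

Lemma csmooth_rhoCV : csmooth (fun q => (rhoC q)^-1).
Proof. by under eq_fun do rewrite -sqr_hC; exact: csmoothX csmooth_hC. Qed.

Lemma wder_rhoCV p : wder (fun q => (rhoC q)^-1) p
  (- zbar p / rhoC p ^+ 2) (- cplx p / rhoC p ^+ 2).
Proof.
have r0 := rhoC_neq0 p; under eq_fun do rewrite -sqr_hC.
apply: wder_eq (wderX 2 (wder_hC p)) _ _.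
  by transitivity (- (zbar p / rhoC p) * hC p ^+ 2); [rewrite /=;
    field | rewrite sqr_hC; field].
by transitivity (- (cplx p / rhoC p) * hC p ^+ 2); [rewrite /=;
  field | rewrite sqr_hC; field].
Qed.

(* Multiplication by [g] passes from the holomorphic frame of the bundle of flux
   [m] to its unitary frame; up to a constant [g] is [rhoC ^ (- m / 2)]. *)
Definition is_gauge (m : int) (g : R * R -> C) := csmooth g /\
  forall p, wder g p (- (m%:~R * zbar p / rhoC p / 2) * g p)
                     (- (m%:~R * cplx p / rhoC p / 2) * g p).

Lemma is_gauge_hC (n : nat) : is_gauge n (fun q => hC q ^+ n).
Proof.
split=> [|p]; first exact: csmoothX csmooth_hC.
rewrite -pmulrn; apply: wder_eq (wderX n (wder_hC p)) _ _;
  by case: n => [|n]; rewrite ?mul0r ?oppr0 ?mul0r // exprS /=; ring.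
Qed.

(** Negative flux occurs because Bol's lemma ends in the bundle of flux - m - 2. *)
Lemma is_gauge_kC (n : nat) : is_gauge (- n%:Z) (fun q => kC q ^+ n).
Proof.
split=> [|p]; first exact: csmoothX (csmoothM csmooth_hC csmooth_rhoC).
have r0 := rhoC_neq0 p.
have W : wder kC p (zbar p / rhoC p / 2 * kC p) (cplx p / rhoC p / 2 * kC p).
  by apply: wder_eq (wderM (wder_hC p) (wder_rhoC p)) _ _; rewrite /kC; field.
rewrite mulrNz -pmulrn; apply: wder_eq (wderX n W) _ _;
  by case: n => [|n]; rewrite ?oppr0 ?mul0r ?oppr0 ?mul0r // exprS /=; ring.
Qed.

Section GaugeTransform.
Variables (m : int) (g : R * R -> C).
Hypothesis gauge_g : is_gauge m g.
Local Notation M := (m%:~R : C).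

Let W q : C := zbar q / rhoC q.

Let sW : csmooth W.
Proof. exact: csmoothM (csmooth_zbar R) csmooth_rhoCV. Qed.

(** The (1,0) part of the connection in the holomorphic frame, that is, of the Chern connection of
    the metric [rhoC ^ (- m)]; its (0,1) part is [dzb]. *)
Definition holnabla f p : C := dz f p - M * (W p * f p).

Lemma csmooth_holnabla f : csmooth f -> csmooth (holnabla f).
Proof.
move=> sf; apply: csmoothD; first exact: csmooth_dz.
by apply: csmoothN; apply: csmoothZ; exact: csmoothM.
Qed.

Lemma potxE p : (potx m p)%:C%C = 'i%C * M * (cplx p - zbar p) / rhoC p / 2.
Proof.
have -> : potx m p = m%:~R * (- p.2) / rho p by rewrite /potx mulrN mulNr.
have E : (- p.2)%:C%C = 'i%C * (cplx p - zbar p) / 2 :> C.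
  have -> : 'i%C * (cplx p - zbar p) = 2 * (- p.2)%:C%C.
    by rewrite /zbar -[X in X - _]/(p.1 +i* p.2)%C; apply: eq_C; rewrite /=;
      ring.
  by field.
have r0 := rhoC_neq0 p.
by rewrite rmorphM fmorphV rmorphM /= rmorph_int E -rhoCE; field.
Qed.

Lemma potyE p : (poty m p)%:C%C = M * (cplx p + zbar p) / rhoC p / 2.
Proof.
have -> : poty m p = m%:~R * p.1 / rho p by [].
have E : (p.1)%:C%C = (cplx p + zbar p) / 2 :> C.
  have -> : cplx p + zbar p = 2 * (p.1)%:C%C.
    by rewrite /zbar -[X in X + _]/(p.1 +i* p.2)%C; apply: eq_C; rewrite /=;
      ring.
  by field.
have r0 := rhoC_neq0 p.
by rewrite rmorphM fmorphV rmorphM /= rmorph_int E -rhoCE; field.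
Qed.

Lemma nablax_gauge f : csmooth f -> nablax m (fun q => g q * f q) =
  fun p => g p * (holnabla f p + dzb f p).
Proof.
move=> sf; apply/funext => p; have [sg Wg] := gauge_g.
rewrite /nablax (cderive1E _ (csmoothM sg sf)) dzM // dzbM //.
rewrite (wder_dz (Wg p)) (wder_dzb (Wg p)) /holnabla /W potxE.
have r0 := rhoC_neq0 p.
set a := dz f p; set b := dzb f p; set z := cplx p; set zb := zbar p.
transitivity (g p * (a + b) - M * (z + zb) / rhoC p / 2 * g p * f p
  - ('i%C * 'i%C) * M * (z - zb) / rhoC p / 2 * g p * f p); first by field.
by rewrite mul_ii; field.
Qed.

Lemma nablay_gauge f : csmooth f -> nablay m (fun q => g q * f q) =
  fun p => g p * ('i%C * (holnabla f p - dzb f p)).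
Proof.
move=> sf; apply/funext => p; have [sg Wg] := gauge_g.
rewrite /nablay (cderive2E _ (csmoothM sg sf)) dzM // dzbM //.
rewrite (wder_dz (Wg p)) (wder_dzb (Wg p)) /holnabla /W potyE.
have r0 := rhoC_neq0 p.
set a := dz f p; set b := dzb f p; set z := cplx p; set zb := zbar p.
by field.
Qed.

Lemma confVE p : ((conf p)^-1)%:C%C = rhoC p ^+ 2 / 4.
Proof.
rewrite /conf -/(rho p) invfM invrK rmorphM /= rmorphXn /= -rhoCE fmorphV /=.
by rewrite mulrC rmorph_nat.
Qed.

Lemma holnablaD f1 f2 p : csmooth f1 -> csmooth f2 ->
  holnabla (fun q => f1 q + f2 q) p = holnabla f1 p + holnabla f2 p.
Proof. by move=> s1 s2; rewrite /holnabla dzD //; ring. Qed.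

Lemma holnablaZ k f1 p : csmooth f1 ->
  holnabla (fun q => k * f1 q) p = k * holnabla f1 p.
Proof. by move=> s1; rewrite /holnabla dzZ //; ring. Qed.

Lemma dzb_W p : dzb W p = (rhoC p)^-1 ^+ 2.
Proof.
have r0 := rhoC_neq0 p.
rewrite (wder_dzb (wderM (wder_zbar p) (wder_rhoCV p))).
transitivity ((rhoC p - cplx p * zbar p) / rhoC p ^+ 2); first by field.
by rewrite {1}/rhoC addrK; field.
Qed.

(** The last term is the commutator of [dzb] and [holnabla]: the curvature. *)
Lemma dzb_holnabla f p : csmooth f ->
  dzb (holnabla f) p = dz (dzb f) p - M * (W p * dzb f p) - M / rhoC p ^+
    2 * f p.
Proof.
move=> sf; have sWf := csmoothM sW sf.
have E : holnabla f = fun q => dz f q + (- M) * (W q * f q).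
  by apply/funext => q; rewrite /holnabla mulNr.
have r0 := rhoC_neq0 p.
rewrite E (dzbD p (csmooth_dz sf) (csmoothZ (- M) sWf)) (dzbZ (- M) p sWf).
rewrite (dzbM p sW sf) dzb_W -(dz_dzb p sf).
by field.
Qed.

(** With X = [holnabla] and Y = [dzb], the covariant derivatives are X + Y and i (X - Y), so the
    pure squares cancel and 2 (X Y + Y X) remains. Reordering Y X produces the constant [M / 2] from
    the curvature. *)
Lemma maglap_gauge f p : csmooth f ->
  maglap_chart m (fun q => g q * f q) p =
  g p * (- (rhoC p ^+ 2) * dz (dzb f) p + M * rhoC p * zbar p * dzb f p +
    M / 2 * f p).
Proof.
move=> sf; have sA := csmooth_holnabla sf; have sB := csmooth_dzb sf.
have sAA := csmooth_holnabla sA; have r0 := rhoC_neq0 p.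
have sNB := csmoothN sB.
have sX := csmoothD sA sB; have sY := csmoothZ 'i%C (csmoothD sA sNB).
rewrite /maglap_chart confVE (nablax_gauge sf) (nablay_gauge sf).
rewrite (nablax_gauge sX) (nablay_gauge sY).
rewrite (holnablaZ _ _ (csmoothD sA sNB)) (dzbZ _ _ (csmoothD sA sNB)).
have sDN : csmooth (fun q => - 1 * dzb f q) by exact: csmoothZ.
have EN : (fun q => holnabla f q - dzb f q) = fun q =>
  holnabla f q + -1 * dzb f q.
  by apply/funext => q; rewrite mulN1r.
rewrite !EN (holnablaD p sA sB) (holnablaD p sA sDN) (holnablaZ (-1) p sB).
rewrite (dzbD p sA sB) (dzbD p sA sDN) (dzbZ (-1) p sB).
have -> : holnabla (dzb f) p = dz (dzb f) p - M * (W p * dzb f p) by [].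
rewrite (dzb_holnabla p sf) /W.
set a := holnabla (holnabla f) p; set b := dz (dzb f) p; set c := dzb (dzb f) p.
set d := dzb f p; set z := zbar p.
transitivity (g p * (- (rhoC p ^+ 2 / 4) * (a * (1 + 'i%C * 'i%C) + c * (1 +
  'i%C * 'i%C) +
  (1 - 'i%C * 'i%C) * (b + b - 2 * M * (z / rhoC p * d) - M / rhoC p ^+
    2 * f p)))).
  by field.
by rewrite mul_ii; field.
Qed.

End GaugeTransform.

End Gauge.

(** * Maximum principle on the sphere *)

Section MaximumPrinciple.
Variable R : realType.
Local Notation C := R[i].
Local Notation Re := complex.Re.
Local Notation Im := complex.Im.
Implicit Types (f g u w : R * R -> C) (p v : R * R).

Definition nsq (a : C) : R := Re a ^+ 2 + Im a ^+ 2.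

Lemma nsq_ge0 a : 0 <= nsq a.
Proof. by rewrite addr_ge0 ?sqr_ge0. Qed.

Lemma nsq_eq0 a : nsq a = 0 -> a = 0.
Proof.
move/eqP; rewrite paddr_eq0 ?sqr_ge0 // !sqrf_eq0 => /andP[/eqP a1 /eqP a2].
exact: eq_C.
Qed.

Lemma nsqM a b : nsq (a * b) = nsq a * nsq b.
Proof. by rewrite /nsq cReM cImM; ring. Qed.

Lemma nsqE a : nsq a = Re (a^*%C * a).
Proof. by case: a => x y; rewrite /nsq /=; ring. Qed.

Lemma smooth_potx m : smooth (@potx R m).
Proof.
rewrite (_ : potx m = fun p => - m%:~R * p.2 * (hrho p * hrho p)).
  apply: smoothM; last by apply: smoothM; exact: smooth_hrho.
  by apply: smoothM; [exact: smooth_cst | exact: smooth_snd].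
by apply/funext => p; rewrite -expr2 sqr_hrho.
Qed.

Lemma smooth_poty m : smooth (@poty R m).
Proof.
rewrite (_ : poty m = fun p => m%:~R * p.1 * (hrho p * hrho p)).
  apply: smoothM; last by apply: smoothM; exact: smooth_hrho.
  by apply: smoothM; [exact: smooth_cst | exact: smooth_fst].
by apply/funext => p; rewrite -expr2 sqr_hrho.
Qed.

(** The connection preserves the hermitian product: as [A] is real, its two contributions cancel. *)
Lemma derive_hermitian u w p v (A : R) : csmooth u -> csmooth w ->
  'D_v (fun q => Re ((u q)^*%C * w q)) p =
  Re ((cderive v u p - 'i%C * A%:C%C * u p)^*%C * w p +
      (u p)^*%C * (cderive v w p - 'i%C * A%:C%C * w p)).
Proof.
move=> su sw; have dc := csmooth_cdiff p (csmooth_conj su).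
have dw := csmooth_cdiff p sw; have := cderiveM v dc dw.
have [_ ->] := wder_conj (wder_csmooth p su).
have [_ E2] := wder_csmooth p su.
have -> : cplx v * (dzb u p)^*%C + zbar v * (dz u p)^*%C = (cderive v u p)^*%C.
  by rewrite E2 conjCD !conjCM /zbar conjcK addrC.
move=> /(congr1 (@complex.Re R)) E; apply: etrans E _.
move: (cderive v u p) (cderive v w p) (u p) (w p) => [a1 a2] [b1 b2] [u1 u2]
  [w1 w2].
by rewrite /=; ring.
Qed.

Lemma second_derive_nsq u p v (A : R * R -> R) : csmooth u ->
  smooth A ->
  let D w := (fun q => cderive v w q - 'i%C * (A q)%:C%C * w q) in
  'D_v ('D_v (fun q => nsq (u q))) p =
  2 * nsq (D u p) + 2 * Re ((u p)^*%C * D (D u) p).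
Proof.
move=> su sA D; have sD : csmooth (D u).
  apply: csmoothD; first exact: csmooth_cderive.
  by apply: csmoothN; apply: csmoothM => //; apply: csmoothZ;
    exact: (csmooth_real sA).
have E1 : (fun q => nsq (u q)) = fun q => Re ((u q)^*%C * u q).
  by apply/funext => q; exact: nsqE.
have ReC a b : Re (a^*%C * b + b^*%C * a) = 2 * Re (b^*%C * a).
  by case: a b => [a1 a2] [b1 b2] /=; ring.
have E2 : 'D_v (fun q => nsq (u q)) = fun q => Re ((u q)^*%C * (2 * D u q)).
  apply/funext => q; rewrite E1 (derive_hermitian q v (A q) su su) -/(D u q)
    ReC.
  by case: (u q) (D u q) => [a1 a2] [b1 b2] /=; ring.
rewrite E2 (derive_hermitian p v (A p) su (csmoothZ 2 sD)) -/(D u p).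
have [_ E3] := wder_csmooth p sD; have [_ E4] := wderZ 2 (wder_csmooth p sD).
have -> : cderive v (fun q => 2 * D u q) p = 2 * cderive v (D u) p.
  by rewrite E3 E4; ring.
rewrite -/(D (D u) p) /D -/(D u p).
move: (D u p) (cderive v (D u) p) (u p) => [a1 a2] [b1 b2] [u1 u2].
by rewrite /nsq /=; ring.
Qed.

(** The closed unit discs of the two charts cover the sphere, since inversion maps the outside of
    one into the other. The compact square [K] contains the disc, so the larger of the two maxima
    over [K] is global. *)
Lemma sphere_max (N1 N2 : R * R -> R) : continuous N1 -> continuous N2 ->
  (forall p q, cplx p * cplx q = 1 -> N1 p = N2 q) ->
  (exists p, forall q, N1 q <= N1 p /\ N2 q <= N1 p) \/
  (exists p, forall q, N1 q <= N2 p /\ N2 q <= N2 p).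
Proof.
move=> c1 c2 N12.
pose K : set (R * R) := `[(-1 : R), 1]%classic `*` `[(-1 : R), 1]%classic.
have cK : compact K by apply: compact_setX; exact: segment_compact.
have K0 : K !=set0.
  by exists (0, 0); split; rewrite /= in_itv /= lerN10 ler01.
have [a aK amax] := compact_EVT_max K0 cK (continuous_subspaceT c1).
have [b bK bmax] := compact_EVT_max K0 cK (continuous_subspaceT c2).
have inK q : q.1 ^+ 2 + q.2 ^+ 2 <= 1 -> q \in K.
  move=> q1; rewrite inE; split => /=; rewrite in_itv /=
    -ler_norml -(@ler_pXn2r _ 2) ?nnegrE //;
  rewrite expr1n real_normK ?num_real //; apply: le_trans q1;
    by rewrite ?lerDl ?lerDr sqr_ge0.
have inv q : q \in K \/ inversion q \in K /\ cplx q != 0.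
  have [q1|q1] := leP (q.1 ^+ 2 + q.2 ^+ 2) 1; first by left; exact: inK.
  right; set n := (q.1 ^+ 2 + q.2 ^+ 2) in q1 *;
    have n0 : 0 < n by exact: lt_trans ltr01 q1.
  split; last first.
    apply: contraTneq q1 => q0; have [E1 E2] : q.1 = 0 /\ q.2 =
      0 by case: q {n n0} q0 => x y [-> ->].
    by rewrite /n E1 E2 expr0n addr0 -leNgt ler01.
  apply: inK; rewrite /inversion /= -/n.
  rewrite (_ : _ + _ = n^-1); first by rewrite invf_le1 // ltW.
  have n00 := lt0r_neq0 n0; rewrite !exprMn sqrrN -mulrDl -/n exprVn; by field.
have all1 q : N1 q <= N1 a \/ N1 q <= N2 b.
  have [qK|[qK q0]] := inv q; first by left; exact: amax.
  by right; rewrite (N12 q (inversion q)) ?inversionK //; exact: bmax.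
have all2 q : N2 q <= N1 a \/ N2 q <= N2 b.
  have [qK|[qK q0]] := inv q; first by right; exact: bmax.
  by left; rewrite -(N12 (inversion q) q) 1?mulrC ?inversionK //; exact: amax.
have [ab|ba] := leP (N1 a) (N2 b).
  right; exists b => q; split; [case: (all1 q)|case: (all2 q)] => // h;
    exact: le_trans h ab.
left; exists a => q; split; [case: (all1 q)|case: (all2 q)] => // h;
  exact: le_trans h (ltW ba).
Qed.

Lemma nsq_max_eq0 m (l : R) u p : l < 0 -> csmooth u ->
  (forall q, maglap_chart m u q = l%:C%C * u q) ->
  (forall q, nsq (u q) <= nsq (u p)) -> nsq (u p) = 0.
Proof.
move=> l0 su eig umax; apply/eqP; apply: contraT => up0.
have up : 0 < nsq (u p) by rewrite lt0r up0 nsq_ge0.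
have sN : smooth (fun q => nsq (u q)).
  have [s1 s2] := su; apply: smoothD; exact: smoothM.
have sd v : 'D_v ('D_v (fun q => nsq (u q))) p <= 0.
  apply: second_derive_max => // q; apply: smooth_differentiable => //.
  exact: smooth_derive.
set X := nablax m (nablax m u) p; set Y := nablay m (nablay m u) p.
have E1 : 'D_(1, 0) ('D_(1, 0) (fun q => nsq (u q))) p =
  2 * nsq (nablax m u p) + 2 * complex.Re ((u p)^*%C * X).
  exact: (second_derive_nsq p (1, 0) su (@smooth_potx m)).
have E2 : 'D_(0, 1) ('D_(0, 1) (fun q => nsq (u q))) p =
  2 * nsq (nablay m u p) + 2 * complex.Re ((u p)^*%C * Y).
  exact: (second_derive_nsq p (0, 1) su (@smooth_poty m)).
have := lerD (sd (1, 0)) (sd (0, 1)); rewrite E1 E2 addr0 leNgt => /negP H.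
exfalso; apply: H.
have cp : 0 < conf p by rewrite divr_gt0 ?exprn_gt0 ?rho_gt0 ?ltr0n.
have XY : X + Y = (- (conf p * l))%:C%C * u p.
  have := congr1 (fun x => - (conf p)%:C%C * x) (eig p).
  rewrite /maglap_chart -/X -/Y mulrA mulrNN -rmorphM /=
    divff ?lt0r_neq0 // mul1r => ->.
  by rewrite mulrA mulNr -rmorphM -rmorphN.
have key (a b c d : R) : 0 <= a -> 0 <= b -> 0 < c + d ->
    0 < 2 * a + 2 * c + (2 * b + 2 * d).
  by move=> a0 b0 cd; rewrite (_ : _ + _ = 2 * (a + b) + 2 * (c + d));
    [rewrite ltr_wpDl ?mulr_ge0 ?addr_ge0 ?mulr_gt0|ring].
apply: key; [exact: nsq_ge0|exact: nsq_ge0|].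
rewrite -cReD -mulrDr XY mulrCA cReM /= mul0r subr0 -nsqE.
by rewrite mulr_gt0 // oppr_gt0 pmulr_rlt0.
Qed.

(** The charts are compared through [nsq] only, so the same statement serves sections of flux [m]
    and the derivatives in Bol's lemma. *)
Lemma max_principle m (l : R) u1 u2 : l < 0 -> csmooth u1 -> csmooth u2 ->
  (forall p q, cplx p * cplx q = 1 -> nsq (u1 p) = nsq (u2 q)) ->
  (forall q, maglap_chart m u1 q = l%:C%C * u1 q) ->
  (forall q, maglap_chart m u2 q = l%:C%C * u2 q) ->
  forall q, u1 q = 0 /\ u2 q = 0.
Proof.
move=> l0 s1 s2 N12 e1 e2.
have cN u : csmooth u -> continuous (fun q => nsq (u q)).
  move=> [su1 su2] q; apply: differentiable_continuous.
  by apply: (@smooth_differentiable R (fun q => nsq (u q))); apply: smoothD;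
    exact: smoothM.
have [[p pmax]|[p pmax]] := sphere_max (cN _ s1) (cN _ s2) N12.
  have E := nsq_max_eq0 l0 s1 e1 (fun q => (pmax q).1).
  move=> q; have [h1 h2] := pmax q; rewrite E in h1 h2.
  by split; apply: nsq_eq0; apply/eqP; rewrite eq_le nsq_ge0 ?h1 ?h2.
have E := nsq_max_eq0 l0 s2 e2 (fun q => (pmax q).2).
move=> q; have [h1 h2] := pmax q; rewrite E in h1 h2.
by split; apply: nsq_eq0; apply/eqP; rewrite eq_le nsq_ge0 ?h1 ?h2.
Qed.

End MaximumPrinciple.

(** * Ladder operators *)

Section Ladder.
Variable R : realType.
Local Notation C := R[i].
Local Notation sect := ((R * R -> C) * (R * R -> C))%type.
Implicit Types (f g : R * R -> C) (p q v : R * R) (u F : sect).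

Definition transition (m : nat) (F : sect) : Prop :=
  [/\ csmooth F.1, csmooth F.2 &
   forall p, cplx p != 0 -> F.1 p = cplx p ^+ m * F.2 (inversion p)].

Lemma dz_transition m F p : transition m F -> cplx p != 0 ->
  dz F.1 p = cplx p ^+ m * (m%:R * cplx (inversion p) * F.2 (inversion p)
     - cplx (inversion p) ^+ 2 * dz F.2 (inversion p)) /\
  dzb F.1 p = - cplx p ^+ m * zbar (inversion p) ^+ 2 * dzb F.2 (inversion p).
Proof.
move=> [s1 s2 T] p0; have K := inversionK p0.
have W := wderM (wderX m (wder_cplx p))
  (wder_comp (wder_inversion p0) (wder_csmooth (inversion p) s2)).
have nE : \forall q \near p, F.1 q = cplx q ^+ m * F.2 (inversion q).
  by apply: filterS (near_neq0 p0) => q q0; exact: T.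
have [-> ->] := near_wderE nE W.
have E0 : (- cplx (inversion p) ^+ 2)^*%C = - zbar (inversion p) ^+ 2.
  by rewrite expr2 -mulNr conjCM /zbar expr2 -mulNr; congr (_ * _);
    exact: rmorphN.
rewrite conjc0 E0; split; last by ring.
case: m {T nE W} => [|m] /=; first by ring.
(* Here m z^(m-1) is rewritten as m z^m w, using z w = 1. *)
rewrite exprS -[X in X * F.2 _]mulr1 -{1}K; ring.
Qed.

Lemma rhoC_inversion p : cplx p != 0 ->
  rhoC p = cplx p * zbar p * rhoC (inversion p).
Proof.
move=> p0; have K := inversionK p0.
have Kb : zbar p * zbar (inversion p) = 1 by rewrite /zbar -conjCM K conjc1.
rewrite /rhoC mulrDr mulr1 addrC; congr (_ + _).
by rewrite mulrACA K Kb mulr1.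
Qed.

Definition raising f p : C := rhoC p ^+ 2 * dzb f p.
(** [lowering m.+2] is the formal adjoint D_m^* of [raising] for the metrics [rhoC ^ (- m)] and
    [rhoC ^ (- m - 2)]: the index is the flux of its argument. *)
Definition lowering (m : nat) f p : C := - dz f p +
  m%:R * (zbar p / rhoC p) * f p.
Definition landau (m : nat) f p : C :=
  - rhoC p ^+ 2 * dz (dzb f) p + m%:R * rhoC p * zbar p * dzb f p.

Lemma csmooth_raising f : csmooth f -> csmooth (raising f).
Proof.
move=> sf; apply: csmoothM; last exact: csmooth_dzb.
exact: csmoothX (csmooth_rhoC R).
Qed.

Lemma csmooth_zbar_rho : csmooth (fun q => zbar q / rhoC q : C).
Proof. exact: csmoothM (csmooth_zbar R) (csmooth_rhoCV R). Qed.

Lemma csmooth_lowering m f : csmooth f -> csmooth (lowering m f).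
Proof.
move=> sf; apply: csmoothD; first exact: csmoothN (csmooth_dz sf).
by apply: csmoothM => //; apply: csmoothZ; exact: csmooth_zbar_rho.
Qed.

Lemma lowering_raising m f p : csmooth f ->
  lowering m.+2 (raising f) p = landau m f p.
Proof.
move=> sf; have sb := csmooth_dzb sf; have r0 := rhoC_neq0 p.
rewrite /lowering /landau.
have -> : dz (raising f) p =
    2 * rhoC p * zbar p * dzb f p + rhoC p ^+ 2 * dz (dzb f) p.
  rewrite (wder_dz (wderM (wderX 2 (wder_rhoC p)) (wder_csmooth p sb))) /=.
  by ring.
rewrite /raising -[m.+2]addn2 natrD.
set a := dz _ _; set b := dzb _ _; set z := zbar p.
by field.
Qed.

Lemma raising_lowering m f p : csmooth f ->
  raising (lowering m f) p = landau m f p + m%:R * f p.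
Proof.
move=> sf; have sb := csmooth_dz sf; have r0 := rhoC_neq0 p.
rewrite /raising /landau.
have -> : dzb (lowering m f) p = - dz (dzb f) p
   + m%:R / rhoC p ^+ 2 * f p + m%:R * (zbar p / rhoC p) * dzb f p.
  rewrite (wder_dzb (wderD (wderN (wder_csmooth p sb))
    (wderM (wderZ m%:R (wder_csmooth p csmooth_zbar_rho)) (wder_csmooth p
      sf)))).
  by rewrite -(dz_dzb p sf) [dzb (fun q => _ / _) p]dzb_W; field.
set a := dz _ _; set b := dzb _ _; set z := zbar p.
by field.
Qed.

(** The sign in the second chart comes from d(1/z) = - z^(-2) dz; with it the transition function is
    exactly z^(m+2). *)
Lemma transition_raising m F : transition m F ->
  transition m.+2 (raising F.1, fun q => - raising F.2 q).
Proof.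
move=> tF; have [s1 s2 T] := tF; split.
- exact: csmooth_raising.
- by apply: csmoothN; exact: csmooth_raising.
move=> p p0 /=; have [_ E] := dz_transition tF p0.
rewrite /raising E (rhoC_inversion p0) -[m.+2]addn2 exprD.
have K := inversionK p0.
have Kb : zbar p * zbar (inversion p) = 1 by rewrite /zbar -conjCM K conjc1.
set w := zbar (inversion p); rewrite -/w in Kb.
transitivity (- (cplx p ^+ m * cplx p ^+ 2 * ((zbar p * w) ^+
  2 * (rhoC (inversion p) ^+ 2 * dzb F.2 (inversion p))))).
  by ring.
by rewrite Kb expr1n mul1r mulrN.
Qed.

Lemma transition_lowering m F : transition m.+2 F ->
  transition m (lowering m.+2 F.1, fun q => - lowering m.+2 F.2 q).
Proof.
move=> tF; have [s1 s2 T] := tF; split.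
- exact: csmooth_lowering.
- by apply: csmoothN; exact: csmooth_lowering.
move=> p p0 /=; have [E _] := dz_transition tF p0.
rewrite /lowering E (T p p0) (rhoC_inversion p0) -[in cplx p ^+
  m.+2]addn2 exprD.
have K := inversionK p0; have r0 := rhoC_neq0 (inversion p).
have Kb : zbar p * zbar (inversion p) = 1 by rewrite /zbar -conjCM K conjc1.
have p0b : zbar p != 0 by rewrite /zbar conjc_eq0.
have rE : rhoC (inversion p) = 1 + cplx (inversion p) * zbar (inversion p) by
  [].
have wE : cplx (inversion p) = (cplx p)^-1 by rewrite -[LHS]mul1r -[X in X *
  _](mulVf p0) -mulrA K mulr1.
have wbE : zbar (inversion p) = (zbar p)^-1 by rewrite -[LHS]mul1r -[X in X *
  _](mulVf p0b) -mulrA Kb mulr1.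
have r1 : cplx p * zbar p + 1 != 0 by rewrite addrC; exact: rhoC_neq0 p.
rewrite rE wE wbE in r0 *; set a := F.2 _; set b := dz _ _.
set z := cplx p in p0 r0 r1 *; set zb := zbar p in p0b r0 r1 *.
field.
by rewrite p0 p0b r1.
Qed.

End Ladder.

(** * Eigenspaces *)

Section Eigenspaces.
Variable R : realType.
Local Notation C := R[i].
Local Notation sect := ((R * R -> C) * (R * R -> C))%type.
Implicit Types (f g : R * R -> C) (p q v : R * R) (u F : sect).

Lemma cplx_inj : injective (@cplx R).
Proof. by move=> [a b] [c d] [-> ->]. Qed.

Lemma inversion_unique p q : cplx p * cplx q = 1 ->
  cplx p != 0 /\ q = inversion p.
Proof.
move=> pq; have p0 : cplx p != 0.
  by apply: contra_eq_neq pq => ->; rewrite mul0r eq_sym oner_eq0.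
split=> //; apply: cplx_inj; apply: (mulfI p0); by rewrite pq inversionK.
Qed.

Lemma hC_kC p : hC p * kC p = 1.
Proof. by rewrite /kC mulrA -expr2 sqr_hC mulVf // rhoC_neq0. Qed.

Lemma kC_neq0 p : kC p != 0.
Proof. by rewrite mulf_neq0 ?hC_neq0 ?rhoC_neq0. Qed.

Lemma hC_inversion p : cplx p != 0 -> hC (inversion p) = `|cplx p| * hC p.
Proof.
move=> p0.
have ge0 q : 0 <= hC q :> C by rewrite /hC lecR ltW // hrho_gt0.
apply/eqP; rewrite -(@eqrXn2 _ 2) ?mulr_ge0 ?normr_ge0 ?ge0 //.
rewrite exprMn !sqr_hC (rhoC_inversion p0) sqr_normc.
have p0b : zbar p != 0 by rewrite /zbar conjc_eq0.
have r0 := rhoC_neq0 (inversion p).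
rewrite -/(zbar p); apply/eqP; field; by rewrite p0 p0b r0.
Qed.

Definition to_section (m : nat) F : sect :=
  (fun p => hC p ^+ m * F.1 p, fun p => hC p ^+ m * F.2 p).
Definition of_section (m : nat) u : sect :=
  (fun p => kC p ^+ m * u.1 p, fun p => kC p ^+ m * u.2 p).

Definition landau_eigen (m : nat) (mu : R) F : Prop := transition m F /\
  forall p, landau m F.1 p = mu%:C%C * F.1 p /\ landau m F.2 p =
    mu%:C%C * F.2 p.

Lemma maglap_hC (m : nat) f p : csmooth f ->
  maglap_chart m (fun q => hC q ^+ m * f q) p =
  hC p ^+ m * (landau m f p + m%:R / 2 * f p).
Proof. by move=> sf; rewrite (maglap_gauge (is_gauge_hC R m)). Qed.

(** Under inversion [hC] is multiplied by |z|, which reduces the transition function z^m to its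
    phase. *)
Lemma transition_unitary m F p q : transition m F -> cplx p * cplx q = 1 ->
  hC q ^+ m * F.2 q = (cplx p / `|cplx p|) ^ (- m%:Z) * (hC p ^+ m * F.1 p).
Proof.
move=> [_ _ T] /inversion_unique[p0 ->]; rewrite T // hC_inversion //.
have n0 : `|cplx p| != 0 by rewrite normr_eq0.
rewrite -exprnN exprMn !expr_div_n; field.
by apply/andP; split; exact: expf_neq0.
Qed.

Lemma to_sectionP m mu F : landau_eigen m mu F ->
  eigensection m (mu + m%:R / 2) (to_section m F).
Proof.
move=> [tF eF]; have [s1 s2 T] := tF.
have key f p : csmooth f -> landau m f p = mu%:C%C * f p ->
    maglap_chart m (fun q => hC q ^+ m * f q) p =
    (mu + m%:R / 2)%:C%C * (hC p ^+ m * f p).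
  move=> sf E; rewrite maglap_hC // E rmorphD rmorphM fmorphV !rmorph_nat.
  by rewrite mulrCA -mulrDl.
split.
  split; [| |by move=> p q pq /=; exact: transition_unitary].
  + by apply: csmoothM => //; exact: csmoothX (csmooth_hC R).
  + by apply: csmoothM => //; exact: csmoothX (csmooth_hC R).
by move=> p; have [e1 e2] := eF p; split; exact: key.
Qed.

Lemma of_sectionP (m : nat) l u : eigensection m l u ->
  landau_eigen m (l - m%:R / 2) (of_section m u).
Proof.
move=> [[s1 s2 T] e].
have sk : csmooth (fun q => kC q ^+ m : C).
  exact: csmoothX (csmoothM (csmooth_hC R) (csmooth_rhoC R)).
have sm1 := csmoothM sk s1; have sm2 := csmoothM sk s2.
have hk p : hC p ^+ m * kC p ^+ m = 1 by rewrite -exprMn hC_kC expr1n.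
have key f p : csmooth f -> csmooth (fun q => kC q ^+ m * f q) ->
    maglap_chart m f p = l%:C%C * f p ->
    landau m (fun q => kC q ^+ m * f q) p =
    (l - m%:R / 2)%:C%C * (kC p ^+ m * f p).
  move=> sf skf; have E : f = fun q => hC q ^+ m * (kC q ^+ m * f q).
    by apply/funext => q; rewrite mulrA hk mul1r.
  rewrite {1}E maglap_hC // => H; have h0 := hC_neq0 p.
  have H2 : hC p ^+ m * (landau m (fun q => kC q ^+ m * f q) p) =
     hC p ^+ m * ((l - m%:R / 2)%:C%C * (kC p ^+ m * f p)).
    rewrite rmorphB rmorphM fmorphV !rmorph_nat mulrBl mulrBr; apply/eqP.
    rewrite eq_sym subr_eq -mulrDr H eq_sym [hC p ^+ m * (l%:C%C * _)]mulrCA.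
    by rewrite (mulrA (hC p ^+ m) (kC p ^+ m)) hk mul1r.
  exact: (mulfI (expf_neq0 m h0) H2).
split; last by move=> p; have [e1 e2] := e p; split; exact: key.
split => // p p0 /=; have n0 : `|cplx p| != 0 by rewrite normr_eq0.
have hp0 := hC_neq0 p.
have kE q : kC q = (hC q)^-1 by apply: (mulfI (hC_neq0 q));
  rewrite hC_kC mulfV // hC_neq0.
rewrite (T p (inversion p)) ?inversionK // !kE hC_inversion //.
rewrite -exprnN exprVn exprVn exprMn expr_div_n; field.
by apply/and3P; split; exact: expf_neq0.
Qed.

Definition lincomb n (c : 'I_n -> C) (u : 'I_n -> sect) : sect :=
  (fun p => \sum_(k < n) c k * (u k).1 p, fun p =>
    \sum_(k < n) c k * (u k).2 p).

Definition null_section u := forall p, u.1 p = 0 /\ u.2 p = 0.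

(** [multiplicity] is the supremum of the [n] for which such a family of eigensections exists; all
    comparisons of eigenspaces are made at fixed [n]. *)
Definition has_family (S : sect -> Prop) n :=
  exists u : 'I_n -> sect, (forall k, S (u k)) /\ lin_indep u.

(** The second hypothesis combines linearity and injectivity: a relation between the images is
    already one between the sections. *)
Lemma has_family_map (S T : sect -> Prop) (Phi : sect -> sect) n :
  (forall u, S u -> T (Phi u)) ->
  (forall c (u : 'I_n -> sect), (forall k, S (u k)) ->
     null_section (lincomb c (fun k => Phi (u k))) ->
       null_section (lincomb c u)) ->
  has_family S n -> has_family T n.
Proof.
move=> ST inj [u [Su li]]; exists (fun k => Phi (u k)); split.
  by move=> k; exact: ST.
by move=> c c0; apply: li; exact: inj Su c0.
Qed.

Lemma has_family_to_section (m : nat) l n :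
  has_family (landau_eigen m (l - m%:R / 2)) n <->
    has_family (eigensection m l) n.
Proof.
split.
  apply: (has_family_map (Phi := to_section m)) => [F /to_sectionP|].
    by rewrite subrK.
  move=> c F _ H p; have h0 := expf_neq0 m (hC_neq0 p); have [] := H p.
  move=> /= H1 H2; split => /=; apply: (mulfI h0); rewrite mulr0 mulr_sumr;
  [rewrite -[RHS]H1 | rewrite -[RHS]H2]; apply: eq_bigr => k _;
    by rewrite mulrCA.
apply: (has_family_map (Phi := of_section m)) => [u /of_sectionP//|].
move=> c F _ H p; have h0 := expf_neq0 m (kC_neq0 p); have [] := H p.
move=> /= H1 H2; split => /=; apply: (mulfI h0); rewrite mulr0 mulr_sumr;
[rewrite -[RHS]H1 | rewrite -[RHS]H2]; apply: eq_bigr => k _; by rewrite mulrCA.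
Qed.

Lemma dz_sum n (F : 'I_n -> R * R -> C) p : (forall k, csmooth (F k)) ->
  dz (fun q => \sum_(k < n) F k q) p = \sum_(k < n) dz (F k) p.
Proof.
elim: n F => [|n IH] F sF.
  under eq_fun do rewrite big_ord0.
  by rewrite big_ord0 (wder_dz (wder_cst 0 p)).
under eq_fun do rewrite big_ord_recl.
rewrite dzD //; last by apply: csmooth_sum => k; exact: sF.
by rewrite big_ord_recl IH.
Qed.

Lemma dzb_sum n (F : 'I_n -> R * R -> C) p : (forall k, csmooth (F k)) ->
  dzb (fun q => \sum_(k < n) F k q) p = \sum_(k < n) dzb (F k) p.
Proof.
elim: n F => [|n IH] F sF.
  under eq_fun do rewrite big_ord0.
  by rewrite big_ord0 (wder_dzb (wder_cst 0 p)).
under eq_fun do rewrite big_ord_recl.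
rewrite dzbD //; last by apply: csmooth_sum => k; exact: sF.
by rewrite big_ord_recl IH.
Qed.

Lemma dz_lincomb n (c : 'I_n -> C) (F : 'I_n -> R * R -> C) p : (forall k,
  csmooth (F k)) ->
  dz (fun q => \sum_(k < n) c k * F k q) p = \sum_(k < n) c k * dz (F k) p.
Proof.
move=> sF; rewrite dz_sum; last by move=> k; exact: csmoothZ.
by apply: eq_bigr => k _; rewrite dzZ.
Qed.

Lemma dzb_lincomb n (c : 'I_n -> C) (F : 'I_n -> R * R -> C) p : (forall k,
  csmooth (F k)) ->
  dzb (fun q => \sum_(k < n) c k * F k q) p = \sum_(k < n) c k * dzb (F k) p.
Proof.
move=> sF; rewrite dzb_sum; last by move=> k; exact: csmoothZ.
by apply: eq_bigr => k _; rewrite dzbZ.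
Qed.

Lemma csmooth_lincomb n (c : 'I_n -> C) (F : 'I_n -> R * R -> C) :
  (forall k, csmooth (F k)) -> csmooth (fun q => \sum_(k < n) c k * F k q).
Proof. by move=> sF; apply: csmooth_sum => k; exact: csmoothZ. Qed.

Lemma raising_lincomb n (c : 'I_n -> C) (F : 'I_n -> R * R -> C) p : (forall k,
  csmooth (F k)) ->
  raising (fun q => \sum_(k < n) c k * F k q) p =
    \sum_(k < n) c k * raising (F k) p.
Proof.
move=> sF; rewrite /raising dzb_lincomb // mulr_sumr.
by apply: eq_bigr => k _; rewrite mulrCA.
Qed.

Lemma lowering_lincomb m n (c : 'I_n -> C) (F : 'I_n -> R * R ->
  C) p : (forall k, csmooth (F k)) ->
  lowering m (fun q => \sum_(k < n) c k * F k q) p =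
    \sum_(k < n) c k * lowering m (F k) p.
Proof.
move=> sF; rewrite /lowering dz_lincomb // mulr_sumr -sumrN -big_split /=.
by apply: eq_bigr => k _; ring.
Qed.

Lemma landau_lincomb m n (c : 'I_n -> C) (F : 'I_n -> R * R ->
  C) p : (forall k, csmooth (F k)) ->
  landau m (fun q => \sum_(k < n) c k * F k q) p =
    \sum_(k < n) c k * landau m (F k) p.
Proof.
move=> sF; have sD k : csmooth (raising (F k)) by exact: csmooth_raising.
rewrite -lowering_raising; last exact: csmooth_lincomb.
have -> : raising (fun q => \sum_(k < n) c k * F k q) =
    fun q => \sum_(k < n) c k * raising (F k) q.
  by apply/funext => q; exact: raising_lincomb.
rewrite lowering_lincomb //; apply: eq_bigr => k _.
by rewrite lowering_raising.
Qed.

Lemma landau_eigen_lincomb m mu n (c : 'I_n -> C) (F : 'I_n -> sect) :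
  (forall k, landau_eigen m mu (F k)) -> landau_eigen m mu (lincomb c F).
Proof.
move=> eF; have s1 k : csmooth (F k).1 by have [[]] := eF k.
have s2 k : csmooth (F k).2 by have [[]] := eF k.
split; first split; try exact: csmooth_lincomb.
  move=> p p0 /=; rewrite mulr_sumr; apply: eq_bigr => k _.
  by have [[_ _ T] _] := eF k; rewrite T // mulrCA.
move=> p; split; rewrite /= landau_lincomb // mulr_sumr; apply: eq_bigr => k _;
  by have [_ /(_ p)[e1 e2]] := eF k; rewrite ?e1 ?e2 mulrCA.
Qed.

Definition raise F : sect := (raising F.1, fun q => - raising F.2 q).
Definition lower m F : sect := (lowering m.+2 F.1, fun q =>
  - lowering m.+2 F.2 q).

Lemma loweringN m f p : csmooth f -> lowering m (fun q =>
  - f q) p = - lowering m f p.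
Proof.
by move=> sf; rewrite /lowering (wder_dz (wderN (wder_csmooth p sf))); ring.
Qed.

Lemma raisingN f p : csmooth f -> raising (fun q => - f q) p = - raising f p.
Proof.
by move=> sf; rewrite /raising (wder_dzb (wderN (wder_csmooth p sf))); ring.
Qed.

Lemma raisingZ k f p : csmooth f -> raising (fun q =>
  k * f q) p = k * raising f p.
Proof.
by move=> sf; rewrite /raising dzbZ //; ring.
Qed.

Lemma loweringZ m k f p : csmooth f -> lowering m (fun q =>
  k * f q) p = k * lowering m f p.
Proof.
by move=> sf; rewrite /lowering dzZ //; ring.
Qed.

Lemma landauN m f p : csmooth f -> landau m (fun q => - f q) p = - landau m f p.
Proof.
move=> sf; rewrite -!lowering_raising //; last exact: csmoothN.
have -> : raising (fun q => - f q) = fun q => - raising f q.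
  by apply/funext => q; exact: raisingN.
by rewrite loweringN //; exact: csmooth_raising.
Qed.

Lemma landau_raising (m : nat) (mu : R) f p : csmooth f ->
  (forall q, landau m f q = mu%:C%C * f q) ->
  landau m.+2 (raising f) p = (mu - m.+2%:R)%:C%C * raising f p.
Proof.
move=> sf ef; have sr := csmooth_raising sf.
have := raising_lowering m.+2 p sr.
have -> : lowering m.+2 (raising f) = fun q => mu%:C%C * f q.
  by apply/funext => q; rewrite lowering_raising.
rewrite raisingZ // => E.
by rewrite -[LHS](addrK (m.+2%:R * raising f p)) -E rmorphB rmorph_nat mulrBl.
Qed.

Lemma raiseP m mu F : landau_eigen m mu F -> landau_eigen m.+2 (mu - m.+2%:R)
  (raise F).
Proof.
move=> [tF eF]; have [s1 s2 T] := tF; split; first exact: transition_raising.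
move=> p; have e1 q := (eF q).1; have e2 q := (eF q).2.
split; rewrite /=; first exact: landau_raising.
by rewrite landauN ?(landau_raising p s2 e2) ?mulrN //; exact: csmooth_raising.
Qed.

Lemma landau_lowering (m : nat) (mu : R) f p : csmooth f ->
  (forall q, landau m.+2 f q = (mu - m.+2%:R)%:C%C * f q) ->
  landau m (lowering m.+2 f) p = mu%:C%C * lowering m.+2 f p.
Proof.
move=> sf ef; have sr := csmooth_lowering m.+2 sf.
rewrite -lowering_raising //.
have -> : raising (lowering m.+2 f) = fun q => mu%:C%C * f q.
  by apply/funext => q; rewrite raising_lowering // ef rmorphB rmorph_nat; ring.
by rewrite loweringZ.
Qed.

Lemma lowerP m mu F : landau_eigen m.+2 (mu - m.+2%:R) F ->
  landau_eigen m mu (lower m F).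
Proof.
move=> [tF eF]; have [s1 s2 T] := tF; split; first exact: transition_lowering.
move=> p; have e1 q := (eF q).1; have e2 q := (eF q).2.
split; rewrite /=; first exact: landau_lowering.
by rewrite landauN ?(landau_lowering p s2 e2) ?mulrN //;
  exact: csmooth_lowering.
Qed.

(* [raise] and [lower m] are inverse to each other up to the factor [mu]. *)
Lemma has_family_shift m mu n : mu != 0 ->
  has_family (landau_eigen m mu) n <-> has_family (landau_eigen m.+2 (mu -
    m.+2%:R)) n.
Proof.
move=> mu0; have mu0C : mu%:C%C != 0 :> C.
  by apply: contra_neq mu0 => /(congr1 (@complex.Re R)).
split.
  apply: (has_family_map (Phi := raise)) => [F|]; first exact: raiseP.
  move=> c F eF H; have eL := landau_eigen_lincomb c eF.
  have s1 k : csmooth (F k).1 by have [[]] := eF k.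
  have s2 k : csmooth (F k).2 by have [[]] := eF k.
  have D1 : raising (lincomb c F).1 = fun=> 0.
    by apply/funext => q; rewrite raising_lincomb //; have [] := H q.
  have D2 : raising (lincomb c F).2 = fun=> 0.
    apply/funext => q; rewrite raising_lincomb //; have [_ /= E] := H q.
    by apply: oppr_inj; rewrite oppr0 -[RHS]E -sumrN; apply: eq_bigr => k _;
      rewrite mulrN.
  have [[t1 t2 _] e] := eL; move=> p; have [e1 e2] := e p.
  have l0 q : lowering m.+2 (fun=> 0 : C) q = 0.
    by rewrite /lowering (wder_dz (wder_cst 0 q)) mulr0 oppr0 addr0.
  move: e1 e2; rewrite -!lowering_raising // D1 D2 !l0 => e1 e2.
  by split; apply: (mulfI mu0C); rewrite mulr0.
apply: (has_family_map (Phi := lower m)) => [F|]; first exact: lowerP.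
move=> c F eF H; have eL := landau_eigen_lincomb c eF.
have s1 k : csmooth (F k).1 by have [[]] := eF k.
have s2 k : csmooth (F k).2 by have [[]] := eF k.
have D1 : lowering m.+2 (lincomb c F).1 = fun=> 0.
  by apply/funext => q; rewrite lowering_lincomb //; have [] := H q.
have D2 : lowering m.+2 (lincomb c F).2 = fun=> 0.
  apply/funext => q; rewrite lowering_lincomb //; have [_ /= E] := H q.
  by apply: oppr_inj; rewrite oppr0 -[RHS]E -sumrN; apply: eq_bigr => k _;
    rewrite mulrN.
have [[t1 t2 _] e] := eL; move=> p; have [e1 e2] := e p.
have r0 q : raising (fun=> 0 : C) q = 0.
  by rewrite /raising (wder_dzb (wder_cst 0 q)) mulr0.
have := raising_lowering m.+2 p t1; have := raising_lowering m.+2 p t2.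
rewrite D1 D2 !r0 e1 e2 -!mulrDl rmorphB rmorph_nat subrK => E2 E1.
by split; apply: (mulfI mu0C); rewrite mulr0.
Qed.

Lemma nsq_normc (a : C) : (nsq a)%:C%C = `|a| ^+ 2.
Proof.
by rewrite sqr_normc; case: a => x y; apply: eq_C; rewrite /nsq /=; ring.
Qed.

(** The inequality says that the eigenvalue [mu + m / 2] of the magnetic Laplacian is negative. *)
Lemma landau_eigen_neg m mu F : 2 * mu + m%:R < 0 -> landau_eigen m mu F ->
  null_section F.
Proof.
move=> neg eF; have [tF _] := eF; have [[s1 s2 _] e] := to_sectionP eF.
have l0 : mu + m%:R / 2 < 0 by lra.
have N12 p q : cplx p * cplx q = 1 ->
    nsq ((to_section m F).1 p) = nsq ((to_section m F).2 q).
  move=> pq; have [p0 _] := inversion_unique pq.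
  have W : nsq ((cplx p / `|cplx p|) ^ (- m%:Z)) = 1.
    apply: (@complexI R); rewrite nsq_normc -exprnN normfV normrX.
    by rewrite normf_div normr_id divff ?normr_eq0 // expr1n invr1 expr1n.
  by rewrite [(to_section m F).2 q](transition_unitary tF pq) [RHS]nsqM W mul1r.
have H := max_principle l0 s1 s2 N12 (fun q => (e q).1) (fun q => (e q).2).
move=> p; have h0 := expf_neq0 m (hC_neq0 p); have [H1 H2] := H p.
by split; apply: (mulfI h0); rewrite mulr0.
Qed.

Lemma has_family_null (S : sect -> Prop) n : (forall u, S u ->
  null_section u) ->
  has_family S n -> n = 0%N.
Proof.
move=> S0 [u [Su li]]; case: n u Su li => // n u Su li.
suff H p : \sum_(k < n.+1) 1 * (u k).1 p = 0 /\ \sum_(k < n.+1) 1 * (u k).2 p =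
  0.
  by have /eqP := li (fun=> 1) H ord0; rewrite oner_eq0.
by split; rewrite big1 // => k _; have [h1 h2] := S0 _ (Su k) p;
  rewrite ?h1 ?h2 mulr0.
Qed.

End Eigenspaces.

(** * Holomorphic sections *)

Section Holomorphic.
Variable R : realType.
Local Notation C := R[i].
Local Notation sect := ((R * R -> C) * (R * R -> C))%type.
Implicit Types (f g : R * R -> C) (p q v : R * R) (u F : sect).

Definition hol f := csmooth f /\ forall p, dzb f p = 0.

Lemma hol_dz f : hol f -> hol (dz f).
Proof.
move=> [sf Hf]; split=> [|p]; first exact: csmooth_dz.
rewrite -dz_dzb // (_ : dzb f = fun=> 0); last exact/funext.
exact: wder_dz (wder_cst 0 p).
Qed.

Lemma hol_iter k f : hol f -> hol (iter k (@dz R) f).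
Proof. move=> hf; elim: k => [|k IH]; [exact: hf | exact: (hol_dz IH)]. Qed.

Lemma landau_hol m f p : hol f -> landau m f p = 0.
Proof.
move=> [sf Hf]; rewrite /landau Hf (_ : dzb f = fun=> 0); last exact/funext.
by rewrite (wder_dz (wder_cst 0 p)) !mulr0 addr0.
Qed.

(** That the kernel of D_m^* D_m is the kernel of D_m follows without an inner product: [raise F]
    has flux m + 2 and eigenvalue - (m + 2), so - (m + 2) / 2 for the magnetic Laplacian, and
    vanishes by the maximum principle. *)
Lemma landau_eigen0P m F : landau_eigen m 0 F <->
  [/\ transition m F, hol F.1 & hol F.2].
Proof.
split=> [eF|[tF h1 h2]]; last first.
  by split=> // p; rewrite !landau_hol // !mul0r.
have [tF _] := eF; have [s1 s2 _] := tF.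
have neg : 2 * (0 - m.+2%:R) + m.+2%:R < 0 :> R.
  rewrite sub0r (_ : _ + _ = - m.+2%:R); last by ring.
  by rewrite oppr_lt0 ltr0n.
have N := landau_eigen_neg neg (raiseP eF).
have r0 p : rhoC p ^+ 2 != 0 :> C by rewrite expf_neq0 // rhoC_neq0.
split=> //; split=> // p; have [] := N p; rewrite /= /raising.
  by move=> E _; apply: (mulfI (r0 p)); rewrite mulr0.
by move=> _ /eqP; rewrite oppr_eq0 => /eqP E; apply: (mulfI (r0 p));
  rewrite mulr0.
Qed.

(* [d/dz], acting on sections of flux [m], read in the other chart. *)
Definition infdual (m : nat) g q : C := m%:R * cplx q * g q - cplx q ^+
  2 * dz g q.

Lemma csmooth_infdual m g : csmooth g -> csmooth (infdual m g).
Proof.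
have sz := csmooth_cplx R.
move=> sg; apply: csmoothD; first by apply: csmoothM => //; exact: csmoothZ.
by apply: csmoothN; apply: csmoothM; [exact: csmoothX | exact: csmooth_dz].
Qed.

Lemma csmooth_iter_infdual m k g : csmooth g -> csmooth (iter k (infdual m) g).
Proof. by move=> sg; elim: k => //= k; exact: csmooth_infdual. Qed.

Lemma csmooth_iter_dz k g : csmooth g -> csmooth (iter k (@dz R) g).
Proof. by move=> sg; elim: k => //= k; exact: csmooth_dz. Qed.

Lemma transition_iter_dz m F k : transition m F ->
  transition m (iter k (@dz R) F.1, iter k (infdual m) F.2).
Proof.
move=> tF; elim: k => [|k IH]; first by case: F tF.
have [s1 s2 _] := IH; split; [exact: csmooth_dz | exact: csmooth_infdual |].
by move=> p p0; have [E _] := dz_transition IH p0; rewrite [LHS]E.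
Qed.

Lemma infdualD m f g p : csmooth f -> csmooth g ->
  infdual m (fun q => f q + g q) p = infdual m f p + infdual m g p.
Proof. by move=> sf sg; rewrite /infdual dzD //; ring. Qed.

Lemma infdual_cplx m k g p : csmooth g ->
  infdual m.+1 (fun q => k * cplx q * g q) p = k * cplx p * infdual m g p.
Proof.
move=> sg; rewrite /infdual.
rewrite (wder_dz (wderM (wderZ k (wder_cplx p)) (wder_csmooth p sg))) -natr1.
by ring.
Qed.

Lemma infdualS m g p : infdual m.+1 g p = infdual m g p + cplx p * g p.
Proof. by rewrite /infdual -natr1; ring. Qed.

(** Raising the flux by one adds multiplication by z to [infdual], and [infdual m.+1] passes a
    factor z by becoming [infdual m]. So every iteration contributes one more copy of the second
    term. *)
Lemma iter_infdualS m k g : csmooth g -> iter k (infdual m.+1) g =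
  fun p => iter k (infdual m) g p + k%:R * cplx p * iter k.-1 (infdual m) g p.
Proof.
move=> sg; elim: k => [|k IH]; first by apply/funext => p;
  rewrite mul0r mul0r addr0.
apply/funext => p; rewrite iterS IH.
have s1 := csmooth_iter_infdual m k sg; have s2 :=
  csmooth_iter_infdual m k.-1 sg.
rewrite infdualD //; last first.
  by apply: csmoothM => //; apply: csmoothZ; exact: csmooth_cplx.
rewrite infdual_cplx // infdualS /=.
case: k {IH s1 s2} => [|k] /=; rewrite -?natr1; last first.
  by set X := infdual m (infdual m _) p; set Y := infdual m _ p; ring.
by set X := infdual m g p; ring.
Qed.

(* Bol's lemma: the (m+1)-st derivative maps flux [m] to flux [- m - 2]. *)
Lemma bol m g : csmooth g -> iter m.+1 (infdual m) g =
  fun p => (- cplx p ^+ 2) ^+ m.+1 * iter m.+1 (@dz R) g p.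
Proof.
move=> sg; elim: m => [|m IH].
  by apply/funext => p; rewrite /= /infdual; ring.
(* At flux m + 1 the (m+2)-fold iterate is a combination of the (m+2)- and (m+1)-fold iterates at
   flux m, and both are known from the induction hypothesis. *)
rewrite iter_infdualS //; apply/funext => p; rewrite [m.+2.-1]/= iterS IH.
have sG := csmooth_iter_dz m.+1 sg; rewrite [in RHS]iterS.
set G := iter m.+1 _ g in sG *; rewrite /infdual.
have W := wderM (wderX m.+1 (wderN (wderX 2 (wder_cplx p)))) (wder_csmooth p
  sG).
rewrite (wder_dz W) /= !exprS -!natr1.
by set a := G p; set b := dz G p; ring.
Qed.

(* By Bol's lemma these derivatives form a holomorphic section of flux
   [- m - 2], an eigensection for the eigenvalue [- (m + 2) / 2 < 0]. *)
Lemma hol_iter_dz0 m F : transition m F -> hol F.1 -> hol F.2 ->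
  forall p, iter m.+1 (@dz R) F.1 p = 0 /\ iter m.+1 (@dz R) F.2 p = 0.
Proof.
move=> tF h1 h2; have [s1 s2 _] := tF.
set G1 := iter _ _ F.1; set G2 := iter _ _ F.2.
have H1 : hol G1 by exact: hol_iter. have H2 : hol G2 by exact: hol_iter.
have sk : csmooth (fun q => kC q ^+ m.+2 : C).
  exact: csmoothX (csmoothM (csmooth_hC R) (csmooth_rhoC R)).
have eig f p : hol f -> maglap_chart (- m.+2%:Z) (fun q =>
  kC q ^+ m.+2 * f q) p =
    (- (m.+2%:R / 2))%:C%C * (kC p ^+ m.+2 * f p).
  move=> [sf Hf]; rewrite (maglap_gauge (is_gauge_kC R m.+2) p sf) Hf.
  rewrite (_ : dzb f = fun=> 0); last exact/funext.
  rewrite (wder_dz (wder_cst 0 p)) !mulr0 !add0r mulrNz -pmulrn.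
  by rewrite rmorphN rmorphM fmorphV !rmorph_nat; ring.
have l0 : - (m.+2%:R / 2) < 0 :> R by rewrite oppr_lt0 divr_gt0 ?ltr0n.
have N12 p q : cplx p * cplx q = 1 ->
    nsq (kC p ^+ m.+2 * G1 p) = nsq (kC q ^+ m.+2 * G2 q).
  move=> pq; have [p0 qE] := inversion_unique pq.
  have [_ _ T] := transition_iter_dz m.+1 tF.
  have E1 : G1 p = cplx p ^+ m * iter m.+1 (infdual m) F.2 q.
    by rewrite qE; exact: (T p p0).
  rewrite E1 (bol m s2) -/G2.
  (* Up to sign, (- q^2)^(m+1) is q^(m+2) q^m. The factor q^m cancels p^m, and q^(m+2) joins the
     weight, as |kC(p) q| = kC(q). *)
  have E : kC p ^+ m.+2 * (cplx p ^+ m * ((- cplx q ^+ 2) ^+ m.+1 * G2 q)) =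
      (-1) ^+ m.+1 * (kC p * cplx q) ^+ m.+2 * (cplx p * cplx q) ^+ m * G2 q.
    have -> : (- cplx q ^+ 2) ^+ m.+1 = (-1) ^+ m.+1 * (cplx q ^+
      m.+2 * cplx q ^+ m).
      rewrite (exprNn (cplx q ^+ 2) m.+1) -exprD -exprM; by congr (_ * _ ^+ _);
        lia.
    by rewrite !exprMn; ring.
  rewrite E pq expr1n mulr1 (nsqM (_ ^+ _ * _) (G2 q)) (nsqM (kC q ^+
    m.+2) (G2 q)); congr (_ * _).
  have nsqX a n : nsq (a ^+ n : C) = nsq a ^+ n.
    elim: n => [|n IH]; first by rewrite !expr0 /nsq /= expr1n expr0n addr0.
    by rewrite !exprS nsqM IH.
  rewrite (nsqM ((-1) ^+ m.+1)) !nsqX (_ : nsq (-1 : C) = 1);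
    last by rewrite /nsq /=; ring.
  rewrite expr1n mul1r; congr (_ ^+ _).
  have k0 := kC_neq0 p; have h0 := hC_neq0 p.
  have kE r : kC r = (hC r)^-1 :> C.
    by apply: (mulfI (hC_neq0 r)); rewrite hC_kC mulfV // hC_neq0.
  apply: (@complexI R); rewrite !nsq_normc !kE qE hC_inversion // -qE.
  have qE2 : cplx q = (cplx p)^-1 by rewrite -[LHS]mul1r -(mulVf p0) -mulrA pq
    mulr1.
  by rewrite qE2 -invfM !normfV !normrM normr_id mulrC.
have M := max_principle l0 (csmoothM sk H1.1) (csmoothM sk H2.1) N12
  (fun q => eig G1 q H1) (fun q => eig G2 q H2).
move=> p; have k0 := expf_neq0 m.+2 (kC_neq0 p); have [M1 M2] := M p.
by split; apply: (mulfI k0); rewrite mulr0.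
Qed.

Lemma cderive0_cst f p q : csmooth f -> (forall v r, cderive v f r = 0) ->
  f p = f q.
Proof.
move=> [s1 s2] D.
have key (h : R * R -> R) : smooth h -> (forall v r, 'D_v h r = 0) -> h p = h q.
  move=> sh Dh; have [c _] := MVT_line q (p.1 - q.1, p.2 - q.2)
    (fun r => smooth_differentiable r sh) ltr01.
  rewrite Dh mul0r /= !mul1r !(addrC _ (_ - _)) !subrK -surjective_pairing.
  by move/eqP; rewrite subr_eq0 => /eqP.
apply: eq_C; [apply: (key (fun r => complex.Re (f r)) s1) => v r
  |apply: (key (fun r => complex.Im (f r)) s2) => v r].
  by have := D v r; rewrite /cderive => -[].
by have := D v r; rewrite /cderive => -[].
Qed.

Lemma hol_taylor0 f p k : hol f -> (forall q, iter k (@dz R) f q = 0) ->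
  (forall i, (i < k)%N -> iter i (@dz R) f p = 0) -> forall q, f q = 0.
Proof.
elim: k f => [|k IH] f hf fk f0; first exact: fk.
have dz0 := IH (dz f) (hol_dz hf).
have {}dz0 q : dz f q = 0.
  apply: dz0 => [r|i ik]; first by rewrite -iterSr.
  by rewrite -iterSr f0.
have [sf Hf] := hf; move=> q; rewrite (cderive0_cst q p sf);
  first exact: (f0 0%N).
by move=> v r; have [_ ->] := wder_csmooth r sf; rewrite dz0 Hf !mulr0 addr0.
Qed.

Lemma iter_dz_off0 f k : (forall q, cplx q != 0 -> f q = 0) ->
  forall q, cplx q != 0 -> iter k (@dz R) f q = 0.
Proof.
move=> f0; elim: k => // k IH q q0 /=.
have nE : \forall r \near q, iter k (@dz R) f r = 0.
  by apply: filterS (near_neq0 q0) => r; exact: IH.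
by have [] := near_wderE nE (wder_cst 0 q).
Qed.

Lemma hol_section_null m F p : transition m F -> hol F.1 -> hol F.2 ->
  (forall i, (i <= m)%N -> iter i (@dz R) F.1 p = 0) -> null_section F.
Proof.
move=> tF h1 h2 F0; have Z := hol_iter_dz0 tF h1 h2.
have Z1 := hol_taylor0 h1 (fun q => (Z q).1) F0.
have [_ _ T] := tF.
have Z2 q : cplx q != 0 -> F.2 q = 0.
  move=> q0; have K := inversionK q0.
  have [p0 E] : cplx (inversion q) != 0 /\ q = inversion (inversion q).
    by apply: inversion_unique; rewrite mulrC.
  have := T _ p0; rewrite -E Z1 => /esym/eqP;
    rewrite mulf_eq0 expf_eq0 (negbTE p0) andbF.
  by move/eqP.
have z1 : cplx (1, 0) != 0 :> C by rewrite cplx10 oner_eq0.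
(* [F.2] is known to vanish off the origin only. Its Taylor coefficients at [(1, 0)] are therefore
   zero, and this settles the origin too. *)
move=> q; split=> //; apply: (hol_taylor0 (p := (1, 0)) h2 (fun q => (Z q).2)).
by move=> i _; exact: iter_dz_off0.
Qed.

Lemma iter_dz_lincomb n (c : 'I_n -> C) (F : 'I_n -> R * R -> C) i :
  (forall k, csmooth (F k)) ->
  iter i (@dz R) (fun q => \sum_(k < n) c k * F k q) =
  fun q => \sum_(k < n) c k * iter i (@dz R) (F k) q.
Proof.
move=> sF; elim: i => // i IH; rewrite iterS IH; apply/funext => q.
by rewrite dz_lincomb // => k; exact: csmooth_iter_dz.
Qed.

Lemma has_family_hol_le m n : has_family (landau_eigen m (0 : R)) n ->
  (n <= m.+1)%N.
Proof.
move=> [u [eu li]]; rewrite leqNgt; apply/negP => nm.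
(* Row [k] lists the derivatives of [u k] up to order m at the origin. With more rows than columns,
   some nonzero combination of the sections has zero Taylor polynomial. *)
pose A : 'M[C]_(n, m.+1) := \matrix_(k, i) iter i (@dz R) (u k).1 (0, 0).
have K0 : kermx A != 0.
  rewrite -mxrank_eq0 mxrank_ker subn_eq0 -ltnNge.
  exact: leq_ltn_trans (rank_leq_col A) nm.
pose c := nz_row (kermx A).
have c0 : c != 0 by rewrite nz_row_eq0.
have cA : c *m A = 0 by apply/sub_kermxP; exact: nz_row_sub.
have eL := landau_eigen_lincomb (fun k => c 0 k) eu.
have [tL h1 h2] := (landau_eigen0P _ _).1 eL.
have s1 k : csmooth (u k).1 by have [[]] := eu k.
have N : null_section (lincomb (fun k => c 0 k) u).
  apply: (hol_section_null (p := (0, 0)) tL h1 h2) => i im.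
  rewrite iter_dz_lincomb //; have /matrixP/(_ 0 (Ordinal (im : i < m.+1)%N))
    := cA.
  rewrite !mxE => cAi; rewrite -[RHS]cAi.
  by apply: eq_bigr => k _; rewrite mxE.
move/eqP: c0; apply; apply/rowP => k; rewrite mxE.
by apply: (li (fun k => c 0 k)) => p; exact: N.
Qed.

Lemma has_family_hol m n : (n <= m.+1)%N -> has_family (landau_eigen m (0 : R))
  n.
Proof.
move=> nm; pose F (k : 'I_n) : sect := (fun p => cplx p ^+ k, fun p =>
  cplx p ^+ (m - k)).
have hX i : hol (fun p => cplx p ^+ i : C).
  split=> [|p]; first exact: csmoothX (csmooth_cplx R).
  by rewrite (wder_dzb (wderX i (wder_cplx p))) mulr0.
exists F; split=> [k|c c0].
  apply/landau_eigen0P; split; try exact: hX.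
  split; try by [have [] := hX k | have [] := hX (m - k)%N].
  move=> p p0 /=; have K := inversionK p0.
  have km : (k <= m)%N by rewrite -ltnS; exact: leq_trans (ltn_ord k) nm.
  by rewrite -{1}(subnKC km) exprD -mulrA -exprMn K expr1n mulr1.
pose P : {poly C} := \poly_(i < n) (if insub i is Some k then c k else 0).
have P0 : P = 0.
  apply/eqP; apply: contraT => Pn0.
  (* The relation between the monomials, evaluated at integers on the real axis, gives [P] as many
     roots as its size. *)
  pose rs : seq C := [seq i%:R | i <- iota 0 (size P)].
  have : (size rs < size P)%N.
    apply: max_poly_roots => //.
      apply/allP => _ /mapP[i _ ->]; rewrite /root horner_poly.
      have [E _] := c0 (i%:R, 0); apply/eqP; rewrite -[RHS]E.
      apply: eq_bigr => k _; rewrite valK /=; congr (_ * _ ^+ _).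
      exact: (esym (rmorph_nat (real_complex R) i)).
    rewrite map_inj_uniq ?iota_uniq // => i j /eqP; rewrite eqr_nat; exact/eqP.
  by rewrite size_map size_iota ltnn.
move=> k; have := congr1 (fun p : {poly C} => p`_k) P0.
by rewrite coef_poly ltn_ord valK coef0.
Qed.

End Holomorphic.

(** * The spectrum and the heat trace *)

Section Spectrum.
Variable R : realType.

(** This is nu_(m,j) - m/2. One step of the ladder sends level j + 1 at flux m to level j at flux m
    + 2, as (j + 1) (j + m + 2) - (m + 2) = j (j + m + 3). *)
Definition landau_level (m j : nat) : R := j%:R * (j + m).+1%:R.

Lemma has_family_landau_level m j n :
  has_family (landau_eigen m (landau_level m j)) n <-> (n <= m + j.*2.+1)%N.
Proof.
elim: j m => [|j IH] m.
  rewrite /landau_level mul0r addn1; split; first exact: has_family_hol_le.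
  exact: has_family_hol.
rewrite has_family_shift; last by rewrite mulf_neq0 // pnatr_eq0.
have -> : landau_level m j.+1 - m.+2%:R = landau_level m.+2 j.
  by rewrite /landau_level -!natr1 !natrD -!natr1; ring.
by rewrite IH doubleS !addSn !addnS.
Qed.

(** Raising decreases [2 * mu + m], twice the eigenvalue of the magnetic Laplacian, by 2 m + 2, so
    finitely many steps make it negative. Only mu = 0 would stop the ladder, and that is level 0 of
    the flux reached. *)
Lemma has_family_not_level m mu n : (forall j, mu <> landau_level m j) ->
  has_family (landau_eigen m mu) n -> n = 0%N.
Proof.
have [K] : exists K, 2 * mu + m%:R < K%:R.
  exists (Num.bound `|2 * mu + m%:R|).
  by rewrite (le_lt_trans (ler_norm _)) // archi_boundP // normr_ge0.
elim: K m mu => [|K IH] m mu muK nl.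
  by apply: has_family_null => F; exact: landau_eigen_neg.
have mu0 : mu != 0 by apply/eqP => mu0; apply: (nl 0%N);
  rewrite mu0 /landau_level mul0r.
move/(has_family_shift m n mu0); apply: IH => [|j E].
  move: muK; rewrite -!natr1 => muK; have := ler0n R m; lra.
apply: (nl j.+1); rewrite -[LHS](subrK m.+2%:R) E /landau_level.
by rewrite -!natr1 !natrD -!natr1; ring.
Qed.

Lemma multiplicityE (m : nat) (l : R) N :
  (forall n, has_family (eigensection m l) n <-> (n <= N)%N) ->
  multiplicity m l = N%:R%:E.
Proof.
move=> H; apply/eqP; rewrite eq_le; apply/andP; split.
  apply: ge_ereal_sup => _ [n [u ul] <-].
  by rewrite lee_fin ler_nat; apply/H; exists u.
by apply: ereal_sup_ubound; exists N => //; exact/H.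
Qed.

Definition eigenvalue_nu (m j : nat) : R := landau_level m j + m%:R / 2.

Lemma multiplicity_nu (m j : nat) : multiplicity m (eigenvalue_nu m j) = (m +
  j.*2.+1)%:R%:E.
Proof.
apply: multiplicityE => n; rewrite -has_family_to_section /eigenvalue_nu addrK.
exact: has_family_landau_level.
Qed.

Lemma multiplicity0 (m : nat) l : (forall j, l <> eigenvalue_nu m j) ->
  multiplicity m l = 0%E.
Proof.
move=> nl; rewrite (@multiplicityE _ _ 0) // => n;
  rewrite -has_family_to_section leqn0.
split=> [/has_family_not_level->//|/eqP->].
  by move=> j E; apply: (nl j); rewrite /eigenvalue_nu -E subrK.
exists (fun k : 'I_0 => (fun=> 0, fun=> 0)); split; first by case.
by move=> c _ [].
Qed.

Lemma eigenvalue_nu_inj m : injective (eigenvalue_nu m).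
Proof.
move=> i j /addIr; rewrite /landau_level -!natrM => /eqP;
  rewrite eqr_nat => /eqP.
by move=> E; nia.
Qed.

(** Completing the square: nu_(m,j) = (j + a)^2 - (m^2 + 1) / 4 with a = (m + 1) / 2, and the
    multiplicity m + 2 j + 1 is 2 (j + a). *)
Lemma heat_traceE (m : nat) (t S : R) :
  series (fun j => 2 * (j%:R + (m%:R + 1) / 2) *
     expR (- t * (j%:R + (m%:R + 1) / 2) ^+ 2)) @ \oo --> S ->
  heat_trace m t = (S * expR (t * ((m%:R ^+ 2 + 1) / 4)))%:E.
Proof.
move=> cS; rewrite /heat_trace.
pose nu := eigenvalue_nu m.
have -> : (\esum_(l in [set: R]) ((expR (- t * l))%:E * multiplicity m l) =
    \esum_(l in range nu) ((expR (- t * l))%:E * multiplicity m l))%E.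
  rewrite [RHS]esum_mkcond; apply: eq_esum => l _; case: ifPn => // /negP nl.
  rewrite multiplicity0 ?mule0 // => j E; apply: nl.
  by apply/mem_set; exists j.
pose w (j : nat) := 2 * (j%:R + (m%:R + 1) / 2) * expR (- t * (j%:R + (m%:R +
  1) / 2) ^+ 2).
pose k := expR (t * ((m%:R ^+ 2 + 1) / 4)).
rewrite esum_set_image /=; last first.
- by move=> i j _ _; exact: eigenvalue_nu_inj.
- by move=> n _; rewrite multiplicity_nu mule_ge0 // lee_fin ?expR_ge0 ?ler0n.
rewrite (eq_eseriesl (Q := xpredT)); last by move=> i; exact: in_setT.
rewrite (eq_eseriesr (g := fun j => (w j * k)%:E)); last first.
  move=> j _; rewrite multiplicity_nu -EFinM; congr (_%:E).
  rewrite /w /k -mulrA -expRD mulrC; congr (_ * expR _).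
    rewrite natrD -addn1 natrD -muln2 natrM; by field.
  rewrite /nu /eigenvalue_nu /landau_level -natr1 natrD; by field.
apply: cvg_lim => //.
rewrite (_ : (fun n => _) = (fun n => (series w n * k)%:E)); last first.
  by apply/funext => n; rewrite sumEFin /series /= mulr_suml.
apply: cvg_EFin; first exact: nearW.
exact: cvgMl.
Qed.

End Spectrum.

(** * Bernoulli numbers and derivatives of Gaussians *)

Section Bernoulli.
Variable R : numFieldType.

Lemma size_bernoulli_seq n : size (bernoulli_seq R n) = n.+1.
Proof. by elim: n => //= n IH; rewrite size_rcons IH. Qed.

Lemma nth_bernoulli_seq n k : (k <= n)%N -> (bernoulli_seq R n)`_k =
  bernoulli R k.
Proof.
elim: n => [|n IH]; first by rewrite leqn0 => /eqP->.
rewrite leq_eqVlt ltnS => /orP[/eqP->//|kn].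
by rewrite /= nth_rcons size_bernoulli_seq ltnS kn IH.
Qed.

Lemma sum_bernoulli n :
  \sum_(i < n.+1) 'C(n.+1, i)%:R * bernoulli R i = (n == 0)%:R.
Proof.
case: n => [|n]; first by rewrite big_ord1 bin0 mul1r.
have E : bernoulli R n.+1 =
    - (\sum_(k < n.+1) 'C(n.+2, k)%:R * bernoulli R k) / n.+2%:R.
  rewrite {1}/bernoulli /= nth_rcons size_bernoulli_seq ltnn eqxx.
  congr (- _ / _); apply: eq_bigr => k _.
  by rewrite nth_bernoulli_seq // -ltnS.
rewrite big_ord_recr /= E binSn mulrC divfK ?pnatr_eq0 //.
by rewrite addrN.
Qed.

Lemma bernoulli_polyE n (x : R) : (bernoulli_poly R n).[x] =
  \sum_(p < n.+1) 'C(n, p)%:R * bernoulli R p * x ^+ (n - p).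
Proof.
rewrite /bernoulli_poly horner_sum; apply: eq_bigr => p _.
by rewrite hornerZ hornerXn.
Qed.
End Bernoulli.

Section EulerMaclaurin.
Variable R : realType.

Lemma mvt_bound (f df : R -> R) (h K : R) : 0 <= h ->
  (forall x : R, is_derive x 1 f (df x)) ->
  (forall x, 0 <= x <= h -> `|df x| <= K) -> f 0 = 0 -> `|f h| <= K * h.
Proof.
move=> h0 D B f0; move: h0; rewrite le_eqVlt => /orP[/eqP<-|h0].
  by rewrite f0 normr0 mulr0.
have cf : {within `[0, h], continuous f}.
  by apply: derivable_within_continuous => x _; case: (D x).
have [c] := MVT h0 (fun x _ => D x) cf.
rewrite in_itv /= f0 !subr0 => /andP[c0 ch] ->.
by rewrite normrM (ger0_norm (ltW h0)) ler_wpM2r ?(ltW h0) // B // !ltW.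
Qed.

Lemma is_derive_horner (P : {poly R}) (s : R) :
  is_derive s 1 (fun y => P.[y]) P^`().[s].
Proof.
apply: DeriveDef; first exact: derivable_horner.
by rewrite -derive1E -derivE.
Qed.

(** The derivative of the error is the error of order one less for the derivative. On an interval of
    length at most 1 the mean value theorem then passes on the bound [K] unchanged; the factor 1 /
    N! is given away. *)
Lemma taylor_bound (N : nat) (g : nat -> R -> R) (x K : R) :
  (forall n (y : R), is_derive y 1 (g n) (g n.+1 y)) ->
  (forall y, x <= y <= x + 1 -> `|g N y| <= K) ->
  forall h, 0 <= h <= 1 ->
  `|g 0%N (x + h) - \sum_(r < N) h ^+ r / r`!%:R * g r x| <= K.
Proof.
move=> D; elim: N g D => [|N IH] g D B h /andP[h0 h1].
  rewrite big_ord0 subr0; apply: B; lra.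
pose f (s : R) := g 0%N (x + s) - \sum_(r < N.+1) s ^+ r / r`!%:R * g r x.
pose df (s : R) := g 1%N (x + s) - \sum_(r < N) s ^+ r / r`!%:R * g r.+1 x.
have Df (s : R) : is_derive s 1 f (df s).
  pose P : {poly R} := \poly_(r < N.+1) (g r x / r`!%:R).
  have EP y : \sum_(r < N.+1) y ^+ r / r`!%:R * g r x = P.[y].
    by rewrite horner_poly; apply: eq_bigr => r _; rewrite mulrC mulrA mulrAC.
  have EP' : \sum_(r < N) s ^+ r / r`!%:R * g r.+1 x = P^`().[s].
    have -> : P^`() = \poly_(r < N) (g r.+1 x / r`!%:R).
      apply/polyP => i; rewrite coef_deriv !coef_poly ltnS; case: ifP => _;
        last by rewrite mul0rn.
      have n0 : i.+1%:R != 0 :> R by rewrite pnatr_eq0.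
      have key (u a b : R) : a != 0 -> u / (a * b) * a = u / b.
        by move=> a0; rewrite invfM mulrA mulrAC divfK.
      by rewrite factS natrM -[LHS]mulr_natr; exact: key.
    by rewrite horner_poly; apply: eq_bigr => r _; rewrite mulrC mulrA mulrAC.
  rewrite /f /df EP'; under eq_fun do rewrite EP.
  have D0 : is_derive s 1 (fun y => g 0%N (x + y)) (g 1%N (x + s)).
    have Ds : is_derive s 1 (fun y => x + y) (0 + 1).
      exact: is_deriveD (is_derive_cst x s 1) (is_derive_id s 1).
    by apply: is_derive_eq (is_derive1_comp (D 0%N (x + s)) Ds) _;
      rewrite add0r mulr1.
  exact: is_deriveB D0 (is_derive_horner P s).
have K0 : 0 <= K.
  by apply: le_trans (B x _); rewrite ?normr_ge0 // lexx lerDl ler01.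
apply: (@le_trans _ _ (K * h)); last by rewrite ler_piMr.
apply: (mvt_bound h0 Df).
  move=> s /andP[s0 sh]; apply: (IH (fun n => g n.+1)) => //.
  by rewrite s0 (le_trans sh).
rewrite /f addr0 big_ord_recl expr0 fact0 divr1 mul1r big1 ?addr0 ?subrr //.
by move=> i _; rewrite lift0 expr0n /= !mul0r.
Qed.

(** This is (- sqrt t)^n H_n(sqrt t x) for the Hermite polynomials H_n, by their three-term
    recurrence: the polynomial factor in the n-th derivative of e^(- t x^2). *)
Fixpoint herm (t x : R) (n : nat) : R :=
  match n with
  | 0 => 1
  | n'.+1 => - (2 * t * x) * herm t x n' - 
      (if n' is n''.+1 then 2 * t * n'%:R * herm t x n'' else 0)
  end.

Lemma hermSS t x n :
  herm t x n.+2 = - (2 * t * x) * herm t x n.+1 - 2 * t * n.+1%:R * herm t x n.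
Proof. by []. Qed.

Lemma hermS t x n :
  herm t x n.+1 = - (2 * t * x) * herm t x n - 2 * t * n%:R * herm t x n.-1.
Proof. by case: n => [|n] //=; rewrite mulr0 mul0r. Qed.

Lemma is_derive_prod (f g : R -> R) (x df dg d : R) :
  is_derive x 1 f df -> is_derive x 1 g dg -> d = df * g x + f x * dg ->
  is_derive x 1 (fun y => f y * g y) d.
Proof.
move=> Df Dg ->; apply: is_derive_eq (is_deriveM Df Dg) _.
by rewrite /GRing.scale /= addrC [g x * _]mulrC.
Qed.

Lemma is_derive_herm (t : R) n (x : R) :
  is_derive x 1 (fun y => herm t y n) (- (2 * t) * n%:R * herm t x n.-1).
Proof.
have Dl : is_derive x 1 (fun y : R => - (2 * t * y)) (- (2 * t)).
  have := is_derive_horner ((- (2 * t)) *: 'X) x.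
  rewrite derivZ derivX hornerZ hornerC mulr1.
  by under eq_fun do rewrite hornerZ hornerX mulNr.
have two : is_derive x 1 (fun y => herm t y n) (- (2 * t) * n%:R * herm t x
  n.-1) /\
   is_derive x 1 (fun y => herm t y n.+1) (- (2 * t) * n.+1%:R * herm t x n).
  elim: n => [|n [I1 I2]].
    split; first by rewrite mulr0 mul0r; exact: is_derive_cst.
    rewrite /= !mulr1; under eq_fun do rewrite mulr1 subr0.
    exact: Dl.
  split=> //; under eq_fun do rewrite hermSS.
  have J1 := is_derive_prod Dl I2 erefl.
  have J2 := is_derive_prod (is_derive_cst (2 * t * n.+1%:R) x 1) I1 erefl.
  apply: is_derive_eq (is_deriveB J1 J2) _.
  rewrite [herm t x n.+1]hermS -natr1; case: n {I1 I2 J1 J2} => [|n] /=; ring.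
by case: two.
Qed.

Definition gauss_deriv (t : R) (n : nat) (x : R) : R :=
  herm t x n * expR (- t * x ^+ 2).

Lemma is_derive_gauss (t : R) n (x : R) :
  is_derive x 1 (gauss_deriv t n) (gauss_deriv t n.+1 x).
Proof.
have Dl : is_derive x 1 (fun y : R => - t * y ^+ 2) (- (2 * t * x)).
  have := is_derive_horner ((- t) *: 'X ^+ 2) x.
  rewrite derivZ derivXn hornerZ hornerMn hornerX => D.
  by under eq_fun do rewrite -hornerXn -hornerZ; apply: is_derive_eq D _; ring.
have De := is_derive1_comp (f := @expR R) (g := fun y => - t * y ^+ 2)
  (is_derive_expR (- t * x ^+ 2)) Dl.
apply: is_derive_prod (is_derive_herm t n x) De _.
by rewrite /gauss_deriv hermS /comp; ring.
Qed.

(* What matters is the factor [t ^ L] for derivatives of order [2 L]. *)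
Lemma herm_bound L : exists2 C : R, 0 <= C & forall t x : R, 0 < t ->
  `|herm t x L.*2| <= C * t ^+ L * (1 + t * x ^+ 2) ^+ L /\
  `|herm t x L.*2.+1| <= C * t ^+ L.+1 * `|x| * (1 + t * x ^+ 2) ^+ L.
Proof.
elim: L => [|L [C C0 IH]].
  exists 2 => // t x t0; rewrite !expr0 !mulr1 expr1 /= subr0 mulr1 normr1.
  by rewrite normrN !normrM (gtr0_norm t0) ger0_norm // ler1n.
pose D := C * (L.*2.+1%:R * 2).
have D0 : 0 <= D by rewrite mulr_ge0 // mulr_ge0.
exists (2 * D + L.*2.+2%:R * 2 * C); first by rewrite addr_ge0 // mulr_ge0 //
  mulr_ge0.
move=> t x t0; have [I1 I2] := IH t x t0; have tp := ltW t0.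
set y := t * x ^+ 2 in I1 I2 *.
have y0 : 0 <= y by rewrite mulr_ge0 ?sqr_ge0.
have y1 : 1 <= 1 + y by rewrite lerDl.
have ax0 := normr_ge0 x.
have p0 : 0 <= (1 + y) ^+ L by rewrite exprn_ge0 // (le_trans ler01).
have q0 : 0 <= (1 + y) ^+ L.+1 by rewrite exprn_ge0 // (le_trans ler01).
have pq : (1 + y) ^+ L <= (1 + y) ^+ L.+1 by rewrite exprS ler_peMl.
have t20 : 0 <= 2 * t * `|x| by rewrite !mulr_ge0.
have A1 : `|herm t x L.*2.+2| <= D * t ^+ L.+1 * (1 + y) ^+ L.+1.
  rewrite hermSS; apply: le_trans (ler_normB _ _) _.
  rewrite mulNr normrN !normrM (gtr0_norm t0) !normr_nat.
  have := lerD (ler_wpM2l t20 I2) (ler_wpM2l (mulr_ge0 (mulr_ge0 (ler0n R 2)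
    tp) (ler0n R L.*2.+1)) I1).
  move/le_trans; apply.
  have -> : 2 * t * `|x| * (C * t ^+ L.+1 * `|x| * (1 + y) ^+ L) +
     2 * t * L.*2.+1%:R * (C * t ^+ L * (1 + y) ^+ L) =
     C * t ^+ L.+1 * (1 + y) ^+ L * 2 * (t * `|x| ^+ 2 + L.*2.+1%:R).
    by rewrite exprS; ring.
  have -> : D * t ^+ L.+1 * (1 + y) ^+ L.+1 =
     C * t ^+ L.+1 * (1 + y) ^+ L * 2 * (L.*2.+1%:R * (1 + y)).
    by rewrite /D !exprS; ring.
  apply: ler_wpM2l; first by rewrite !mulr_ge0 // exprn_ge0.
  rewrite real_normK ?num_real // -/y mulrDr mulr1 addrC lerD2l ler_peMl //
    ler1n.
  by [].
have A2 : 0 <= t ^+ L.+1 by rewrite exprn_ge0.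
split.
  rewrite doubleS; apply: (le_trans A1).
  apply: ler_wpM2r => //; apply: ler_wpM2r => //.
  by apply: (@le_trans _ _ (2 * D)); [rewrite ler_peMl // ler1n|rewrite lerDl
    !mulr_ge0].
rewrite doubleS hermSS; apply: le_trans (ler_normB _ _) _.
rewrite mulNr normrN !normrM (gtr0_norm t0) !normr_nat.
have := lerD (ler_wpM2l t20 A1) (ler_wpM2l (mulr_ge0 (mulr_ge0 (ler0n R 2) tp)
  (ler0n R L.*2.+2)) I2).
move/le_trans; apply.
have -> : 2 * t * `|x| * (D * t ^+ L.+1 * (1 + y) ^+ L.+1) +
   2 * t * L.*2.+2%:R * (C * t ^+ L.+1 * `|x| * (1 + y) ^+ L) =
   t ^+ L.+2 * `|x| * (2 * D * (1 + y) ^+ L.+1 + L.*2.+2%:R * 2 * C * (1 +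
     y) ^+ L).
  by rewrite !exprS; ring.
have -> : (2 * D + L.*2.+2%:R * 2 * C) * t ^+ L.+2 * `|x| * (1 + y) ^+ L.+1 =
  t ^+ L.+2 * `|x| * ((2 * D + L.*2.+2%:R * 2 * C) * (1 + y) ^+ L.+1) by ring.
apply: ler_wpM2l; first by rewrite mulr_ge0 // exprn_ge0.
by rewrite [leRHS]mulrDl lerD2l ler_wpM2l // !mulr_ge0.
Qed.

(** The inequality u <= e^u at u = (1 + y) / k, raised to the power [k], gives the constant e
    k^k. *)
Lemma exp_bound k : exists2 C : R, 0 <= C &
  forall y : R, 0 <= y -> (1 + y) ^+ k * expR (- y) <= C.
Proof.
exists (expR 1 * k%:R ^+ k); first by rewrite mulr_ge0 ?expR_ge0 ?exprn_ge0.
move=> y y0; rewrite expRN ler_pdivrMr ?expR_gt0 //.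
rewrite mulrAC -expRD; case: k => [|k].
  by rewrite !expr0 mulr1 -[leLHS]expR0 ler_expR addr_ge0.
have k0 : 0 < k.+1%:R :> R by rewrite ltr0n.
pose u := (1 + y) / k.+1%:R.
have u0 : 0 <= u by rewrite divr_ge0 ?addr_ge0 // ltW.
have uE : 1 + y = u * k.+1%:R by rewrite /u divfK // gt_eqF.
rewrite uE exprMn ler_wpM2r ?exprn_ge0 // ?(ltW k0) // expRM_natr.
by rewrite lerXn2r ?nnegrE ?expR_ge0 // (le_trans _ (expR_ge1Dx u)) // lerDr.
Qed.

(** The factor [t * x ^+ 2] is absorbed by one more power of [1 + t * x ^+ 2]. Divided out, it
    yields the summable decay 1 / x^2 at the cost of one power of t. *)
Lemma gauss_even_bound L : exists2 C : R, 0 <= C & forall t x : R, 0 < t ->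
  `|gauss_deriv t L.*2 x| * (t * x ^+ 2) <= C * t ^+ L.
Proof.
have [C C0 H] := herm_bound L; have [D D0 E] := exp_bound L.+1.
exists (C * D); first by rewrite mulr_ge0.
move=> t x t0; have [I1 _] := H t x t0.
have y0 : 0 <= t * x ^+ 2 by rewrite mulr_ge0 ?sqr_ge0 // ltW.
have := E _ y0; move: y0 I1; rewrite /gauss_deriv mulNr;
  set y := t * x ^+ 2 => y0 I1 Ey.
have p0 : 0 <= (1 + y) ^+ L by rewrite exprn_ge0 // addr_ge0.
have tL : 0 <= t ^+ L by rewrite exprn_ge0 // ltW.
rewrite normrM (ger0_norm (expR_ge0 _)) -[leLHS]mulrA.
have e0 : 0 <= expR (- y) * y by rewrite mulr_ge0 // expR_ge0.
apply: le_trans (ler_wpM2r e0 I1) _.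
have -> : C * t ^+ L * (1 + y) ^+ L * (expR (- y) * y) =
  C * t ^+ L * ((1 + y) ^+ L * expR (- y) * y) by ring.
rewrite [leRHS]mulrAC; apply: ler_wpM2l; first by rewrite mulr_ge0.
apply: le_trans Ey; rewrite exprSr -mulrA (mulrC _ y) -[leRHS]mulrA.
by rewrite ler_wpM2l // ler_wpM2r ?expR_ge0 // lerDr.
Qed.

Lemma gauss_odd_bound L : exists2 C : R, 0 <= C & forall t x : R, 0 < t ->
  `|gauss_deriv t L.*2.+1 x| * (t * x ^+ 2) <= C * t ^+ L.+1 * `|x|.
Proof.
have [C C0 H] := herm_bound L; have [D D0 E] := exp_bound L.+1.
exists (C * D); first by rewrite mulr_ge0.
move=> t x t0; have [_ I1] := H t x t0.
have y0 : 0 <= t * x ^+ 2 by rewrite mulr_ge0 ?sqr_ge0 // ltW.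
have := E _ y0; move: y0 I1; rewrite /gauss_deriv mulNr;
  set y := t * x ^+ 2 => y0 I1 Ey.
have p0 : 0 <= (1 + y) ^+ L by rewrite exprn_ge0 // addr_ge0.
have tL : 0 <= t ^+ L.+1 by rewrite exprn_ge0 // ltW.
rewrite normrM (ger0_norm (expR_ge0 _)) -[leLHS]mulrA.
have e0 : 0 <= expR (- y) * y by rewrite mulr_ge0 // expR_ge0.
apply: le_trans (ler_wpM2r e0 I1) _.
have -> : C * t ^+ L.+1 * `|x| * (1 + y) ^+ L * (expR (- y) * y) =
  C * t ^+ L.+1 * `|x| * ((1 + y) ^+ L * expR (- y) * y) by ring.
have -> : C * D * t ^+ L.+1 * `|x| = C * t ^+ L.+1 * `|x| * D by ring.
apply: ler_wpM2l; first by rewrite !mulr_ge0.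
apply: le_trans Ey; rewrite exprSr -mulrA (mulrC _ y) -[leRHS]mulrA.
by rewrite ler_wpM2l // ler_wpM2r ?expR_ge0 // lerDr.
Qed.

(** Comparison with the harmonic sequence: odd orders are bounded by a multiple of 1 / x, even ones
    by 1 / x^2 <= 1 / (a x). *)
Lemma gauss_cvg0 n (t a : R) : 0 < t -> 2^-1 <= a ->
  (fun J : nat => gauss_deriv t n (a + J%:R)) @ \oo --> (0 : R).
Proof.
move=> t0 a2; have a0 : 0 < a by apply: lt_le_trans a2; rewrite invr_gt0.
have [K K0 HK] : exists2 K : R, 0 <= K & forall x, a <= x ->
  `|gauss_deriv t n x| <= K * x^-1.
  have [[C C0 HC] [D D0 HD]] := (gauss_even_bound n./2, gauss_odd_bound n./2).
  rewrite -(odd_double_half n); case: (odd n); rewrite ?add1n ?add0n.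
    exists (D * t ^+ n./2.+1 / t); first by rewrite !mulr_ge0 ?exprn_ge0
      ?invr_ge0 // ltW.
    move=> x ax; have x0 : 0 < x by exact: lt_le_trans ax.
    have := HD t x t0; rewrite -ler_pdivlMr; last by rewrite mulr_gt0 //
      exprn_gt0.
    rewrite (gtr0_norm x0) => /le_trans; apply; rewrite le_eqVlt; apply/orP;
      left; apply/eqP.
    by field; rewrite !gt_eqF.
  exists (C * t ^+ n./2 / t / a); first by rewrite !mulr_ge0 ?exprn_ge0
    ?invr_ge0 // ltW.
  move=> x ax; have x0 : 0 < x by exact: lt_le_trans ax.
  have := HC t x t0; rewrite -ler_pdivlMr; last by rewrite mulr_gt0 //
    exprn_gt0.
  move/le_trans; apply; rewrite invfM mulrA -!mulrA ler_wpM2l // ler_wpM2l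
    ?exprn_ge0 ?(ltW t0) //.
  rewrite ler_wpM2l ?invr_ge0 ?(ltW t0) // expr2 invfM ler_wpM2r ?invr_ge0
    ?(ltW x0) //.
  by rewrite lef_pV2 ?posrE.
have ch : (fun J => K * 2 * harmonic J) @ \oo --> (0 : R).
  by rewrite -[X in _ --> X](mulr0 (K * 2)); apply: cvgMr; exact: cvg_harmonic.
apply/norm_cvg0P; apply: (squeeze_cvgr _ (cvg_cst 0) ch).
apply: nearW => J; rewrite normr_ge0 /=.
apply: le_trans (HK _ _) _; first by rewrite lerDl.
have p1 : 0 < a + J%:R by rewrite ltr_wpDr.
have p2 : 0 < 2^-1 * J.+1%:R :> R by rewrite mulr_gt0 ?invr_gt0.
(* The factor 2 comes from a + J >= (J + 1) / 2, where a >= 1/2 enters. *)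
rewrite -mulrA ler_wpM2l // -[2]invrK -invfM lef_pV2 ?posrE //.
have := ler0n R J; rewrite -(natr1 J); lra.
Qed.

End EulerMaclaurin.

(** * Euler-Maclaurin summation *)

Section Theta.
Variable R : realType.
Local Notation b i := (bernoulli R i / i`!%:R).

Lemma fact_neq0 n : n`!%:R != 0 :> R.
Proof. by rewrite pnatr_eq0 -lt0n fact_gt0. Qed.

(** The coefficient of z^n in e^z B(z) = B(z) + z, with B(z) = z / (e^z - 1). *)
Lemma bernoulli_convolution n :
  \sum_(i < n.+1) b i / (n - i)`!%:R = b n + (n == 1%N)%:R.
Proof.
rewrite big_ord_recr /= subnn fact0 divr1 addrC; congr (_ + _).
case: n => [|n]; first by rewrite big_ord0.
have E : \sum_(i < n.+1) b i / (n.+1 - i)`!%:R =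
    (\sum_(i < n.+1) 'C(n.+1, i)%:R * bernoulli R i) / n.+1`!%:R.
  rewrite mulr_suml; apply: eq_bigr => i _.
  have f0 := fact_neq0 n.+1; have f1 := fact_neq0 i;
    have f2 := fact_neq0 (n.+1 - i).
  have E : 'C(n.+1, i)%:R * (i`!%:R * (n.+1 - i)`!%:R) = n.+1`!%:R :> R.
    by rewrite -!natrM bin_fact // ltnW.
  apply: (mulIf f0); rewrite [RHS](divfK f0) -E.
  by field; rewrite f1 f2.
rewrite E sum_bernoulli eqSS; case: n {E} => [|n]; first by rewrite divr1.
by rewrite mul0r.
Qed.

(** The identity e^D B(D) = B(D) + D truncated at order [N], where D shifts [G]: each induction step
    adds the antidiagonal i + r = N, which [bernoulli_convolution] sums. *)
Lemma triangular_sum (G : nat -> R) N :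
  \sum_(i < N) b i * \sum_(r < N - i) G (i + r)%N / r`!%:R =
  \sum_(i < N) b i * G i + (1 < N)%:R * G 1%N.
Proof.
elim: N => [|N IH]; first by rewrite !big_ord0 mul0r addr0.
rewrite big_ord_recr /= subSnn big_ord1 addn0 fact0 divr1.
have -> : \sum_(i < N) b i * \sum_(r < N.+1 - i) G (i + r)%N / r`!%:R =
  \sum_(i < N) b i * \sum_(r < N - i) G (i + r)%N / r`!%:R +
  (\sum_(i < N) b i / (N - i)`!%:R) * G N.
  rewrite mulr_suml -big_split /=; apply: eq_bigr => i _.
  rewrite (subSn (ltnW (ltn_ord i))) big_ord_recr /=
    (subnKC (ltnW (ltn_ord i))).
  by ring.
have := bernoulli_convolution N; rewrite big_ord_recr /=
  subnn fact0 divr1 addrC.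
move/addrI => ->; rewrite IH big_ord_recr /=.
case: N {IH} => [|[|N]] /=; rewrite ?big_ord0 ?big_ord1 /=; ring.
Qed.

(** The i-th derivative at x + 1 is expanded to order N - i, so that every remainder involves the
    same derivative [g N]; the Taylor polynomials add up by [triangular_sum]. *)
Lemma euler_maclaurin_step (g : nat -> R -> R) N x K : (1 < N)%N ->
  (forall n (y : R), is_derive y 1 (g n) (g n.+1 y)) ->
  (forall y, x <= y <= x + 1 -> `|g N y| <= K) ->
  `|\sum_(i < N) b i * g i (x + 1) - \sum_(i < N) b i * g i x - g 1%N x| <=
  (\sum_(i < N) `|b i|) * K.
Proof.
move=> N1 D B.
have T (i : 'I_N) : `|g i (x + 1) - \sum_(r < N - i) g (i + r)%N x / r`!%:R| <=
  K.
  have Di n (y : R) : is_derive y 1 (g (i + n)%N) (g (i + n.+1)%N y).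
    by rewrite addnS; exact: D.
  have Bi y : x <= y <= x + 1 -> `|g (i + (N - i))%N y| <= K.
    by rewrite (subnKC (ltnW (ltn_ord i))); exact: B.
  have h1 : 0 <= (1 : R) <= 1 by rewrite ler01 lexx.
  have := taylor_bound Di Bi h1; rewrite addn0.
  by under eq_bigr do rewrite expr1n mul1r mulrC.
have := triangular_sum (fun n => g n x) N; rewrite N1 mul1r => E.
rewrite -addrA -opprD -E -sumrB mulr_suml.
apply: le_trans (ler_norm_sum _ _ _) _; apply: ler_sum => i _.
by rewrite -mulrBr normrM ler_wpM2l.
Qed.

(** Since 1 / (c + 1)^2 <= 1 / c - 1 / (c + 1), the sum is at most 1 / a^2 + 1 / a, and a >= 1/2
    makes this at most 4 + 2. *)
Lemma sum_inv_sqr_le (a : R) J : 2^-1 <= a ->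
  \sum_(j < J) ((a + j%:R) ^+ 2)^-1 <= 6.
Proof.
move=> a2; have a0 : 0 < a by apply: lt_le_trans a2; rewrite invr_gt0.
have p j : 0 < a + j%:R by rewrite ltr_wpDr.
suff H : \sum_(j < J.+1) ((a + j%:R) ^+ 2)^-1 <= 6 - (a + J%:R)^-1.
  apply: (@le_trans _ _ (\sum_(j < J.+1) ((a + j%:R) ^+ 2)^-1)).
    by rewrite big_ord_recr /= lerDl invr_ge0 sqr_ge0.
  by apply: (le_trans H); rewrite gerBl invr_ge0 ltW.
elim: J => [|J IH].
  rewrite big_ord1 addr0 -exprVn.
  have u0 : 0 < a^-1 by rewrite invr_gt0.
  have u2 : a^-1 <= 2 by rewrite -[2]invrK lef_pV2 ?posrE ?invr_gt0.
  nra.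
rewrite big_ord_recr /=.
have p0 := p J; have p1 := p J.+1; have e : a + J.+1%:R = a + J%:R +
  1 by rewrite -natr1 addrA.
rewrite e in p1 *; move: p0 p1 IH; set c := a + J%:R => p0 p1 IH.
apply: le_trans (lerD IH (lexx _)) _.
rewrite -addrA lerD2l -subr_ge0.
have -> : - (c + 1)^-1 - (- c^-1 + ((c + 1) ^+ 2)^-1) = c^-1 * ((c + 1) ^+
  2)^-1.
  by field; rewrite !gt_eqF.
by rewrite mulr_ge0 // invr_ge0 ?sqr_ge0 // ltW.
Qed.

Definition em_sum (t : R) N x := \sum_(i < N) b i * gauss_deriv t i x.

Definition theta_term (a t : R) (j : nat) : R :=
  2 * (j%:R + a) * expR (- t * (j%:R + a) ^+ 2).

Lemma theta_termE a t j : 0 < t -> theta_term a t j = - gauss_deriv t 1 (a +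
  j%:R) / t.
Proof.
move=> t0; rewrite /theta_term /gauss_deriv /= subr0 mulr1 (addrC j%:R).
by field; rewrite gt_eqF.
Qed.

(** Up to the factor - 1 / t, [theta_term] is the first derivative of the Gaussian at a + j, so the
    Euler-Maclaurin steps telescope. Order 2 (L + 1) gives t^(L+1) for the error, and one power is
    spent on summability. *)
Lemma theta_partial (a : R) L : 2^-1 <= a -> exists2 C : R, 0 <= C &
  forall t, 0 < t -> forall J,
  `|t * \sum_(j < J) theta_term a t j - (em_sum t L.+1.*2 a - em_sum t L.+1.*2
    (a + J%:R))|
  <= C * t ^+ L.
Proof.
move=> a2; have a0 : 0 < a by apply: lt_le_trans a2; rewrite invr_gt0.
have [C C0 H] := @gauss_even_bound R L.+1.
pose B : R := \sum_(i < L.+1.*2) `|b i|.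
have B0 : 0 <= B by apply: sumr_ge0.
exists (B * C * 6); first by rewrite !mulr_ge0.
move=> t t0 J; set N := L.+1.*2.
have step j : `|em_sum t N (a + j%:R + 1) - em_sum t N (a + j%:R) -
    gauss_deriv t 1 (a + j%:R)| <= B * (C * t ^+ L * ((a + j%:R) ^+ 2)^-1).
  apply: euler_maclaurin_step => // [n y|y /andP[y1 y2]];
    first exact: is_derive_gauss.
  have p : 0 < a + j%:R by rewrite ltr_wpDr.
  have py : 0 < y by exact: lt_le_trans y1.
  have := H t y t0; rewrite -ler_pdivlMr; last by rewrite mulr_gt0 // exprn_gt0.
  move/le_trans; apply; rewrite exprS.
  have -> : C * (t * t ^+ L) / (t * y ^+ 2) = C * t ^+ L * (y ^+ 2)^-1.
    by field; rewrite !gt_eqF.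
  apply: ler_wpM2l; first by rewrite mulr_ge0 // exprn_ge0 // ltW.
  rewrite lef_pV2 ?posrE ?exprn_gt0 //.
  by apply: lerXn2r => //; rewrite nnegrE ltW.
have E : t * \sum_(j < J) theta_term a t j - (em_sum t N a - em_sum t N (a +
  J%:R)) =
  \sum_(j < J) (em_sum t N (a + j%:R + 1) - em_sum t N (a +
    j%:R) - gauss_deriv t 1 (a + j%:R)).
  elim: J => [|J IH]; first by rewrite !big_ord0 mulr0 mulr0n addr0 subrr subrr.
  rewrite !big_ord_recr /= -IH mulrDr theta_termE // -natr1 addrA.
  have -> : t * (- gauss_deriv t 1 (a + J%:R) / t) = - gauss_deriv t 1 (a +
    J%:R).
    by field; rewrite gt_eqF.
  by ring.
rewrite E; apply: le_trans (ler_norm_sum _ _ _) _.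
apply: (@le_trans _ _ (\sum_(j < J) B * (C * t ^+ L * ((a + j%:R) ^+ 2)^-1))).
  by apply: ler_sum => j _; exact: step.
rewrite -mulr_sumr -mulr_sumr.
have -> : B * C * 6 * t ^+ L = B * (C * t ^+ L * 6) by ring.
apply: ler_wpM2l => //; apply: ler_wpM2l; last exact: sum_inv_sqr_le.
by rewrite mulr_ge0 // exprn_ge0 // ltW.
Qed.

Lemma em_sum_cvg0 (a t : R) N : 0 < t -> 2^-1 <= a ->
  (fun J : nat => em_sum t N (a + J%:R)) @ \oo --> (0 : R).
Proof.
move=> t0 a2; rewrite /em_sum.
elim: N => [|N IH].
  by under eq_fun do rewrite big_ord0; exact: cvg_cst.
under eq_fun do rewrite big_ord_recr /=.
have c1 : (fun J : nat => b N * gauss_deriv t N (a + J%:R)) @ \oo --> b N * 0.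
  by apply: cvgMr; exact: gauss_cvg0.
have c2 := cvgD IH c1; rewrite mulr0 addr0 in c2; exact: c2.
Qed.

(** The terms are nonnegative, and [theta_partial] with L = 0 bounds the partial sums. *)
Lemma theta_cvg (a : R) t : 2^-1 <= a -> 0 < t ->
  cvgn (series (theta_term a t)).
Proof.
move=> a2 t0; have a0 : 0 < a by apply: lt_le_trans a2; rewrite invr_gt0.
have [C C0 H] := theta_partial 0 a2.
have cE := em_sum_cvg0 2 t0 a2.
have [M [Mr HM]] := cvg_seq_bounded (cvgP _ cE).
have MB J : `|em_sum t 2 (a + J%:R)| <= M + 1 by apply: HM => //; rewrite ltrDl.
apply: nondecreasing_is_cvgn.
  apply/nondecreasing_seqP => n; rewrite /series /= big_nat_recr //= lerDl.
  by rewrite !mulr_ge0 ?expR_ge0 // addr_ge0 // ltW.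
exists ((C + `|em_sum t 2 a| + (M + 1)) / t) => _ [J _ <-].
rewrite ler_pdivlMr // mulrC /series /= big_mkord.
have := H t t0 J; rewrite expr0 mulr1 => HJ.
have := ler_norm (t * \sum_(j < J) theta_term a t j - (em_sum t 2 a - em_sum t
  2 (a + J%:R))).
have := ler_norm (em_sum t 2 a); have := MB J;
  have := ler_norm (- em_sum t 2 (a + J%:R)).
rewrite normrN; lra.
Qed.

Definition theta (a t : R) : R := limn (series (theta_term a t)).

Lemma theta_em (a : R) L : 2^-1 <= a -> exists2 C : R, 0 <= C &
  forall t, 0 < t -> `|t * theta a t - em_sum t L.+1.*2 a| <= C * t ^+ L.
Proof.
move=> a2; have [C C0 H] := theta_partial L a2; exists C => // t t0.
have cS := theta_cvg a2 t0; have cE := em_sum_cvg0 L.+1.*2 t0 a2.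
have c1 : (fun J : nat => `|t * series (theta_term a t) J -
    (em_sum t L.+1.*2 a - em_sum t L.+1.*2 (a + J%:R))|) @ \oo -->
    `|t * theta a t - (em_sum t L.+1.*2 a - 0)|.
  apply: cvg_norm; apply: cvgB; first exact: cvgMr.
  by apply: cvgB => //; exact: cvg_cst.
rewrite subr0 in c1; rewrite -(cvg_lim (@Rhausdorff R) c1).
apply: limr_le; first exact: cvgP c1.
by apply: nearW => J; have := H t t0 J; rewrite /series /= big_mkord.
Qed.

End Theta.

(** * Expansion in t *)

Section Expansion.
Variable R : realType.
Local Notation b i := (bernoulli R i / i`!%:R).

Lemma exp_taylor K (x : R) :
  `|expR x - \sum_(k < K) x ^+ k / k`!%:R| <= `|x| ^+ K * expR `|x|.
Proof.
elim: K x => [|K IH] x.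
  by rewrite big_ord0 subr0 expr0 mul1r ger0_norm ?expR_ge0 // ler_expR
    ler_norm.
pose P n : {poly R} := \poly_(k < n) (k`!%:R)^-1.
have PE n y : (P n).[y] = \sum_(k < n) y ^+ k / k`!%:R.
  by rewrite horner_poly; apply: eq_bigr => k _; rewrite mulrC.
have P' n : (P n.+1)^`() = P n.
  apply/polyP => i; rewrite coef_deriv !coef_poly ltnS; case: ifP => _;
    last by rewrite mul0rn.
  have f0 := fact_neq0 R i; have n0 : i.+1%:R != 0 :> R by rewrite pnatr_eq0.
  by rewrite -[LHS]mulr_natl factS natrM invfM mulrA divff // mul1r.
pose f (s : R) := expR (x * s) - (P K.+1).[x * s].
have Dx (s : R) : is_derive s 1 (fun s => x * s) x.
  have := is_derive_horner (x *: 'X) s; rewrite derivZ derivX hornerZ hornerC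
    mulr1.
  by under eq_fun do rewrite hornerZ hornerX.
have Df (s : R) : is_derive s 1 f (expR (x * s) * x - (P K).[x * s] * x).
  have D1 : is_derive s 1 (fun s => expR (x * s)) (expR (x * s) * x).
    exact: (is_derive1_comp (f := @expR R) (g := fun s =>
      x * s) (is_derive_expR _) (Dx s)).
  have D2 : is_derive s 1 (fun s => (P K.+1).[x * s]) ((P K).[x * s] * x).
    have := is_derive1_comp (f := horner (P K.+1)) (g := fun s => x * s)
      (is_derive_horner (P K.+1) (x * s)) (Dx s).
    by rewrite P'.
  exact: is_deriveB D1 D2.
have B (s : R) : 0 <= s <= 1 ->
    `|expR (x * s) * x - (P K).[x * s] * x| <= `|x| ^+ K.+1 * expR `|x|.
  move=> /andP[s0 s1]; rewrite -mulrBl normrM PE exprSr mulrAC ler_wpM2r //.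
  have sx : `|x * s| <= `|x| by rewrite normrM (ger0_norm s0) ler_piMr.
  apply: le_trans (IH _) _; apply: ler_pM; rewrite ?exprn_ge0 ?expR_ge0
    ?ler_expR //.
  exact: lerXn2r.
have f0 : f 0 = 0.
  rewrite /f !mulr0 expR0 PE big_ord_recl expr0 fact0 divr1 big1 ?addr0 ?subrr
    //.
  by move=> i _; rewrite lift0 expr0n mul0r.
have := mvt_bound ler01 Df B f0; by rewrite /f !mulr1 PE.
Qed.

Lemma derivn_mulX (p : {poly R}) n :
  ('X * p)^`(n) = 'X * p^`(n) + n%:R *: p^`(n.-1).
Proof.
elim: n => [|n IH]; first by rewrite scale0r addr0.
rewrite !derivnS IH derivD derivZ derivM derivX mul1r.
rewrite (addrC p^`(n)) -addrA; congr (_ + _).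
have -> : n%:R *: p^`(n.-1)^`() = n%:R *: p^`(n).
  by case: n {IH} => [|n]; rewrite ?scale0r // derivnS.
by rewrite -[n.+1%:R]natr1 scalerDl scale1r addrC.
Qed.

Definition gauss_poly (t : R) K : {poly R} :=
  \sum_(k < K.+1) ((- t) ^+ k / k`!%:R) *: 'X^(2 * k).

(** [gauss_poly], the expansion of e^(- t x^2) in powers of t, satisfies the Gaussian's equation g'
    = - 2 t x g except for a defect of order t^(K+1). *)
Lemma deriv_gauss_poly t K : (gauss_poly t K)^`() =
  (- (2 * t)) *: ('X * gauss_poly t K) +
  (2 * t * ((- t) ^+ K / K`!%:R)) *: 'X^((2 * K).+1).
Proof.
rewrite /gauss_poly; elim: K => [|K IH].
  rewrite !big_ord1 !muln0 derivZ expr0 fact0 divr1 !mulr1 !scale1r.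
  by rewrite -[1]/(1%:P) derivC mulr1 expr1 -scalerDl addNr scale0r.
rewrite big_ord_recr derivD IH /=.
set A := \sum_(k < K.+1) _; rewrite derivZ derivXn.
have c : (- t) ^+ K.+1 / K.+1`!%:R * (2 * K.+1)%:R = - (2 * t * ((- t) ^+
  K / K`!%:R)) :> R.
  have f0 := fact_neq0 R K; have n0 : K.+1%:R != 0 :> R by rewrite pnatr_eq0.
  by rewrite factS !natrM exprS; field; rewrite f0 -natr1 addrC in n0 *;
    rewrite n0.
rewrite -[_ *+ (2 * K.+1)]scaler_nat scalerA c mulnS /=.
have -> : 'X * (A + ((- t) ^+ K.+1 / K.+1`!%:R) *: 'X^(2 + 2 * K)) =
    'X * A + ((- t) ^+ K.+1 / K.+1`!%:R) *: 'X^((2 + 2 * K).+1).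
  by rewrite mulrDr -scalerAr -exprS.
rewrite scalerDr scalerA -!addrA; congr (_ + _).
by rewrite -scalerDl addrN scale0r -scalerDl mulNr addNr scale0r.
Qed.

(** Differentiating that equation, the errors [rho t n] obey the recurrence of [herm] up to a defect
    O(t^(K+1)). So the estimate spreads from n = 0, where it is Taylor's formula for the
    exponential, to all n. *)
Lemma gauss_expand (a : R) K n : exists2 C : R, 0 <= C & forall t, 0 < t ->
  t <= 1 ->
  `|gauss_deriv t n a - (gauss_poly t K)^`(n).[a]| <= C * t ^+ K.+1.
Proof.
pose r n := `|('X^((2 * K).+1) : {poly R})^`(n).[a]|.
pose rho t n := gauss_deriv t n a - (gauss_poly t K)^`(n).[a].
have rhoS t n' : 0 < t -> t <= 1 ->
    `|rho t n'.+1| <= 2 * `|a| * `|rho t n'| + 2 * n'%:R * `|rho t n'.-1| +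
      2 * r n' * t ^+ K.+1.
  move=> t0 t1; have tp := ltW t0.
  have E : rho t n'.+1 = - (2 * t * a) * rho t n' - 2 * t * n'%:R * rho t n'.-1
     - 2 * t * ((- t) ^+ K / K`!%:R) * ('X^((2 * K).+1) : {poly R})^`(n').[a].
    rewrite /rho /gauss_deriv hermS derivSn deriv_gauss_poly derivnD !derivnZ.
    rewrite derivn_mulX hornerD !hornerZ hornerD hornerM hornerX hornerZ.
    by set e := expR _; set A := _.[a]; set B := _.[a]; set D := _.[a]; ring.
  rewrite E; apply: le_trans (ler_normB _ _) _; apply: lerD.
    apply: le_trans (ler_normB _ _) _; apply: lerD.
      rewrite mulNr normrN !normrM normr_nat (ger0_norm tp).
      by rewrite ler_wpM2r // ler_wpM2r // ler_piMr.
    rewrite !normrM !normr_nat (ger0_norm tp).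
    by rewrite ler_wpM2r // ler_wpM2r // ler_piMr.
  rewrite !normrM normfV normrX normrN !normr_nat (ger0_norm tp) -/(r n')
    [leRHS]mulrAC.
  rewrite ler_wpM2r ?/r ?normr_ge0 // -mulrA ler_wpM2l // mulrA -exprS.
  by rewrite ler_piMr ?exprn_ge0 // invf_le1 ?ltr0n ?fact_gt0 // ler1n fact_gt0.
have two : exists2 C : R, 0 <= C & forall t, 0 < t -> t <= 1 ->
   `|rho t n| <= C * t ^+ K.+1 /\ `|rho t n.-1| <= C * t ^+ K.+1.
  elim: n => [|n [C C0 IH]].
    exists ((a ^+ 2) ^+ K.+1 * expR (a ^+ 2));
      first by rewrite mulr_ge0 ?expR_ge0 // exprn_ge0 ?sqr_ge0.
    move=> t t0 t1; suff H : `|rho t 0| <= (a ^+ 2) ^+ K.+1 * expR (a ^+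
      2) * t ^+ K.+1 by [].
    have E : rho t 0%N = expR (- t * a ^+ 2) - \sum_(k < K.+1) (- t * a ^+
      2) ^+ k / k`!%:R.
      rewrite /rho /gauss_deriv /= mul1r /gauss_poly horner_sum; congr (_ - _).
      apply: eq_bigr => k _; rewrite hornerZ hornerXn exprMn -exprM mulrAC.
      by [].
    rewrite E; apply: le_trans (exp_taylor _ _) _.
    have -> : `|- t * a ^+ 2| = t * a ^+ 2.
      by rewrite mulNr normrN ger0_norm // mulr_ge0 ?sqr_ge0 // ltW.
    rewrite exprMn [leRHS]mulrC [leRHS]mulrA; apply: ler_wpM2l.
      by apply: mulr_ge0; apply: exprn_ge0; [exact: ltW | exact: sqr_ge0].
    by rewrite ler_expR ler_piMl // sqr_ge0.
  exists (C + (2 * `|a| * C + 2 * n%:R * C + 2 * r n)).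
    by rewrite !addr_ge0 // ?mulr_ge0 ?normr_ge0 // /r.
  move=> t t0 t1; have [I1 I2] := IH t t0 t1.
  have tK : 0 <= t ^+ K.+1 by rewrite exprn_ge0 // ltW.
  split.
    apply: le_trans (rhoS t n t0 t1) _; rewrite [leRHS]mulrDl -[leLHS]add0r.
    apply: lerD; first by rewrite mulr_ge0.
    have -> : (2 * `|a| * C + 2 * n%:R * C + 2 * r n) * t ^+ K.+1 =
      2 * `|a| * (C * t ^+ K.+1) + 2 * n%:R * (C * t ^+ K.+1) + 2 * r n * t ^+
        K.+1 by ring.
    by rewrite !lerD // ler_wpM2l ?mulr_ge0 ?normr_ge0.
  apply: (le_trans I1); rewrite ler_wpM2r // lerDl !addr_ge0 // ?mulr_ge0
    ?normr_ge0 // /r.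
by have [C C0 H] := two; exists C => // t t0 t1; have [] := H t t0 t1.
Qed.

(** B(D) x^n = B_n(x) for each monomial; [M] exceeds the degree, so the truncation at [M] loses no
    nonzero derivative. *)
Lemma gauss_poly_bernoulli (a t : R) K M : (2 * K < M)%N ->
  \sum_(i < M) b i * (gauss_poly t K)^`(i).[a] =
  \sum_(k < K.+1) (- t) ^+ k / k`!%:R * (bernoulli_poly R (2 * k)).[a].
Proof.
move=> KM; have E (i : 'I_M) : b i * (gauss_poly t K)^`(i).[a] =
   \sum_(k < K.+1) (- t) ^+ k / k`!%:R * (b i * ('X^(2 * k) : {poly
     R})^`(i).[a]).
  rewrite /gauss_poly linear_sum horner_sum mulr_sumr; apply: eq_bigr => k _.
  by rewrite linearZ /= hornerZ mulrCA.
under eq_bigr do rewrite E.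
rewrite exchange_big /=; apply: eq_bigr => k _; rewrite -mulr_sumr;
  congr (_ * _).
rewrite bernoulli_polyE.
have kM : ((2 * k).+1 <= M)%N.
  by apply: leq_trans KM; rewrite ltnS leq_pmul2l // -ltnS.
rewrite (big_ord_widen M (fun p => 'C(2 * k, p)%:R * bernoulli R p * a ^+
  (2 * k - p)) kM).
rewrite [RHS]big_mkcond /=; apply: eq_bigr => i _.
rewrite derivnXn hornerMn hornerXn ltnS; case: leqP => ik.
  have f0 := fact_neq0 R i.
  have E2 : (2 * k) ^_ i = ('C(2 * k, i) * i`!)%N by rewrite bin_ffact.
  by rewrite E2 -[X in _ * X]mulr_natr natrM; field.
by rewrite ffact_small // mulr0n mulr0.
Qed.

Lemma theta_asymptotics (a : R) N : 2^-1 <= a -> exists2 C : R, 0 <= C &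
  forall t, 0 < t -> t <= 1 ->
  `|theta a t - (t^-1 - \sum_(k < N.+1) (- t) ^+ k / (k.+1)`!%:R
      * (bernoulli_poly R (2 * k + 2)).[a])| <= C * t ^+ N.+1.
Proof.
(* All estimates are made to order t^(N+2) for [t * theta a t]; the final division by [t] costs one
   power. *)
move=> a2; have [C C0 H] := theta_em N.+2 a2.
pose M := N.+3.*2.
have [D D0 HD] : exists2 D : R, 0 <= D & forall t, 0 < t -> t <= 1 ->
   `|em_sum t M a - \sum_(i < M) b i * (gauss_poly t N.+1)^`(i).[a]| <=
     D * t ^+ N.+2.
  rewrite /em_sum; elim: M => [|M' [D D0 HD]].
    by exists 0 => // t _ _; rewrite !big_ord0 subrr normr0 mul0r.
  have [E E0 HE] := gauss_expand a N.+1 M'.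
  exists (D + `|b M'| * E); first by rewrite addr_ge0 // mulr_ge0.
  move=> t t0 t1; rewrite !big_ord_recr /= opprD addrACA mulrDl.
  apply: le_trans (ler_normD _ _) _; apply: lerD; first exact: HD.
  by rewrite -mulrBr normrM -mulrA ler_wpM2l // HE.
exists (C + D); first by rewrite addr_ge0.
move=> t t0 t1; have := HD t t0 t1; rewrite gauss_poly_bernoulli;
  last by rewrite /M; lia.
(* The term k = 0 becomes [t^-1]; dividing the others by [t] shifts k, whence B_(2k+2), (k + 1)! and
   the minus sign. *)
have B0 : (bernoulli_poly R (2 * 0)).[a] = 1.
  by rewrite muln0 bernoulli_polyE big_ord1 bin0 subnn expr0 mulr1 mul1r.
rewrite big_ord_recl expr0 fact0 divr1 mul1r B0.
set T := \sum_(i < N.+1) _ => HT.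
have ET : T = - t * \sum_(k < N.+1) (- t) ^+ k / (k.+1)`!%:R * (bernoulli_poly
  R (2 * k + 2)).[a].
  rewrite mulr_sumr; apply: eq_bigr => k _.
  by rewrite lift0 exprS mulnS addnC !mulrA.
have H2 := H t t0; rewrite -/M in H2.
have key : `|t * theta a t - (1 + T)| <= (C + D) * t ^+ N.+2.
  rewrite mulrDl; apply: le_trans (ler_distD (em_sum t M a) _ _) _.
  exact: lerD.
have t00 : t != 0 by rewrite gt_eqF.
set S := \sum_(k < N.+1) _ in ET *.
have E : theta a t - (t^-1 - S) = t^-1 * (t * theta a t - (1 + T)).
  by rewrite ET; field.
rewrite E normrM (gtr0_norm (_ : 0 < t^-1)) ?invr_gt0 // mulrC ler_pdivrMr //.
by apply: (le_trans key); rewrite [t ^+ N.+2]exprSr mulrA.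
Qed.

End Expansion.

(** * The asymptotic expansion of the heat trace *)

Section BernoulliValues.
Variable R : realType.

Lemma bernoulli_values : [/\ bernoulli R 0 = 1, bernoulli R 1 = - (1 / 2),
  bernoulli R 2 = 1 / 6, bernoulli R 3 = 0 & bernoulli R 4 = - (1 / 30)] /\
  [/\ bernoulli R 5 = 0, bernoulli R 6 = 1 / 42, bernoulli R 7 = 0 &
      bernoulli R 8 = - (1 / 30)].
Proof.
have B0 : bernoulli R 0 = 1 by [].
have B1 : bernoulli R 1 = - (1 / 2).
  have := sum_bernoulli R 1.
  have -> : \sum_(i < 2) 'C(2, i)%:R * bernoulli R i =
    1 * bernoulli R 0 + 2 * bernoulli R 1.
    by rewrite !big_ord_recr big_ord0 /= add0r.
  by rewrite B0 /=; lra.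
have B2 : bernoulli R 2 = 1 / 6.
  have := sum_bernoulli R 2.
  have -> : \sum_(i < 3) 'C(3, i)%:R * bernoulli R i =
    1 * bernoulli R 0 + 3 * bernoulli R 1 + 3 * bernoulli R 2.
    by rewrite !big_ord_recr big_ord0 /= add0r.
  by rewrite B0 B1 /=; lra.
have B3 : bernoulli R 3 = 0.
  have := sum_bernoulli R 3.
  have -> : \sum_(i < 4) 'C(4, i)%:R * bernoulli R i =
    1 * bernoulli R 0 + 4 * bernoulli R 1 + 6 * bernoulli R 2 +
      4 * bernoulli R 3.
    by rewrite !big_ord_recr big_ord0 /= add0r.
  by rewrite B0 B1 B2 /=; lra.
have B4 : bernoulli R 4 = - (1 / 30).
  have := sum_bernoulli R 4.
  have -> : \sum_(i < 5) 'C(5, i)%:R * bernoulli R i =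
    1 * bernoulli R 0 + 5 * bernoulli R 1 + 10 * bernoulli R 2 +
      10 * bernoulli R 3 + 5 * bernoulli R 4.
    by rewrite !big_ord_recr big_ord0 /= add0r.
  by rewrite B0 B1 B2 B3 /=; lra.
have B5 : bernoulli R 5 = 0.
  have := sum_bernoulli R 5.
  have -> : \sum_(i < 6) 'C(6, i)%:R * bernoulli R i =
    1 * bernoulli R 0 + 6 * bernoulli R 1 + 15 * bernoulli R 2 +
      20 * bernoulli R 3 + 15 * bernoulli R 4 + 6 * bernoulli R 5.
    by rewrite !big_ord_recr big_ord0 /= add0r.
  by rewrite B0 B1 B2 B3 B4 /=; lra.
have B6 : bernoulli R 6 = 1 / 42.
  have := sum_bernoulli R 6.
  have -> : \sum_(i < 7) 'C(7, i)%:R * bernoulli R i =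
    1 * bernoulli R 0 + 7 * bernoulli R 1 + 21 * bernoulli R 2 +
      35 * bernoulli R 3 + 35 * bernoulli R 4 + 21 * bernoulli R 5 +
      7 * bernoulli R 6.
    by rewrite !big_ord_recr big_ord0 /= add0r.
  by rewrite B0 B1 B2 B3 B4 B5 /=; lra.
have B7 : bernoulli R 7 = 0.
  have := sum_bernoulli R 7.
  have -> : \sum_(i < 8) 'C(8, i)%:R * bernoulli R i =
    1 * bernoulli R 0 + 8 * bernoulli R 1 + 28 * bernoulli R 2 +
      56 * bernoulli R 3 + 70 * bernoulli R 4 + 56 * bernoulli R 5 +
      28 * bernoulli R 6 + 8 * bernoulli R 7.
    by rewrite !big_ord_recr big_ord0 /= add0r.
  by rewrite B0 B1 B2 B3 B4 B5 B6 /=; lra.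
have B8 : bernoulli R 8 = - (1 / 30).
  have := sum_bernoulli R 8.
  have -> : \sum_(i < 9) 'C(9, i)%:R * bernoulli R i =
    1 * bernoulli R 0 + 9 * bernoulli R 1 + 36 * bernoulli R 2 +
      84 * bernoulli R 3 + 126 * bernoulli R 4 + 126 * bernoulli R 5 +
      84 * bernoulli R 6 + 36 * bernoulli R 7 + 9 * bernoulli R 8.
    by rewrite !big_ord_recr big_ord0 /= add0r.
  by rewrite B0 B1 B2 B3 B4 B5 B6 B7 /=; lra.
by [].
Qed.

Lemma eqO_right (f : R -> R) n (C : R) : 0 <= C ->
  (forall t, 0 < t -> t <= 1 -> `|f t| <= C * t ^+ n) ->
  f =O_ ((0 : R)^'+) (fun t : R => t ^+ n).
Proof.
move=> C0 H; apply/eqO_exP; exists (C + 1); first by rewrite ltr_wpDl.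
near=> t.
have t0 : 0 < t by near: t; exact: nbhs_right_gt.
have t1 : t <= 1 by near: t; apply: nbhs_right_le.
apply: le_trans (H t t0 t1) _; rewrite (ger0_norm (exprn_ge0 _ (ltW t0))).
by rewrite ler_wpM2r ?exprn_ge0 ?(ltW t0) // lerDl.
Unshelve. all: by end_near.
Qed.

Lemma heat_trace_theta (m : nat) (t : R) : 0 < t -> heat_trace m%:Z t =
  (theta ((m%:R + 1) / 2) t * expR (t * ((m%:R ^+ 2 + 1) / 4)))%:E.
Proof.
move=> t0; apply: heat_traceE; apply: theta_cvg => //.
by rewrite -[leLHS]mul1r ler_pM2r ?invr_gt0 // lerDr.
Qed.

(** Only even powers of [x] occur, because B_n(1 - a) = (-1)^n B_n(a) and 1 - a corresponds to - x.
    Order 8 is the last one needed for t^3. *)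
Lemma bernoulli_poly_half_odd (x a : R) : a = (x + 1) / 2 ->
  [/\ (bernoulli_poly R 2).[a] = x ^+ 2 / 4 - 1 / 12,
      (bernoulli_poly R 4).[a] = x ^+ 4 / 16 - x ^+ 2 / 8 + 7 / 240,
      (bernoulli_poly R 6).[a] =
        x ^+ 6 / 64 - 5 * x ^+ 4 / 64 + 7 * x ^+ 2 / 64 - 31 / 1344 &
      (bernoulli_poly R 8).[a] =
        x ^+ 8 / 256 - 7 * x ^+ 6 / 192 + 49 * x ^+ 4 / 384
        - 31 * x ^+ 2 / 192 + 127 / 3840].
Proof.
move=> aE; have [[B0 B1 B2 B3 B4] [B5 B6 B7 B8]] := bernoulli_values.
split; rewrite bernoulli_polyE.
- have -> : \sum_(p < 3) 'C(2, p)%:R * bernoulli R p * a ^+ (2 - p) =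
    1 * bernoulli R 0 * a ^+ 2 + 2 * bernoulli R 1 * a ^+ 1 +
      1 * bernoulli R 2 * a ^+ 0.
    by rewrite !big_ord_recr big_ord0 /= add0r.
  by rewrite B0 B1 B2 aE; field.
- have -> : \sum_(p < 5) 'C(4, p)%:R * bernoulli R p * a ^+ (4 - p) =
    1 * bernoulli R 0 * a ^+ 4 + 4 * bernoulli R 1 * a ^+ 3 +
      6 * bernoulli R 2 * a ^+ 2 + 4 * bernoulli R 3 * a ^+ 1 +
      1 * bernoulli R 4 * a ^+ 0.
    by rewrite !big_ord_recr big_ord0 /= add0r.
  by rewrite B0 B1 B2 B3 B4 aE; field.
- have -> : \sum_(p < 7) 'C(6, p)%:R * bernoulli R p * a ^+ (6 - p) =
    1 * bernoulli R 0 * a ^+ 6 + 6 * bernoulli R 1 * a ^+ 5 +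
      15 * bernoulli R 2 * a ^+ 4 + 20 * bernoulli R 3 * a ^+ 3 +
      15 * bernoulli R 4 * a ^+ 2 + 6 * bernoulli R 5 * a ^+ 1 +
      1 * bernoulli R 6 * a ^+ 0.
    by rewrite !big_ord_recr big_ord0 /= add0r.
  by rewrite B0 B1 B2 B3 B4 B5 B6 aE; field.
- have -> : \sum_(p < 9) 'C(8, p)%:R * bernoulli R p * a ^+ (8 - p) =
    1 * bernoulli R 0 * a ^+ 8 + 8 * bernoulli R 1 * a ^+ 7 +
      28 * bernoulli R 2 * a ^+ 6 + 56 * bernoulli R 3 * a ^+ 5 +
      70 * bernoulli R 4 * a ^+ 4 + 56 * bernoulli R 5 * a ^+ 3 +
      28 * bernoulli R 6 * a ^+ 2 + 8 * bernoulli R 7 * a ^+ 1 +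
      1 * bernoulli R 8 * a ^+ 0.
    by rewrite !big_ord_recr big_ord0 /= add0r.
  by rewrite B0 B1 B2 B3 B4 B5 B6 B7 B8 aE; field.
Qed.

Lemma cubic_bound (a0 a1 a2 a3 t : R) : 0 <= t -> t <= 1 ->
  `|a0 + a1 * t + a2 * t ^+ 2 + a3 * t ^+ 3| <= `|a0| + `|a1| + `|a2| + `|a3|.
Proof.
move=> t0 t1; have H u n : `|u * t ^+ n| <= `|u|.
  by rewrite normrM (ger0_norm (exprn_ge0 n t0)) ler_piMr // exprn_ile1.
apply: le_trans (ler_normD _ _) _; apply: lerD; last exact: H.
apply: le_trans (ler_normD _ _) _; apply: lerD; last exact: H.
by apply: le_trans (ler_normD _ _) _; apply: lerD; last exact: (H a1 1%N).
Qed.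

Lemma fact8E : (8`!)%:R = 8 * 7 * 6 * 5 * 4 * 3 * 2 :> R.
Proof. by rewrite !factS fact0 !natrM mulr1 !mulrA. Qed.

End BernoulliValues.

(* 8`! = 40320; the unary literal is too large to be written directly. *)
Theorem mainTheorem3 (R : realType) (m : nat) :
  (forall N : nat, exists r : R -> R,
     r =O_ ((0 : R)^'+) (fun t : R => t ^+ N.+1) /\
     \forall t \near (0 : R)^'+,
       heat_trace m%:Z t =
       ((t^-1
         - \sum_(k < N.+1) (- t) ^+ k / (k.+1)`!%:R
             * (bernoulli_poly R (2 * k + 2)).[(m%:R + 1) / 2]
         + r t) * expR (t * ((m%:R ^+ 2 + 1) / 4)))%:E) /\
  (exists r : R -> R,
     r =O_ ((0 : R)^'+) (fun t : R => t ^+ 4) /\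
     \forall t \near (0 : R)^'+,
       heat_trace m%:Z t =
       (t^-1 + 1 / 3
        + (1 / 15 - m%:R ^+ 2 / 24) * t
        + (4 / 315 - m%:R ^+ 2 / 40) * t ^+ 2
        + (128 - 432 * m%:R ^+ 2 + 49 * m%:R ^+ 4) / (8`!)%:R * t ^+ 3
        + r t)%:E).
Proof.
pose a : R := (m%:R + 1) / 2; pose c : R := (m%:R ^+ 2 + 1) / 4.
have a2 : 2^-1 <= a by rewrite -[leLHS]mul1r ler_pM2r ?invr_gt0 // lerDr.
split=> [N|].
  have [C C0 H] := theta_asymptotics N a2.
  exists (fun t => theta a t - (t^-1 - \sum_(k < N.+1) (- t) ^+ k / (k.+1)`!%:R
             * (bernoulli_poly R (2 * k + 2)).[a])).
  split; first exact: eqO_right C0 H.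
  near=> t; have t0 : 0 < t by near: t; exact: nbhs_right_gt.
  by rewrite heat_trace_theta // subrKC.
have [C C0 H] := theta_asymptotics 3 a2.
set x : R := m%:R; have [P2 P4 P6 P8] := bernoulli_poly_half_odd (erefl a).
pose beta0 : R := (bernoulli_poly R 2).[a].
pose beta1 : R := - (bernoulli_poly R 4).[a] / 2.
pose beta2 : R := (bernoulli_poly R 6).[a] / 6.
pose beta3 : R := - (bernoulli_poly R 8).[a] / 24.
pose S t := beta0 + beta1 * t + beta2 * t ^+ 2 + beta3 * t ^+ 3.
(* The exponential is expanded to order 4, one beyond the cubic claim, because it is multiplied by
   [t^-1]. *)
pose E t := 1 + c * t + (c * t) ^+ 2 / 2 + (c * t) ^+ 3 / 6 + (c * t) ^+ 4 / 24.
(* These are the coefficients of t^4, ..., t^7 in [- S t * E t], the part of the product beyond the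
   stated expansion. *)
pose q0 := - (beta0 * c ^+ 4 / 24 + beta1 * c ^+ 3 / 6 + beta2 * c ^+ 2 / 2 +
  beta3 * c).
pose q1 := - (beta1 * c ^+ 4 / 24 + beta2 * c ^+ 3 / 6 + beta3 * c ^+ 2 / 2).
pose q2 := - (beta2 * c ^+ 4 / 24 + beta3 * c ^+ 3 / 6).
pose q3 := - (beta3 * c ^+ 4 / 24).
pose Q t := q0 + q1 * t + q2 * t ^+ 2 + q3 * t ^+ 3.
pose p t := t^-1 + 1 / 3 + (1 / 15 - x ^+ 2 / 24) * t
        + (4 / 315 - x ^+ 2 / 40) * t ^+ 2
        + (128 - 432 * x ^+ 2 + 49 * x ^+ 4) / (8`!)%:R * t ^+ 3.
have SE t : \sum_(k < 4) (- t) ^+ k / (k.+1)`!%:R * (bernoulli_poly R (2 * k +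
  2)).[a] = S t.
  rewrite !big_ord_recr big_ord0 /= add0r /S /beta0 /beta1 /beta2 /beta3.
  rewrite !factS fact0 !natrM mulr1.
  by field.
have QE t : t != 0 -> (t^-1 - S t) * E t = p t + t ^+ 4 * Q t.
  move=> t0; rewrite /p /S /E /Q /q0 /q1 /q2 /q3 fact8E /beta0 /beta1 /beta2
    /beta3 P2 P4 P6 P8 /c -/x.
  by field.
exists (fun t => theta a t * expR (t * c) - p t).
have c0 : 0 <= c by rewrite divr_ge0 // addr_ge0 // sqr_ge0.
split; last first.
  near=> t; have t0 : 0 < t by near: t; exact: nbhs_right_gt.
  by rewrite heat_trace_theta // -/(p t) subrKC.
have EE t : \sum_(k < 5) (t * c) ^+ k / k`!%:R = E t.
  rewrite !big_ord_recr big_ord0 /= add0r /E !factS fact0 !natrM mulr1.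
  by field.
pose BS := `|beta0| + `|beta1| + `|beta2| + `|beta3|.
pose BQ := `|q0| + `|q1| + `|q2| + `|q3|.
have BS0 : 0 <= BS by rewrite !addr_ge0.
have BQ0 : 0 <= BQ by rewrite !addr_ge0.
apply: (@eqO_right R _ 4 (C * expR c + (1 + BS) * (c ^+ 5 * expR c) + BQ)).
  by rewrite !addr_ge0 // mulr_ge0 ?expR_ge0 ?addr_ge0 // mulr_ge0 ?exprn_ge0
    ?expR_ge0.
move=> t t0 t1; have tp := ltW t0; have t00 : t != 0 by rewrite gt_eqF.
have tc : `|t * c| = t * c by rewrite ger0_norm // mulr_ge0.
have ec : expR (t * c) <= expR c by rewrite ler_expR ler_piMl.
(* Three errors, each O(t^4): that of [theta], that of the truncated exponential, where [t^-1] meets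
   a remainder of order t^5, and the tail of the polynomial product. *)
have -> : theta a t * expR (t * c) - p t =
   (theta a t - (t^-1 - S t)) * expR (t * c) +
   (1 - t * S t) * (t^-1 * (expR (t * c) - E t)) + t ^+ 4 * Q t.
  have := QE t t00; move/eqP; rewrite -subr_eq => /eqP <-.
  by field.
have H4 : `|theta a t - (t^-1 - S t)| <= C * t ^+ 4 by rewrite -SE; exact: H.
have H5 : `|expR (t * c) - E t| <= (t * c) ^+ 5 * expR (t * c).
  by have := exp_taylor 5 (t * c); rewrite tc EE.
have HS : `|1 - t * S t| <= 1 + BS.
  apply: le_trans (ler_normB _ _) _; rewrite normr1 lerD2l normrM (ger0_norm
    tp).
  by apply: le_trans (cubic_bound _ _ _ _ tp t1); rewrite ler_piMl.
have t4 : 0 <= t ^+ 4 by rewrite exprn_ge0.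
rewrite (_ : (C * _ + _ + _) * _ = C * expR c * t ^+ 4 +
  (1 + BS) * (c ^+ 5 * expR c) * t ^+ 4 + BQ * t ^+ 4); last by ring.
apply: le_trans (ler_normD _ _) _; apply: lerD; last first.
  rewrite normrM (ger0_norm t4) [leRHS]mulrC; apply: ler_wpM2l => //.
  exact: cubic_bound.
apply: le_trans (ler_normD _ _) _; apply: lerD.
  rewrite normrM (ger0_norm (expR_ge0 _)) [leRHS]mulrAC.
  by apply: ler_pM => //; exact: expR_ge0.
rewrite normrM normrM (gtr0_norm (_ : 0 < t^-1)) ?invr_gt0 //.
rewrite -[leRHS]mulrA; apply: ler_pM => //; first by rewrite mulr_ge0 ?invr_ge0.
rewrite mulrC ler_pdivrMr //; apply: (le_trans H5).
have -> : c ^+ 5 * expR c * t ^+ 4 * t = (t * c) ^+ 5 * expR c.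
  by ring.
by rewrite ler_wpM2l // exprn_ge0 // mulr_ge0.
Unshelve. all: by end_near.
Qed.
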